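(* Let $\mathcal{P}$ denote the minimal cost link insertion problem: given candidate link sets $\mathcal{E}^{can}_{\mathcal{X},\mathcal{X}}\subseteq\mathcal{X}\times\mathcal{X}$, $\mathcal{E}^{can}_{\mathcal{U},\mathcal{X}}\subseteq\mathcal{U}\times\mathcal{X}$ and costs $c(e)\ge 0$ for $e\in\mathcal{E}^{can}_{\mathcal{X},\mathcal{X}}\cup\mathcal{E}^{can}_{\mathcal{U},\mathcal{X}}$, determine $$\min\ \sum_{e\in\mathcal{E}_{\mathcal{X},\mathcal{X}}(\Delta\bar A)\cup\mathcal{E}_{\mathcal{U},\mathcal{X}}(\Delta\bar B)}c(e)$$ over all $\Delta\bar A\in\{0,1\}^{n\times n}$, $\Delta\bar B\in\{0,1\}^{n\times q}$ with $\mathcal{E}_{\mathcal{X},\mathcal{X}}(\Delta\bar A)\subseteq\mathcal{E}^{can}_{\mathcal{X},\mathcal{X}}$, $\mathcal{E}_{\mathcal{U},\mathcal{X}}(\Delta\bar B)\subseteq\mathcal{E}^{can}_{\mathcal{U},\mathcal{X}}$ and $(\Delta\bar A,\Delta\bar B)$ structurally controllable. If $\mathcal{P}$ is feasible, then Algorithm 1 (described in the context) is a $2$-approximation algorithm for $\mathcal{P}$ (it returns a feasible solution whose total cost is at most twice the optimal value), with complexity $\mathcal{O}((|\mathcal{U}|+|\mathcal{X}|)^3)$.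
   Context: A structured matrix is represented by a binary matrix, where an entry $1$ denotes a free real parameter and an entry $0$ denotes a fixed zero. A pair $(\bar A,\bar B)$ with $\bar A\in\{0,1\}^{n\times n}$, $\bar B\in\{0,1\}^{n\times q}$ is structurally controllable if there exist real matrices $A\in\mathbb{R}^{n\times n}$, $B\in\mathbb{R}^{n\times q}$ with the sparsity pattern of $(\bar A,\bar B)$ (i.e. $A_{ij}=0$ whenever $\bar A_{ij}=0$, $B_{ij}=0$ whenever $\bar B_{ij}=0$, the other entries being free) such that the linear system $x(t+1)=Ax(t)+Bu(t)$ is controllable. State vertices: $\mathcal{X}=\{x_1,\dots,x_n\}$; input vertices: $\mathcal{U}=\{u_1,\dots,u_q\}$. Links: $\mathcal{E}_{\mathcal{X},\mathcal{X}}(\bar A)=\{(x_i,x_j):\bar A_{ji}\neq 0\}$, $\mathcal{E}_{\mathcal{U},\mathcal{X}}(\bar B)=\{(u_j,x_i):\bar B_{ij}\neq 0\}$. The system digraph is $\mathcal{D}(\bar A,\bar B)=(\mathcal{X}\cup\mathcal{U},\mathcal{E}_{\mathcal{X},\mathcal{X}}(\bar A)\cup\mathcal{E}_{\mathcal{U},\mathcal{X}}(\bar B))$. (The problem of adding a minimal cost set of links from a given candidate set to an existing system so that it becomes structurally controllable is the problem $\mathcal{P}$ in which the already existing links are included among the candidates with cost $0$.) An arborescence is a directed rooted tree in which all edges point away from the root. A minimal spanning forest rooted in $\mathcal{U}$ (with no isolated state vertex) is a union of vertex-disjoint arborescences with roots in $\mathcal{U}$ that covers every state vertex, with total edge cost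 as small as possible. $E(\cdot)$ denotes the edge set. For a digraph on $\mathcal{U}\cup\mathcal{X}$ with edge set $\mathcal{E}\subseteq(\mathcal{U}\cup\mathcal{X})\times\mathcal{X}$, its associated bipartite graph has left vertex set $\mathcal{U}\cup\mathcal{X}$, right vertex set (a copy of) $\mathcal{X}$, and an edge between left vertex $v$ and right vertex $x$ for each $(v,x)\in\mathcal{E}$; a vertex of the right side is right-matched by a matching if it is an endpoint of an edge of the matching. Edges of the bipartite graph are identified with edges of the digraph. Algorithm 1. Input: $\mathcal{E}^{can}_{\mathcal{X},\mathcal{X}},\mathcal{E}^{can}_{\mathcal{U},\mathcal{X}}$ and costs $C=\{c(e)\}$. Step 1: Determine a minimal spanning forest $\mathcal{T}$, rooted in $\mathcal{U}$ and with no isolated state vertex, of the digraph $(\mathcal{U}\cup\mathcal{X},\mathcal{E}^{can}_{\mathcal{X},\mathcal{X}}\cup\mathcal{E}^{can}_{\mathcal{U},\mathcal{X}})$ with edge costs $C$. Step 2: Let $C'$ be obtained from $C$ by setting $c'(e)=0$ for all $e\in E(\mathcal{T})$ and $c'(e)=c(e)$ otherwise. In the bipartite graph associated with $(\mathcal{U}\cup\mathcal{X},\mathcal{E}^{can}_{\mathcal{X},\mathcal{X}}\cup\mathcal{E}^{can}_{\mathcal{U},\mathcal{X}})$ with edge costs $C'$, determine a minimum cost maximum matching $\mathcal{M}$ such that every state vertex is right-matched. Step 3: Let $C''$ be obtained from $C$ by setting $c''(e)=0$ for all $e\in\mathcal{M}$ and $c''(e)=c(e)$ otherwise. Find a minimal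 spanning forest $\mathcal{T}'$, rooted in $\mathcal{U}$, of the digraph $(\mathcal{U}\cup\mathcal{X},E(\mathcal{T})\cup\mathcal{M})$ with edge costs $C''$. Step 4: Return the structured system $(\bar A,\bar B)$ with $\mathcal{D}(\bar A,\bar B)=(\mathcal{U}\cup\mathcal{X},E(\mathcal{T}')\cup\mathcal{M})$. In the complexity bound the minimal spanning forests are computed with Edmonds' algorithm and the minimum cost maximum matching with the Hungarian algorithm; arithmetic operations on costs are counted as unit time. *)

(* Defs.v *)
From mathcomp Require Import all_boot all_order all_algebra.
From mathcomp Require Import reals.

Set Implicit Arguments.
Unset Strict Implicit.
Unset Printing Implicit Defensive.

Import Order.TTheory GRing.Theory Num.Theory.
Local Open Scope ring_scope.

Section Control.
Variables (R : realType) (n q : nat).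

Fixpoint trajectory (A : 'M[R]_n) (B : 'M[R]_(n, q)) (x0 : 'cV[R]_n)
    (u : nat -> 'cV[R]_q) (t : nat) : 'cV[R]_n :=
  if t is s.+1 then A *m trajectory A B x0 u s + B *m u s else x0.

Definition controllable (A : 'M[R]_n) (B : 'M[R]_(n, q)) : Prop :=
  forall x0 x1 : 'cV[R]_n, exists (t : nat) (u : nat -> 'cV[R]_q),
    trajectory A B x0 u t = x1.

Definition has_pattern (k l : nat) (S : 'M[bool]_(k, l)) (A : 'M[R]_(k, l)) :=
  forall i j, ~~ S i j -> A i j = 0.

Definition structurally_controllable (SA : 'M[bool]_n) (SB : 'M[bool]_(n, q)) :=
  exists (A : 'M[R]_n) (B : 'M[R]_(n, q)),
    [/\ has_pattern SA A, has_pattern SB B & controllable A B].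

End Control.

(* [inl i] is the state vertex x_i, [inr j] is the input vertex u_j. *)
Definition vertex (n q : nat) : Type := ('I_n + 'I_q)%type.

(* Every link ends in a state vertex.  A link is at the same time an edge of
   the bipartite graph: left vertex [e.1], right vertex [e.2]. *)
Definition link (n q : nat) : Type := (vertex n q * 'I_n)%type.

Section Links.
Variables (n q : nat).

Definition links_XX (SA : 'M[bool]_n) : {set 'I_n * 'I_n} :=
  [set e | SA e.2 e.1].

Definition links_UX (SB : 'M[bool]_(n, q)) : {set 'I_q * 'I_n} :=
  [set e | SB e.2 e.1].

Definition link_union (EXX : {set 'I_n * 'I_n}) (EUX : {set 'I_q * 'I_n}) :
    {set link n q} :=
  [set ((inl e.1, e.2) : link n q) | e in EXX]
    :|: [set ((inr e.1, e.2) : link n q) | e in EUX].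

Definition system_links (SA : 'M[bool]_n) (SB : 'M[bool]_(n, q)) :=
  link_union (links_XX SA) (links_UX SB).

Definition total_cost (R : realDomainType) (c : link n q -> R)
    (F : {set link n q}) : R :=
  \sum_(e in F) c e.

End Links.

Section Problem.
Variables (R : realType) (n q : nat).
Variables (canXX : {set 'I_n * 'I_n}) (canUX : {set 'I_q * 'I_n}).
Variable c : link n q -> R.

Definition feasible_solution (dA : 'M[bool]_n) (dB : 'M[bool]_(n, q)) : Prop :=
  [/\ links_XX dA \subset canXX, links_UX dB \subset canUX
    & structurally_controllable R dA dB].

Definition feasible : Prop := exists dA dB, feasible_solution dA dB.

Definition optimal_value (v : R) : Prop :=
  (exists dA dB,
     feasible_solution dA dB /\ total_cost c (system_links dA dB) = v) /\
  (forall dA dB,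
     feasible_solution dA dB -> v <= total_cost c (system_links dA dB)).

End Problem.

Section Graphs.
Variables (R : realDomainType) (n q : nat).
Implicit Types (E F M : {set link n q}) (c : link n q -> R).

Definition arc F : rel (vertex n q) :=
  fun v w => if w is inl x then (v, x) \in F else false.

(* The uniqueness of the walk also for [w = r] excludes edges entering [r]. *)
Definition is_arborescence (r : vertex n q) (W : {set vertex n q}) F : Prop :=
  [/\ r \in W,
      forall e, e \in F -> (e.1 \in W) && ((inl e.2 : vertex n q) \in W)
    & forall w, w \in W ->
        exists! p : seq (vertex n q), path (arc F) r p /\ last r p = w].

(* [U] is the set of the inputs that serve as roots; the arborescence rooted
   at [u] has vertex set [W u] and edge set [T u]. *)
Definition spanning_forest F : Prop :=
  exists (U : {set 'I_q}) (W : 'I_q -> {set vertex n q})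
         (T : 'I_q -> {set link n q}),
    [/\ forall u, u \in U -> is_arborescence (inr u) (W u) (T u),
        forall u v, u \in U -> v \in U -> u != v -> [disjoint W u & W v],
        F = \bigcup_(u in U) T u
      & forall x : 'I_n, exists2 u, u \in U & (inl x : vertex n q) \in W u].

Definition minimal_spanning_forest E c F : Prop :=
  [/\ F \subset E, spanning_forest F
    & forall F', F' \subset E -> spanning_forest F' ->
        total_cost c F <= total_cost c F'].

Definition matching E M : Prop :=
  [/\ M \subset E, {in M &, injective fst} & {in M &, injective snd}].

Definition maximum_matching E M : Prop :=
  matching E M /\ forall M', matching E M' -> (#|M'| <= #|M|)%N.

Definition all_right_matched M : Prop :=
  forall x : 'I_n, exists2 e, e \in M & e.2 = x.

Definition min_cost_maximum_matching E c M : Prop :=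
  [/\ maximum_matching E M, all_right_matched M
    & forall M', maximum_matching E M' -> all_right_matched M' ->
        total_cost c M <= total_cost c M'].

Definition zero_on F c : link n q -> R := fun e => if e \in F then 0 else c e.

End Graphs.

Section Algorithm.
Variables (R : realDomainType) (n q : nat).
Variables (canXX : {set 'I_n * 'I_n}) (canUX : {set 'I_q * 'I_n}).
Variable c : link n q -> R.
Implicit Types T M : {set link n q}.

Definition step1 T : Prop :=
  minimal_spanning_forest (link_union canXX canUX) c T.

Definition step2 T M : Prop :=
  min_cost_maximum_matching (link_union canXX canUX) (zero_on T c) M.

Definition step3 T M T' : Prop :=
  minimal_spanning_forest (T :|: M) (zero_on M c) T'.

Definition step4 M T' (SA : 'M[bool]_n) (SB : 'M[bool]_(n, q)) : Prop :=
  system_links SA SB = T' :|: M.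

Definition algorithm1_run T M T' (SA : 'M[bool]_n) (SB : 'M[bool]_(n, q)) :=
  [/\ step1 T, step2 T M, step3 T M T' & step4 M T' SA SB].

End Algorithm.

(* Random access machine.

   Running times are counted on a random access machine with integer and real
   registers.  Registers are grouped into arrays with two indices (a scalar is
   the entry (0, 0) of an array), so that tables are addressed without integer
   multiplication.  The only operations are addition, subtraction (truncated
   on the integers), comparison and indirect addressing.  Every operation
   takes one unit of time.  Real numbers enter a computation only through the
   input and the constant 0, and influence it only through comparisons. *)

Inductive iexp : Type :=
| IConst of nat
| IGet of nat & iexp & iexp
| IAdd of iexp & iexp
| ISub of iexp & iexp.

Inductive rexp : Type :=
| RZero
| RGet of nat & iexp & iexp
| RAdd of rexp & rexp
| RSub of rexp & rexp.

Inductive bexp : Type :=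
| BILe of iexp & iexp
| BRLe of rexp & rexp
| BNot of bexp
| BAnd of bexp & bexp.

Inductive program : Type :=
| Skip
| ISet of nat & iexp & iexp & iexp
| RSet of nat & iexp & iexp & rexp
| Seq of program & program
| If of bexp & program & program
| While of bexp & program.

Fixpoint itime (e : iexp) : nat :=
  match e with
  | IConst _ => 1
  | IGet _ i j => (itime i + itime j).+1
  | IAdd e1 e2 | ISub e1 e2 => (itime e1 + itime e2).+1
  end.

Fixpoint rtime (e : rexp) : nat :=
  match e with
  | RZero => 1
  | RGet _ i j => (itime i + itime j).+1
  | RAdd e1 e2 | RSub e1 e2 => (rtime e1 + rtime e2).+1
  end.

Fixpoint btime (b : bexp) : nat :=
  match b with
  | BILe e1 e2 => (itime e1 + itime e2).+1
  | BRLe e1 e2 => (rtime e1 + rtime e2).+1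
  | BNot b1 => (btime b1).+1
  | BAnd b1 b2 => (btime b1 + btime b2).+1
  end.

Section Machine.
Variable R : realDomainType.

Record memory : Type := Memory {
  ints : nat -> nat -> nat -> nat;
  reals : nat -> nat -> nat -> R
}.

Definition update (D : Type) (f : nat -> nat -> nat -> D) (a i j : nat) (d : D) :=
  fun a' i' j' => if [&& a' == a, i' == i & j' == j] then d else f a' i' j'.

Fixpoint ieval (m : memory) (e : iexp) : nat :=
  match e with
  | IConst k => k
  | IGet a i j => ints m a (ieval m i) (ieval m j)
  | IAdd e1 e2 => (ieval m e1 + ieval m e2)%N
  | ISub e1 e2 => (ieval m e1 - ieval m e2)%N
  end.

Fixpoint reval (m : memory) (e : rexp) : R :=
  match e with
  | RZero => 0
  | RGet a i j => reals m a (ieval m i) (ieval m j)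
  | RAdd e1 e2 => reval m e1 + reval m e2
  | RSub e1 e2 => reval m e1 - reval m e2
  end.

Fixpoint beval (m : memory) (b : bexp) : bool :=
  match b with
  | BILe e1 e2 => (ieval m e1 <= ieval m e2)%N
  | BRLe e1 e2 => reval m e1 <= reval m e2
  | BNot b1 => ~~ beval m b1
  | BAnd b1 b2 => beval m b1 && beval m b2
  end.

(* [exec p m t m']: started in memory [m], the program [p] halts in memory
   [m'] after [t] units of time. *)
Inductive exec : program -> memory -> nat -> memory -> Prop :=
| ExecSkip m : exec Skip m 1 m
| ExecISet a i j e m :
    exec (ISet a i j e) m (itime i + itime j + itime e).+1
      (Memory (update (ints m) a (ieval m i) (ieval m j) (ieval m e)) (reals m))
| ExecRSet a i j e m :
    exec (RSet a i j e) m (itime i + itime j + rtime e).+1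
      (Memory (ints m) (update (reals m) a (ieval m i) (ieval m j) (reval m e)))
| ExecSeq p1 p2 m m1 m2 t1 t2 :
    exec p1 m t1 m1 -> exec p2 m1 t2 m2 -> exec (Seq p1 p2) m (t1 + t2) m2
| ExecIfTrue b p1 p2 m m' t :
    beval m b -> exec p1 m t m' -> exec (If b p1 p2) m (btime b + t).+1 m'
| ExecIfFalse b p1 p2 m m' t :
    ~~ beval m b -> exec p2 m t m' -> exec (If b p1 p2) m (btime b + t).+1 m'
| ExecWhileFalse b p m :
    ~~ beval m b -> exec (While b p) m (btime b).+1 m
| ExecWhileTrue b p m m1 m2 t1 t2 :
    beval m b -> exec p m t1 m1 -> exec (While b p) m1 t2 m2 ->
    exec (While b p) m (btime b + t1 + t2).+1 m2.

Variables (n q : nat).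

Definition vcode (v : vertex n q) : nat :=
  match v with inl i => i | inr j => (n + j)%N end.

(* Integer array 0 holds n and q, integer array 1 the adjacency table of the
   candidate links, real array 0 their costs; all other registers, including
   the costs of non-candidates, are 0. *)
Definition input_memory (canXX : {set 'I_n * 'I_n}) (canUX : {set 'I_q * 'I_n})
    (c : link n q -> R) : memory :=
  let E := link_union canXX canUX in
  Memory
    (fun a i j =>
       match a, i, j with
       | 0%N, 0%N, 0%N => n
       | 0%N, 0%N, 1%N => q
       | 1%N, _, _ =>
           nat_of_bool [exists e in E, (vcode e.1 == i) && (e.2 == j :> nat)]
       | _, _, _ => 0%N
       end)
    (fun a i j =>
       if a is 0%N then
         \sum_(e in E | (vcode e.1 == i) && (e.2 == j :> nat)) c e
       else 0).

Definition stores_links (m : memory) (a : nat) (F : {set link n q}) : Prop :=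
  forall (v : vertex n q) (x : 'I_n),
    (ints m a (vcode v) x != 0%N) = ((v, x) \in F).

Definition stores_matrix (m : memory) (a k l : nat) (S : 'M[bool]_(k, l)) :=
  forall (i : 'I_k) (j : 'I_l), (ints m a i j != 0%N) = S i j.

End Machine.

(* Main.v *)
From mathcomp Require Import fingroup perm.
From mathcomp Require Import all_boot all_order all_algebra.
From mathcomp Require Import zify ring boolp reals.
Require Import Defs.

(** A structured system is structurally controllable iff every state vertex is
    reachable from an input and all state vertices can be right-matched (Lin).
    Necessity is elementary; for sufficiency the matching splits the states into
    paths that start in inputs and cycles, and the cycles are attached one after
    the other, each with a weight that makes it coprime to what drives it.

    An optimal solution contains a spanning forest and a right-perfect matching,
    so T costs at most opt and M costs, beyond T, at most opt; and the cost of
    T' and M together is at most that of T and M.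

    For the running time, spanning forests are computed by a primal-dual form of
    Edmonds' algorithm: raise the dual variable of a strong source component of
    the tight links until one more link becomes tight, keeping the transitive
    closure up to date, which takes at most 2n rounds; then grow the forest by
    Prim's algorithm, always along the oldest link.  Matchings are computed by
    the Hungarian algorithm with slack variables.  All loops have |X| or |U|+|X|
    rounds and are nested at most three deep. *)

Set Implicit Arguments.
Unset Strict Implicit.
Unset Printing Implicit Defensive.

Import Order.TTheory GRing.Theory Num.Theory.
Local Open Scope ring_scope.

(** * Spanning forests *)

(** A spanning forest is treated as a set of links that reaches every state and enters each state at
    most once, and a matching as an injection from states to left endpoints. In this form Lin's
    criterion and the algorithm speak of the same two properties.

    A suitable cycle weight always exists: the polynomials X^k - t^k for distinct positive t are
    pairwise coprime, and a nonzero polynomial can share factors with finitely many of them only.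

    The factor 2 comes from marginal costs: setting the cost of a link to zero once it is bought
    means that each later step is charged only for what it adds.

    Edmonds' algorithm is usually stated with contraction and expansion, which are awkward to bound
    and to verify. Here nothing is contracted: the closure table identifies the components, and the
    order in which links became tight replaces the expansion.

    The programs have no early exit. Each loop runs a number of rounds fixed by n and q and idles
    once its work is done, so the time bound is read off the syntax and correctness concerns a total
    function only. *)

Lemma exists_arg_min (R : realDomainType) (T : finType) (P : T -> Prop)
    (f : T -> R) :
  (exists x, P x) -> exists x, P x /\ forall y, P y -> f x <= f y.
Proof.
case=> x0 /asboolP Px0.
case: (@Order.TotalTheory.arg_minP _ _ _ x0 (fun x => `[< P x >]) f Px0).
by move=> x /asboolP Px min_x; exists x; split=> // y /asboolP; apply: min_x.
Qed.

Lemma connect_crossing (T : finType) (e : rel T) (Q : {set T}) a b :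
  connect e a b -> a \in Q -> b \notin Q ->
  exists v w, [/\ e v w, v \in Q & w \notin Q].
Proof.
case/connectP=> p; elim: p a => [|c p IH] a /=.
  by move=> _ -> aQ; rewrite aQ.
case/andP=> eac pcp El aQ bQ; case: (boolP (c \in Q)) => [cQ|cQ].
  exact: IH pcp El cQ bQ.
by exists a, c.
Qed.

Section Forests.
Variables n q : nat.
Implicit Types (E F M : {set link n q}) (Q : {set vertex n q}).

Definition reachable E : Prop :=
  forall x, exists u, connect (arc E) (inr u : vertex n q) (inl x).

Lemma arc_sub E F : E \subset F -> subrel (arc E) (arc F).
Proof. by move=> /subsetP EF v [x|//] /=; apply: EF. Qed.

Lemma connect_arc_sub E F v w :
  E \subset F -> connect (arc E) v w -> connect (arc F) v w.
Proof.
by move=> EF; apply: connect_sub => a b /(arc_sub EF) /connect1.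
Qed.

Lemma reachable_sub E F : E \subset F -> reachable E -> reachable F.
Proof. by move=> EF rE x; have [u /(connect_arc_sub EF)] := rE x; exists u. Qed.

(** Read both walks backwards: as at most one link of [F] enters a state, the last links coincide,
    and induction applies to what precedes them. No arc ends in an input, so both walks reach their
    start at the same moment. *)
Lemma walk_unique F (u v : 'I_q) p p' :
  {in F &, injective snd} ->
  path (arc F) (inr u : vertex n q) p -> path (arc F) (inr v) p' ->
  last (inr u : vertex n q) p = last (inr v) p' -> u = v /\ p = p'.
Proof.
move=> injF; elim/last_ind: p p' => [|p x IH] p'.
  case/lastP: p' => [_ _ [->] //|p' x _] /=.
  by rewrite rcons_path last_rcons => /andP[_ xF] Ex; rewrite -Ex in xF.
rewrite rcons_path last_rcons; case/andP=> pp xF.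
case/lastP: p' => [_ /= Ex|p' y]; first by rewrite Ex in xF.
rewrite rcons_path last_rcons; case/andP=> pp' yF Exy; rewrite -{y}Exy in yF *.
case: x xF yF => // x /= xF yF.
have [Elast] := injF _ _ xF yF erefl.
by have [-> ->] := IH _ pp pp' Elast.
Qed.

(** From left to right, two links with the same head lie in one tree, by disjointness, and would
    yield two walks from its root to that head. Conversely every input is taken as a root and its
    tree is what it reaches; an input without outgoing links spans only itself. *)
Lemma spanning_forestP F :
  spanning_forest F <-> reachable F /\ {in F &, injective snd}.
Proof.
split=> [[U [W [T [arbT disW -> covW]]]]|[reachF injF]].
  have subT u : u \in U -> T u \subset \bigcup_(u in U) T u.
    by move=> uU; apply: bigcup_sup.
  split=> [x|e e' /bigcupP[u uU eT] /bigcupP[u' u'U eT'] Ee].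
    have [u uU xW] := covW x; exists u.
    have [_ _ /(_ _ xW)[p [[pp pl] _]]] := arbT u uU.
    by apply: (connect_arc_sub (subT u uU)); apply/connectP; exists p.
  have [_ inW uniW] := arbT u uU; have [_ inW' _] := arbT u' u'U.
  have [e1W e2W] := andP (inW _ eT); have [e1W' e2W'] := andP (inW' _ eT').
  have Eu : u' = u.
    apply/eqP; apply: contraT => /(disW _ _ u'U uU) /pred0P /(_ (inl e'.2)) /=.
    by rewrite e2W' -Ee e2W.
  rewrite {u' u'U inW' e2W'}Eu in eT' e1W'.
  have [p [[pp pl] _]] := uniW _ e1W; have [p' [[pp' pl'] _]] := uniW _ e1W'.
  have [p0 [_ uni]] := uniW _ e2W.
  have w1 : path (arc (T u)) (inr u) (rcons p (inl e.2)) /\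
      last (inr u) (rcons p (inl e.2)) = inl e.2.
    by rewrite rcons_path last_rcons pp pl /= -surjective_pairing eT.
  have w2 : path (arc (T u)) (inr u) (rcons p' (inl e.2)) /\
      last (inr u) (rcons p' (inl e.2)) = inl e.2.
    by rewrite rcons_path last_rcons pp' pl' Ee /= -surjective_pairing eT'.
  have := uni _ w1; rewrite (uni _ w2) => /rcons_inj[Ep].
  by rewrite (surjective_pairing e) (surjective_pairing e') -Ee -pl -pl' Ep.
pose W (u : 'I_q) := [set w | connect (arc F) (inr u) w].
pose T (u : 'I_q) := [set e in F | connect (arc F) (inr u) e.1].
have subT u : T u \subset F by apply/subsetP=> e; rewrite inE => /andP[].
exists setT, W, T; split=> [u _|u v _ _|| x].
- split=> [|e|w]; first by rewrite inE connect0.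
    rewrite !inE => /andP[eF e1]; rewrite e1 /=; apply: (connect_trans e1).
    by apply: connect1; rewrite /= -surjective_pairing.
  rewrite inE => /connectP[p pp Ew]; exists p; split; last first.
    move=> p' [pp' El]; apply: proj2 (walk_unique injF pp _ _).
      by apply: sub_path pp'; apply: arc_sub.
    by rewrite -Ew.
  split=> //; elim/last_ind: p pp {w Ew} => // p w IH.
  rewrite !rcons_path => /andP[pp wF]; rewrite IH //=.
  case: w wF => //= x xF; rewrite inE xF /=.
  by apply/connectP; exists p.
- apply: contraNT; rewrite -setI_eq0 => /set0Pn[w]; rewrite !inE.
  case/andP=> /connectP[p pp pl] /connectP[p' pp' pl'].
  by have [-> _] := walk_unique injF pp pp' (etrans (esym pl) pl').
- apply/setP=> e; apply/idP/bigcupP=> [eF|[u _]]; last by rewrite inE => /andP[].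
  case: e eF => -[x|u] y eF; last by exists u; rewrite ?inE // eF connect0.
  by have [u ux] := reachF x; exists u; rewrite ?inE // eF.
by have [u ux] := reachF x; exists u; rewrite ?inE.
Qed.

Definition grown Q F : Prop :=
  [/\ forall u, inr u \in Q,
      {in F &, injective snd},
      forall e, e \in F -> (e.1 \in Q) && (inl e.2 \in Q)
    & forall w, w \in Q -> exists u, connect (arc F) (inr u) w].

Lemma grown0 : grown [set w | if w is inr _ then true else false] set0.
Proof.
split=> [u|e e'|e|w]; rewrite ?inE //.
by case: w => // u _; exists u; apply: connect0.
Qed.

Lemma grown_add Q F v x :
  grown Q F -> v \in Q -> inl x \notin Q -> grown (inl x |: Q) ((v, x) |: F).
Proof.
move=> [inQ injF edgeF reachF] vQ xQ.
have notF e : e \in F -> e.2 != x.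
  by case/edgeF/andP=> _ e2; apply: contraNneq xQ => <-.
split=> [u|e e'|e|w].
- by rewrite in_setU1 inQ orbT.
- rewrite !in_setU1 => /predU1P[->|eF] /predU1P[->|eF'] //= Ex.
  + by have := notF _ eF'; rewrite -Ex eqxx.
  + by have := notF _ eF; rewrite Ex eqxx.
  exact: injF.
- rewrite !in_setU1 => /predU1P[->|/edgeF/andP[-> ->]] /=.
    by rewrite vQ eqxx orbT.
  by rewrite !orbT.
have sF : F \subset (v, x) |: F by apply: subsetUr.
rewrite in_setU1 => /predU1P[->|/reachF[u]]; last first.
  by move=> uw; exists u; apply: connect_arc_sub uw.
have [u uv] := reachF _ vQ; exists u; apply: connect_trans (connect_arc_sub sF uv) _.
by apply: connect1; rewrite /= setU11.
Qed.

Lemma grown_spanning F : grown setT F -> spanning_forest F.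
Proof.
case=> _ injF _ reachF; apply/spanning_forestP; split=> // x.
exact: reachF (in_setT _).
Qed.

Lemma reachable_crossing E Q :
  reachable E -> (forall u, inr u \in Q) -> Q != setT ->
  exists v x, [/\ (v, x) \in E, v \in Q & inl x \notin Q].
Proof.
move=> rE inQ; rewrite -subTset => /subsetPn[w _ wQ].
have [x Ew] : exists x, w = inl x.
  by case: w wQ => [x|u]; [exists x | rewrite inQ].
have [u ux] := rE x; rewrite Ew in wQ.
by have [v [[y|z] [//= vy vQ yQ]]] := connect_crossing ux (inQ u) wQ; exists v, y.
Qed.

(** Serves twice: step 1 has a solution, and every structurally controllable system contains a
    forest, which bounds the cost of [T] by the optimum. *)
Lemma reachable_forest E :
  reachable E -> exists2 F : {set link n q}, F \subset E & spanning_forest F.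
Proof.
move=> rE.
suff ind k : forall Q F, (#|~: Q| <= k)%N -> grown Q F -> F \subset E ->
    exists2 F' : {set link n q}, F' \subset E & spanning_forest F'.
  by apply: (ind _ _ _ (leqnn _) grown0); apply: sub0set.
elim: k => [|k IH] Q F leQ.
  move=> grF FE; exists F => //; apply: grown_spanning; suff <- : Q = setT by [].
  by apply/eqP; rewrite -subTset -setCS setCT subset0 -cards_eq0 -leqn0.
move=> grF FE; have [EQ|nQ] := eqVneq Q setT.
  by exists F => //; apply: grown_spanning; rewrite -EQ.
have [inQ _ _ _] := grF.
have [v [x [vxE vQ xQ]]] := reachable_crossing rE inQ nQ.
apply: (IH _ _ _ (grown_add grF vQ xQ)); last by rewrite subUset sub1set vxE.
rewrite -ltnS; apply: leq_trans leQ; apply: proper_card.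
rewrite setCU properEneq subsetIr andbT; apply: contraNneq xQ => /setP /(_ (inl x)).
by rewrite !inE eqxx /= => /esym/negbFE.
Qed.

End Forests.

(** * Structural controllability *)

Section Trajectories.
Variables (R : realType) (n q : nat).
Implicit Types (A : 'M[R]_n) (B : 'M[R]_(n, q)) (x y : 'cV[R]_n)
  (u v : nat -> 'cV[R]_q).

Lemma trajectoryD A B x y u v t :
  trajectory A B (x + y) (fun s => u s + v s) t =
  trajectory A B x u t + trajectory A B y v t.
Proof. by elim: t => //= t ->; rewrite !mulmxDr addrACA. Qed.

Lemma trajectoryZ A B (a : R) x u t :
  trajectory A B (a *: x) (fun s => a *: u s) t = a *: trajectory A B x u t.
Proof. by elim: t => //= t ->; rewrite scalerDr !scalemxAr. Qed.

Lemma trajectory_ext A B x u v t :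
  (forall s, (s < t)%N -> u s = v s) ->
  trajectory A B x u t = trajectory A B x v t.
Proof.
elim: t => //= t IH uv; rewrite (uv t (ltnSn t)) IH // => s st.
by apply: uv; apply: ltnW.
Qed.

Lemma trajectory_cat A B x u v t T :
  trajectory A B x (fun s => if (s < t)%N then u s else v (s - t)%N) (t + T) =
  trajectory A B (trajectory A B x u t) v T.
Proof.
elim: T => [|T IH]; last first.
  by rewrite addnS /= IH ltnNge leq_addr /= addKn.
by rewrite addn0 /=; apply: trajectory_ext => s ->.
Qed.

Definition reaches_in A B t x : Prop := exists u, trajectory A B 0 u t = x.

Definition reaches A B x : Prop := exists t, reaches_in A B t x.

Lemma reaches_inD A B t x y :
  reaches_in A B t x -> reaches_in A B t y -> reaches_in A B t (x + y).
Proof.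
move=> [u <-] [v <-]; exists (fun s => u s + v s).
by rewrite -trajectoryD addr0.
Qed.

Lemma reaches_inZ A B t a x : reaches_in A B t x -> reaches_in A B t (a *: x).
Proof.
by move=> [u <-]; exists (fun s => a *: u s); rewrite -trajectoryZ scaler0.
Qed.

Lemma reaches_in0 A B t : reaches_in A B t 0.
Proof.
by exists (fun=> 0); elim: t => //= t ->; rewrite !mulmx0 addr0.
Qed.

(** The control is delayed by one idle step, during which the zero state stays put. Hence the sets
    reachable from 0 increase with time. *)
Lemma reaches_inS A B t x : reaches_in A B t x -> reaches_in A B t.+1 x.
Proof.
move=> [u <-]; exists (fun s => if s is r.+1 then u r else 0).
by elim: t => [|t] /=; [rewrite !mulmx0 addr0 | move=> ->].
Qed.

Lemma reaches_in_leq A B t T x :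
  (t <= T)%N -> reaches_in A B t x -> reaches_in A B T x.
Proof.
move=> /subnK <-; elim: (T - t)%N => // k IH rx; rewrite addSn.
by apply: reaches_inS; apply: IH.
Qed.

Lemma reachesD A B x y : reaches A B x -> reaches A B y -> reaches A B (x + y).
Proof.
move=> [t rx] [T ry]; exists (maxn t T); apply: reaches_inD.
  exact: reaches_in_leq (leq_maxl _ _) rx.
exact: reaches_in_leq (leq_maxr _ _) ry.
Qed.

Lemma reachesZ A B a x : reaches A B x -> reaches A B (a *: x).
Proof. by case=> t rx; exists t; apply: reaches_inZ. Qed.

Lemma reaches0 A B : reaches A B 0.
Proof. by exists 0%N; apply: reaches_in0. Qed.

Lemma reachesA A B x : reaches A B x -> reaches A B (A *m x).
Proof.
case=> t [u <-]; exists t.+1, (fun s => if (s < t)%N then u s else 0) => /=.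
rewrite ltnn mulmx0 addr0; congr (_ *m _).
by apply: trajectory_ext => s ->.
Qed.

Lemma reachesB A B (w : 'cV_q) : reaches A B (B *m w).
Proof. by exists 1%N, (fun=> w); rewrite /= mulmx0 add0r. Qed.

Definition unit_col (i : 'I_n) : 'cV[R]_n := delta_mx i 0.

Lemma col_unit_sum x : x = \sum_i x i 0 *: unit_col i.
Proof.
apply/colP=> j; rewrite summxE (bigD1 j) //= big1 ?addr0 => [|i ij].
  by rewrite !mxE !eqxx mulr1.
by rewrite !mxE eq_sym (negbTE ij) mulr0.
Qed.

(** The point is uniformity: reachable sets increase with time, so the largest of finitely many
    horizons serves all vectors at once. *)
Lemma reaches_supported A B (S : {set 'I_n}) :
  (forall i, i \in S -> reaches A B (unit_col i)) ->
  exists T, forall x, (forall i, i \notin S -> x i 0 = 0) -> reaches_in A B T x.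
Proof.
move=> rS.
have /choice[t tS] : forall i, exists t, i \in S -> reaches_in A B t (unit_col i).
  move=> i; case: (boolP (i \in S)) => [/rS[t ri]|_]; first by exists t.
  by exists 0%N.
exists (\max_i t i) => x suppx; rewrite (col_unit_sum x).
apply: (big_ind (reaches_in A B _)) => [|y z|i _].
- exact: reaches_in0.
- exact: reaches_inD.
case: (boolP (i \in S)) => [iS|/suppx->]; last first.
  by rewrite scale0r; apply: reaches_in0.
by apply/reaches_inZ/(reaches_in_leq (leq_bigmax i))/tS.
Qed.

(** The free motion of [x] stays supported on [S] because the other rows of [A] vanish. By linearity
    it is enough to reach from 0 the difference between the target and that motion. The return to 0
    needed for inserting a cycle is an instance. *)
Lemma steer_supported A B (S : {set 'I_n}) :
  (forall i, i \in S -> reaches A B (unit_col i)) ->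
  (forall i j, i \notin S -> A i j = 0) ->
  exists T, forall x y,
    (forall i, i \notin S -> x i 0 = 0) -> (forall i, i \notin S -> y i 0 = 0) ->
    exists u, trajectory A B x u T = y.
Proof.
move=> rS suppA; have [T rT] := reaches_supported rS; exists T => x y sx sy.
pose z := trajectory A B x (fun=> 0) T.
have sz i : i \notin S -> z i 0 = 0.
  rewrite /z; case: (T) => [|k] /=; first exact: sx.
  by move=> iS; rewrite mulmx0 addr0 mxE big1 // => j _; rewrite suppA // mul0r.
have [|u Eu] := rT (y - z); first by move=> i iS; rewrite !mxE sz ?sy // subr0.
exists u; rewrite (@trajectory_ext _ _ _ u (fun s => 0 + u s)); last first.
  by move=> s _; rewrite add0r.
by rewrite -[x]addr0 trajectoryD Eu -/z addrC subrK.
Qed.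

Lemma controllable_reaches A B :
  (forall i, reaches A B (unit_col i)) -> controllable A B.
Proof.
move=> rS; have [|i j|T sT] := @steer_supported A B setT; rewrite ?in_setT //.
by move=> x0 x1; exists T; apply: sT => i; rewrite in_setT.
Qed.

End Trajectories.

(** Two polynomials [f i] and [f j] differ by a nonzero constant, hence are coprime. If [p] shared a
    factor with each of them, the product of these factors would divide [p] and have unbounded
    degree. *)
Lemma exists_power_coprime (R : realType) (p : {poly R}) k : p != 0 -> (0 < k)%N ->
  exists2 t : R, t != 0 & coprimep p ('X^k - (t ^+ k)%:P).
Proof.
move=> p0 k0.
pose f (i : nat) : {poly R} := 'X^k - (i.+1%:R ^+ k)%:P.
suff [i cop] : exists i, coprimep p (f i) by exists i.+1%:R; rewrite ?pnatr_eq0.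
apply/not_existsP => ncop.
have pwf i j : i != j -> coprimep (f i) (f j).
  move=> ij; pose d : R := (j.+1%:R ^+ k - i.+1%:R ^+ k).
  have d0 : d != 0.
    rewrite subr_eq0 eqrXn2 ?ler0n // eqr_nat eqSS eq_sym; exact: ij.
  apply/Bezout_eq1_coprimepP; exists (d^-1%:P, - d^-1%:P) => /=.
  have Ed : f i - f j = d%:P by rewrite /f polyCB opprB addrC addrA subrK.
  by rewrite mulNr -mulrBr Ed -polyCM mulVf.
(* Coprimality of [g] to all later [f i] is carried along, so that the next common factor can be
   multiplied on while the product still divides [p]. *)
have prod_dvd m : exists2 g : {poly R}, g %| p & (m < size g)%N /\
    (forall i, (m <= i)%N -> coprimep g (f i)).
  elim: m => [|m [g gp [sg cg]]].
    exists 1; rewrite ?dvd1p // size_poly1; split=> // i _.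
    by rewrite coprime1p.
  pose h := gcdp p (f m); exists (g * h).
    rewrite Gauss_dvdp ?gp ?dvdp_gcdl //.
    by apply: coprimep_dvdl (dvdp_gcdr _ _) _; rewrite cg.
  have h0 : h != 0 by rewrite gcdp_eq0 negb_and p0.
  have g0 : g != 0 by rewrite -size_poly_gt0; apply: leq_trans sg.
  have sh : (1 < size h)%N.
    have /negP := ncop m; rewrite /coprimep -/h => sh1.
    by rewrite ltn_neqAle eq_sym sh1 size_poly_gt0.
  split=> [|i mi]; last first.
    rewrite coprimepMl cg 1?ltnW //=.
    apply: coprimep_dvdr (dvdp_gcdr _ _) _; rewrite coprimep_sym pwf //.
    by rewrite neq_ltn mi orbT.
  rewrite size_mul //; case: (size h) sh => [|[|s]] // _.
  by rewrite !addnS /= ltnS; apply: leq_trans sg (leq_addr _ _).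
have [g gp [sg _]] := prod_dvd (size p).
by have := dvdp_leq p0 gp; rewrite leqNgt sg.
Qed.

Lemma horner_mxMXaddC_mul (R : realType) (n : nat) (P : 'M[R]_n.+1)
    (e : 'cV[R]_n.+1) (p : {poly R}) (c : R) :
  horner_mx P (p * 'X + c%:P) *m e = P *m (horner_mx P p *m e) + c *: e.
Proof.
rewrite rmorphD rmorphM /= horner_mx_X horner_mx_C mulmxDl mul_scalar_mx.
by rewrite mulmxA; congr (_ *m _ + _); apply: (comm_horner_mx p (erefl : comm_mx P P)).
Qed.

Lemma mul_horner_mx_ann (R : realType) (n m : nat) (C : 'M[R]_(m, n.+1))
    (P : 'M[R]_n.+1) (e : 'cV[R]_n.+1) (p : {poly R}) :
  C *m P = 0 -> C *m e = 0 -> C *m (horner_mx P p *m e) = 0.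
Proof.
move=> CP Ce; elim/poly_ind: p => [|p c _].
  by rewrite rmorph0 mul0mx mulmx0.
by rewrite horner_mxMXaddC_mul mulmxDr -scalemxAr Ce mulmxA CP mul0mx scaler0 addr0.
Qed.

(** * Insertion of a cycle driven by a controllable part *)

Section CycleInsertion.
Variables (R : realType) (n q : nat).
Variables (A : 'M[R]_n.+1) (B : 'M[R]_(n.+1, q)).
Variables (a : 'rV[R]_n.+1) (b : 'rV[R]_q).

(** What the driving link transmits at time [s]: [a] reads off a state and [b] an input, according
    to where the link starts. *)
Definition signal (u : nat -> 'cV[R]_q) s : R :=
  (a *m trajectory A B 0 u s + b *m u s) 0 0.

(** The signal of time [s] becomes the coefficient of X^(t-1-s), because by time [t] it has been
    carried [t-1-s] steps around the cycle. *)
Fixpoint signal_poly u t : {poly R} :=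
  if t is s.+1 then signal_poly u s * 'X + (signal u s)%:P else 0.

Lemma signal_poly_neq0 u s t :
  (s < t)%N -> signal u s != 0 -> signal_poly u t != 0.
Proof.
move=> st us; elim: t st => // t IH; rewrite ltnS leq_eqVlt.
rewrite /= -size_poly_gt0 size_MXaddC => /orP[/eqP <-|/IH nz].
  by rewrite (negbTE us) andbF.
by rewrite (negbTE nz).
Qed.

Variables (P : 'M[R]_n.+1) (e : 'cV[R]_n.+1).
Hypotheses (AP : A *m P = 0) (PA : P *m A = 0) (PB : P *m B = 0).
Hypotheses (Ae : A *m e = 0) (aP : a *m P = 0) (ae : a *m e = 0).

(** Old dynamics [A], cycle [P], and a rank-one term that feeds the signal into the cycle at [e].
    The hypotheses say that the old part and the cycle act on complementary coordinates and that the
    signal does not read the cycle. *)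
Let A' := A + P + e *m a.
Let B' := B + e *m b.

(** The cycle does not feed back, so the old part moves as before, while the cycle accumulates the
    signal by Horner's rule. *)
Lemma trajectory_inserted u t :
  trajectory A' B' 0 u t =
  trajectory A B 0 u t + horner_mx P (signal_poly u t) *m e.
Proof.
elim: t => [|t IH]; first by rewrite /= rmorph0 mul0mx addr0.
have Px : P *m trajectory A B 0 u t = 0.
  by case: (t) => [|s] /=; rewrite ?mulmx0 // mulmxDr !mulmxA PA PB !mul0mx addr0.
have ez (M : 'M[R]_1) : e *m M = M 0 0 *: e.
  by rewrite [M in LHS]mx11_scalar mul_mx_scalar.
rewrite [LHS]/= IH [signal_poly u t.+1]/= horner_mxMXaddC_mul /signal.
rewrite /A' /B' !mulmxDl !mulmxDr Px (mul_horner_mx_ann _ AP Ae).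
rewrite -!(mulmxA e) (mul_horner_mx_ann _ aP ae) mulmx0 addr0 add0r.
rewrite mxE scalerDl -!ez !addr0 /=.
by rewrite addrACA -!addrA; congr (_ + _); rewrite addrCA; congr (_ + _).
Qed.

(** On vectors of the cycle [A'] acts as [P], so the polynomials [p] with [p(P) e] reachable are
    closed under multiplication by X and form an ideal. *)
Lemma reaches_inserted_horner p r :
  reaches A' B' (horner_mx P p *m e) ->
  reaches A' B' (horner_mx P (r * p) *m e).
Proof.
move=> rp; elim/poly_ind: r => [|r c IH].
  by rewrite mul0r rmorph0 mul0mx; apply: reaches0.
rewrite mulrDl rmorphD mulmxDl /= (rmorphM (horner_mx P) c%:P) /= horner_mx_C.
rewrite -(mulmxA c%:M) mul_scalar_mx; apply: reachesD; last exact: reachesZ.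
rewrite mulrAC.
have -> : r * p * 'X = r * p * 'X + 0%:P by rewrite addr0.
rewrite horner_mxMXaddC_mul scale0r addr0.
have <- : A' *m (horner_mx P (r * p) *m e) = P *m (horner_mx P (r * p) *m e).
  rewrite /A' !mulmxDl -(mulmxA e) (mul_horner_mx_ann _ AP Ae).
  by rewrite (mul_horner_mx_ann _ aP ae) mulmx0 addr0 add0r.
exact: reachesA.
Qed.

(** Steering the old part back to 0 leaves exactly [p(P) e] with [p] the signal polynomial. Since
    X^k - t^k annihilates [e], Bezout puts 1 into the ideal of reachable polynomials. For a unit
    vector of [S] the old control is replayed, and the residue that it leaves on the cycle is
    reachable and can be subtracted. *)
Lemma reaches_inserted k t u T (S : {set 'I_n.+1}) :
  trajectory A B 0 u T = 0 ->
  coprimep (signal_poly u T) ('X^k - (t ^+ k)%:P) ->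
  horner_mx P ('X^k) *m e = t ^+ k *: e ->
  (forall i, i \in S -> reaches A B (unit_col R i)) ->
  (forall p, reaches A' B' (horner_mx P p *m e)) /\
  (forall i, i \in S -> reaches A' B' (unit_col R i)).
Proof.
move=> uT0 cop Pk rS.
have rp : reaches A' B' (horner_mx P (signal_poly u T) *m e).
  by exists T, u; rewrite trajectory_inserted uT0 add0r.
have re : reaches A' B' (horner_mx P 1 *m e).
  have [[r1 r2] /= E] := Bezout_eq1_coprimepP _ _ cop.
  rewrite -E rmorphD mulmxDl.
  have -> : horner_mx P (r2 * ('X^k - (t ^+ k)%:P)) *m e = 0.
    rewrite rmorphM /= -mulmxA rmorphB mulmxBl Pk /= horner_mx_C.
    by rewrite mul_scalar_mx subrr mulmx0.
  by rewrite addr0; apply: reaches_inserted_horner.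
have rall p : reaches A' B' (horner_mx P p *m e).
  by rewrite -[p]mulr1; apply: reaches_inserted_horner.
split=> // i /rS[s [v Ev]].
have -> : unit_col R i = trajectory A' B' 0 v s
    + (-1) *: (horner_mx P (signal_poly v s) *m e).
  by rewrite trajectory_inserted Ev scaleN1r addrK.
apply: reachesD; last exact: reachesZ.
by exists s, v.
Qed.

End CycleInsertion.

(** * Sufficiency in Lin's theorem: absorbing the cycles of the matching *)

Section StructuralSufficiency.
Variables (R : realType) (n q : nat) (F : {set link n.+1 q}).
Variable pm : 'I_n.+1 -> vertex n.+1 q.
Hypotheses (pm_inj : injective pm) (pmF : forall x, (pm x, x) \in F).
Implicit Types S : {set 'I_n.+1}.

Definition controllable_part S : Prop :=
  exists (A : 'M[R]_n.+1) (B : 'M[R]_(n.+1, q)),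
    [/\ forall i j, A i j != 0 -> [&& i \in S, j \in S & (inl j, i) \in F],
        forall i j, B i j != 0 -> (i \in S) && ((inr j, i) \in F)
      & forall i, i \in S -> reaches A B (unit_col R i)].

(** [S] is a union of whole paths and cycles of the matching and contains every path that starts in
    an input. Only cycles can remain outside. *)
Definition pm_closed S : Prop :=
  (forall x y, pm y = inl x -> (y \in S) = (x \in S)) /\
  (forall u y, pm y = inr u -> y \in S).

Definition stems : {set 'I_n.+1} :=
  [set x | [exists u, connect (arc [set (pm x, x) | x in 'I_n.+1]) (inr u) (inl x)]].

Lemma mem_pm_links v x :
  ((v, x) \in [set (pm x, x) | x in 'I_n.+1]) = (v == pm x).
Proof. by apply/imsetP/eqP=> [[y _ [-> ->]]|->] //; exists x. Qed.

Lemma stems_closed : pm_closed stems.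
Proof.
split=> [x y Ey|u y Ey]; last first.
  rewrite inE; apply/existsP; exists u; apply: connect1.
  by rewrite /= mem_pm_links Ey.
rewrite !inE; apply/existsP/existsP=> -[u ux]; exists u; last first.
  apply: connect_trans ux _; apply: connect1.
  by rewrite /= mem_pm_links Ey.
case/connectP: ux => p; case/lastP: p => [|p z] //=.
rewrite rcons_path last_rcons => /andP[pp + Ez]; rewrite -{}Ez /=.
by rewrite mem_pm_links Ey => /eqP <-; apply/connectP; exists p.
Qed.

(** With all weights 1 the matrix moves a unit vector one step along its path; injectivity of [pm]
    ensures that the image is a single unit vector. *)
Lemma controllable_stems : controllable_part stems.
Proof.
pose A : 'M[R]_n.+1 := \matrix_(i, j) ((i \in stems) && (pm i == inl j))%:R.
pose B : 'M[R]_(n.+1, q) := \matrix_(i, j) (pm i == inr j)%:R.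
have [cl1 cl2] := stems_closed.
have nat_neq0 (b : bool) : b%:R != 0 :> R -> b by case: b; rewrite ?eqxx.
exists A, B; split=> [i j|i j|x].
- rewrite mxE => /nat_neq0/andP[iS /eqP Ei].
  by rewrite iS -(cl1 _ _ Ei) iS -Ei pmF.
- by rewrite mxE => /nat_neq0/eqP Ei; rewrite (cl2 _ _ Ei) -Ei pmF.
rewrite inE => /existsP[u /connectP[p]].
elim/last_ind: p x => [|p z IH] x //=.
rewrite rcons_path last_rcons => /andP[pp + Ez]; rewrite -{}Ez /= mem_pm_links.
have mulE (m : nat) (C : 'M[R]_(n.+1, m)) j i :
    (C *m (delta_mx j 0 : 'cV_m)) i 0 = C i j.
  by rewrite -colE mxE.
move=> /eqP Ex; case El: (last _ p) Ex => [y|v] Ex.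
  have xS : x \in stems.
    rewrite (cl1 _ _ (esym Ex)) inE; apply/existsP; exists u.
    by apply/connectP; exists p.
  have <- : A *m unit_col R y = unit_col R x.
    apply/colP=> i; rewrite mulE !mxE Ex (inj_eq pm_inj) andbT.
    by case: (eqVneq i x) => [->|]; rewrite ?xS ?andbF.
  by apply/reachesA/IH.
have <- : B *m (delta_mx v 0) = unit_col R x.
  by apply/colP=> i; rewrite mulE !mxE Ex (inj_eq pm_inj) andbT.
exact: reachesB.
Qed.

(* Adds the cycle of [pm] through [c], driven by the link from [w].  A control
   that steers the part [S] from 0 to 0 with a nonzero signal [p] at [w] moves
   the cycle to [p(P) e_c], and this vector is cyclic for [P] as soon as [p] is
   coprime to [X^k - t^k], the characteristic polynomial of the cycle. *)
Lemma controllable_part_add S (w : vertex n.+1 q) c :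
  pm_closed S -> controllable_part S -> (w, c) \in F ->
  (if w is inl s then s \in S else true) -> c \notin S ->
  exists S', [/\ pm_closed S', controllable_part S' & S \proper S'].
Proof.
move=> [cl1 cl2] [A [B [suppA suppB rS]]] wcF wS cS.
(* Outside [S] the map [pm] takes only states as values, so [g] can follow it backwards there.
   Extending it by the identity on [S] gives a total injection, whose orbits off [S] are the
   cycles. *)
pose g y := if y \in S then y else if pm y is inl x then x else y.
have pm_g y : y \notin S -> pm y = inl (g y).
  rewrite /g => yS; rewrite (negbTE yS); case E: (pm y) => [//|u].
  by rewrite (cl2 _ _ E) in yS.
have gS y : (g y \in S) = (y \in S).
  case: (boolP (y \in S)) => yS; first by rewrite /g yS.
  by rewrite -(cl1 _ _ (pm_g _ yS)) (negbTE yS).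
have g_inj : injective g.
  move=> y z E; have := gS y; rewrite E gS.
  case: (boolP (y \in S)) => yS zS; first by rewrite /g yS zS in E.
  by apply: pm_inj; rewrite (pm_g y yS) (pm_g z) ?zS // E.
pose C := [set y | fconnect g c y].
have CS y : y \in C -> y \notin S.
  rewrite inE => /iter_findex <-; elim: (findex _ _ _) => //= k.
  by rewrite gS.
have gC y : (g y \in C) = (y \in C) by rewrite !inE -same_fconnect1_r.
have fC y : (finv g y \in C) = (y \in C) by rewrite -gC f_finv.
have Cc : c \in C by rewrite inE connect0.
pose PP (t : R) : 'M[R]_n.+1 := \matrix_(i, j) (t *+ ((i \in C) && (g i == j))).
have PPe t y : y \in C -> PP t *m unit_col R y = t *: unit_col R (finv g y).
  move=> yC; apply/colP=> i; rewrite -colE !mxE andbT mulr_natr; congr (_ *+ _).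
  rewrite -(inj_eq (@g_inj) i) f_finv //; case: eqVneq => [E|]; rewrite ?andbF //.
  by rewrite -gC E yC.
have PPX t m : horner_mx (PP t) ('X^m) *m unit_col R c
    = t ^+ m *: unit_col R (iter m (finv g) c).
  rewrite rmorphXn /= horner_mx_X.
  have itC k : iter k (finv g) c \in C by elim: k => //= k; rewrite fC.
  elim: m => [|m IH]; first by rewrite !expr0 scale1r mul1mx.
  rewrite exprS -mulmxA IH -scalemxAr PPe // scalerA -exprSr; congr (_ *: _).
pose a : 'rV[R]_n.+1 := if w is inl s then delta_mx 0 s else 0.
pose b : 'rV[R]_q := if w is inr u then delta_mx 0 u else 0.
have a0 j : j \notin S -> a 0 j = 0.
  rewrite /a; case: (w) wS => [s sS|u _]; last by rewrite mxE.
  by move=> jS; rewrite mxE eqxx /=; case: eqVneq jS => // ->; rewrite sS.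
have A0r i j : i \notin S -> A i j = 0.
  by move=> iS; apply: contraNeq iS => /suppA/and3P[].
have A0l i j : j \notin S -> A i j = 0.
  by move=> iS; apply: contraNeq iS => /suppA/and3P[].
have B0 i j : i \notin S -> B i j = 0.
  by move=> iS; apply: contraNeq iS => /suppB/andP[].
have PPr t i j : i \in S -> PP t i j = 0.
  by move=> iS; rewrite mxE (contraTF (@CS i) iS).
have PPl t i j : j \in S -> PP t i j = 0.
  move=> jS; rewrite mxE; case: eqVneq => [E|]; rewrite ?andbF ?andbT //.
  by rewrite -gC E (contraTF (@CS j) jS).
have mulmx_supp m1 m2 (M : 'M[R]_(m1, n.+1)) (N : 'M[R]_(n.+1, m2)) (D : pred 'I_n.+1) :
    (forall i j, ~~ D j -> M i j = 0) -> (forall i j, D i -> N i j = 0) ->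
    M *m N = 0.
  move=> M0 N0; apply/matrixP=> i j; rewrite !mxE big1 // => k _.
  case: (boolP (D k)) => kD; first by rewrite N0 ?mulr0.
  by rewrite M0 ?mul0r.
have e0 i (j : 'I_1) : i \in S -> unit_col R c i j = 0.
  by move=> iS; rewrite mxE; case: eqVneq => //= E; rewrite -E iS in cS.
have [T sT] := steer_supported rS A0r.
have z0 i : i \notin S -> (0 : 'cV[R]_n.+1) i 0 = 0 by rewrite mxE.
(* If [w] is a state, steer 0 to its unit vector and back, so that the signal is 1 at time [T]. If
   [w] is an input, an impulse at time 0 gives signal 1 at once, and the state it causes is steered
   back to 0. *)
have [u [T' [s [uT' sT' sig]]]] : exists u T' s,
    [/\ trajectory A B 0 u T' = 0, (s < T')%N & signal A B a b u s != 0].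
  rewrite /signal /a /b; case: (w) wS => [x xS|v _].
    have ex0 i : i \notin S -> unit_col R x i 0 = 0.
      by move=> iS; rewrite mxE; case: eqVneq iS => // ->; rewrite xS.
    have [u1 E1] := sT _ _ z0 ex0; have [u2 E2] := sT _ _ ex0 z0.
    have T0 : (0 < T)%N.
      case: (T) E1 => //= /colP /(_ x); rewrite !mxE !eqxx => /eqP.
      by rewrite eq_sym oner_eq0.
    exists (fun s => if (s < T)%N then u1 s else u2 (s - T)%N), (T + T)%N, T.
    split; first by rewrite trajectory_cat E1 E2.
      by rewrite -[X in (X < _)%N]addn0 ltn_add2l.
    rewrite -[X in trajectory _ _ _ _ X]addn0 trajectory_cat /= E1 mul0mx addr0.
    by rewrite -rowE !mxE !eqxx oner_eq0.
  have Be i : i \notin S -> (B *m (delta_mx v 0 : 'cV_q)) i 0 = 0.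
    by move=> iS; rewrite -colE mxE B0.
  have [u2 E2] := sT _ _ Be z0.
  exists (fun s => if (s < 1)%N then delta_mx v 0 else u2 (s - 1)%N), (1 + T)%N, 0%N.
  split=> //; first by rewrite trajectory_cat /= mulmx0 add0r E2.
  by rewrite /= mul0mx add0r -rowE !mxE !eqxx oner_eq0.
have p0 := signal_poly_neq0 sT' sig.
have [t t0 cop] := exists_power_coprime p0 (order_gt0 g c).
have itC : iter (order g c) (finv g) c = c by rewrite iter_finv // subnn.
have AP : A *m PP t = 0 by apply: (mulmx_supp _ _ _ _ (mem S)); [apply: A0l | apply: PPr].
have PA : PP t *m A = 0.
  apply: (mulmx_supp _ _ _ _ (fun i => i \notin S)); last exact: A0r.
  by move=> i j /negPn; apply: PPl.
have PB : PP t *m B = 0.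
  apply: (mulmx_supp _ _ _ _ (fun i => i \notin S)); last exact: B0.
  by move=> i j /negPn; apply: PPl.
have Ae : A *m unit_col R c = 0.
  by apply: (mulmx_supp _ _ _ _ (mem S)); [apply: A0l | apply: e0].
have aP : a *m PP t = 0.
  apply: (mulmx_supp _ _ _ _ (mem S)) => [i j|]; last exact: PPr.
  by rewrite ord1; apply: a0.
have ae : a *m unit_col R c = 0.
  apply: (mulmx_supp _ _ _ _ (mem S)) => [i j|]; last exact: e0.
  by rewrite ord1; apply: a0.
have Pk : horner_mx (PP t) ('X^(order g c)) *m unit_col R c
    = t ^+ order g c *: unit_col R c by rewrite PPX itC.
have [rall rS'] := reaches_inserted (b := b) AP PA PB Ae aP ae uT' cop Pk rS.
exists (S :|: C); split.
- split=> [x y E|v y E]; last by rewrite in_setU (cl2 _ _ E).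
  rewrite !in_setU (cl1 _ _ E); case: (boolP (x \in S)) => //= xS.
  have yS : y \notin S by rewrite (cl1 _ _ E).
  by have [<-] := etrans (esym (pm_g _ yS)) E; rewrite gC.
- exists (A + PP t + unit_col R c *m a), (B + unit_col R c *m b).
  have ea m (d : 'rV[R]_m) i j : (unit_col R c *m d) i j = d 0 j *+ (i == c).
    rewrite !mxE big_ord1 !mxE /=; case: eqVneq; rewrite /= ?mul1r ?mul0r ?andbT //.
  split=> [i j|i j|i].
  + rewrite mxE ea mxE.
    have [A0|/suppA/and3P[iS jS ijF] _] := eqVneq (A i j) 0; last first.
      by rewrite !in_setU iS jS.
    have [P0|P1] := eqVneq (PP t i j) 0; last first.
      move=> _; move: P1; rewrite mxE; case: (boolP (i \in C)) => //= [iC|]; rewrite ?eqxx //.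
      have [Ej _|_] := eqVneq (g i) j; last by rewrite eqxx.
      rewrite -Ej.
      by rewrite !in_setU gC iC !orbT -pm_g ?CS ?pmF.
    rewrite A0 P0 !add0r /a; case: (eqVneq i c) => [->|]; rewrite ?eqxx //.
    case: (w) wcF wS => [x|v] wcF wS; rewrite mxE ?eqxx //=.
    case: (eqVneq j x) => [->|]; rewrite ?eqxx //= => _.
    by rewrite !in_setU wS wcF Cc orbT.
  + rewrite mxE ea; have [E0|/suppB/andP[iS ijF] _] := eqVneq (B i j) 0; last first.
      by rewrite !in_setU iS.
    rewrite E0 add0r /b; case: (eqVneq i c) => [->|]; rewrite ?eqxx //.
    case: (w) wcF wS => [x|v] wcF wS; rewrite mxE ?eqxx //=.
    case: (eqVneq j v) => [->|]; rewrite ?eqxx //= => _.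
    by rewrite !in_setU wcF Cc orbT.
  (* The unit vectors of the cycle are the vectors P^m e_c up to the factor [t ^+ m], which is
     invertible because [t] is nonzero. *)
  rewrite in_setU => /orP[/rS'//|]; rewrite inE -(same_fconnect_finv g_inj).
  move=> /iter_findex <-; set m := findex _ _ _.
  have -> : unit_col R (iter m (finv g) c) =
      (t ^+ m)^-1 *: (t ^+ m *: unit_col R (iter m (finv g) c)).
    by rewrite scalerA mulVf ?scale1r // expf_neq0.
  rewrite -PPX; exact: reachesZ.
apply/properP; split; first exact: subsetUl.
by exists c; rewrite // in_setU Cc orbT.
Qed.

End StructuralSufficiency.

Definition perfect (n q : nat) (F : {set link n q}) : Prop :=
  exists2 pm : 'I_n -> vertex n q, injective pm & forall x, (pm x, x) \in F.

Lemma perfect_sub (n q : nat) (E F : {set link n q}) :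
  E \subset F -> perfect E -> perfect F.
Proof.
by move=> /subsetP EF [pm pmI pmE]; exists pm => // x; exact: EF (pmE x).
Qed.

Lemma matching_perfect (n q : nat) (E M : {set link n q}) :
  matching E M -> all_right_matched M -> perfect E.
Proof.
move=> [ME inj1 inj2] allM.
have /choice[pm pmM] : forall x, exists v, (v, x) \in M.
  by move=> x; have [[v y] vM /= <-] := allM x; exists v.
exists pm => [x y Exy|x]; last by have /subsetP -> := ME.
by have [] := inj1 _ _ (pmM x) (pmM y) Exy.
Qed.

(** The right side has only [n] vertices, so a matching that covers all of them is automatically
    maximum. *)
Lemma matching_of_fun (n q : nat) (F : {set link n q}) (pm : 'I_n -> vertex n q) :
  injective pm -> (forall x, (pm x, x) \in F) ->
  let M := [set (pm x, x) | x in 'I_n] in maximum_matching F M /\ all_right_matched M.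
Proof.
move=> pmI pmF M.
have in2 (M' : {set link n q}) : matching F M' -> (#|M'| <= n)%N.
  by case=> _ _ /card_in_imset <-; rewrite -[X in (_ <= X)%N]card_ord max_card.
split; last by move=> x; exists (pm x, x) => //; apply: imset_f.
split; last first.
  move=> M' /in2/leq_trans-> //; rewrite card_imset ?card_ord //.
  by move=> x y [].
split; first by apply/subsetP=> _ /imsetP[x _ ->].
  by move=> _ _ /imsetP[x _ ->] /imsetP[y _ ->] /= /pmI ->.
by move=> _ _ /imsetP[x _ ->] /imsetP[y _ ->] /= ->.
Qed.

Lemma system_links_inl n q (SA : 'M[bool]_n) (SB : 'M[bool]_(n, q)) x y :
  ((inl x, y) \in system_links SA SB) = SA y x.
Proof.
rewrite in_setU; apply/orP/idP=> [[/imsetP[e]|/imsetP[e _ []]] //|Sxy].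
  by rewrite inE => Se [-> ->].
by left; apply/imsetP; exists (x, y); rewrite ?inE.
Qed.

Lemma system_links_inr n q (SA : 'M[bool]_n) (SB : 'M[bool]_(n, q)) u y :
  ((inr u, y) \in system_links SA SB) = SB y u.
Proof.
rewrite in_setU; apply/orP/idP=> [[/imsetP[e _ []]|/imsetP[e]] //|Sxy].
  by rewrite inE => Se [-> ->].
by right; apply/imsetP; exists (u, y); rewrite ?inE.
Qed.

(** * Lin's theorem *)

Section Lin.
Variables (R : realType) (n q : nat).

(** The case without states is split off because a polynomial can be evaluated only at matrices of
    size [m.+1]. Otherwise the part grows from the stems: while it is not everything, reachability
    provides a link from it or from an input to a state outside, whose cycle is then absorbed. *)
Lemma reachable_perfect_controllable (SA : 'M[bool]_n) (SB : 'M[bool]_(n, q)) :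
  reachable (system_links SA SB) -> perfect (system_links SA SB) ->
  structurally_controllable R SA SB.
Proof.
case: n SA SB => [|m] SA SB rF [pm pmI pmF].
  exists 0, 0; split=> [[]|[]|x0 x1] //.
  by exists 0%N, (fun=> 0); apply/matrixP=> -[].
suff [A [B [suppA suppB rS]]] : controllable_part R (system_links SA SB) setT.
  exists A, B; split=> [i j|i j|].
  - by apply: contraNeq => /suppA/and3P[_ _]; rewrite system_links_inl.
  - by apply: contraNeq => /suppB/andP[_]; rewrite system_links_inr.
  by apply: controllable_reaches => i; apply: rS; rewrite in_setT.
suff ind k : forall S, (#|~: S| <= k)%N -> pm_closed pm S ->
    controllable_part R (system_links SA SB) S ->
    controllable_part R (system_links SA SB) setT.
  apply: (ind _ _ (leqnn _) (stems_closed pm)).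
  exact: controllable_stems pmI pmF.
elim: k => [|k IH] S leS.
  suff -> : S = setT by [].
  by apply/eqP; rewrite -subTset -setCS setCT subset0 -cards_eq0 -leqn0.
have [-> //|nT] := eqVneq S setT => clS cS.
pose Q : {set vertex m.+1 q} := [set v | if v is inl s then s \in S else true].
have [||w [c [wcF]]] := reachable_crossing rF (Q := Q).
- by move=> u; rewrite inE.
- apply: contraNneq nT => EQ; apply/eqP/setP=> s.
  by have /setP/(_ (inl s)) := EQ; rewrite !inE.
rewrite !inE => wS cNS.
have [S' [clS' cS' /proper_card ltS]] := controllable_part_add pmI pmF clS cS wcF wS cNS.
apply: (IH S') => //; rewrite -ltnS; apply: leq_trans leS.
by rewrite -(ltn_add2l #|S'|) cardsC -(cardsC S) ltn_add2r.
Qed.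

(** The states that no input reaches receive links only from each other, so their coordinates stay 0
    on every trajectory from 0. *)
Lemma controllable_reachable (SA : 'M[bool]_n) (SB : 'M[bool]_(n, q)) :
  structurally_controllable R SA SB -> reachable (system_links SA SB).
Proof.
move=> [A [B [pA pB ctr]]] x; apply: contrapT => nx.
pose E := system_links SA SB.
pose Z y := ~ exists u, connect (arc E) (inr u : vertex n q) (inl y).
have AZ y z : Z y -> A y z != 0 -> Z z.
  move=> Zy Ayz [u uz]; apply: Zy; exists u; apply: connect_trans uz (connect1 _).
  by rewrite /= /E system_links_inl; apply: contraNT Ayz => /pA ->.
have BZ y u : Z y -> B y u = 0.
  move=> Zy; apply: pB; apply/negP => Syu; apply: Zy; exists u; apply: connect1.
  by rewrite /= /E system_links_inr.
have [t [u Eu]] := ctr 0 (unit_col R x).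
have /(_ t x nx)/eqP : forall t y, Z y -> trajectory A B 0 u t y 0 = 0.
  elim=> [|s IH] y Zy; first by rewrite mxE.
  rewrite /= !mxE !big1 ?addr0 // => z _; first by rewrite BZ ?mul0r.
  have [->|/(AZ _ _ Zy)/IH->] := eqVneq (A y z) 0; first by rewrite mul0r.
  by rewrite mulr0.
by rewrite Eu !mxE !eqxx oner_eq0.
Qed.

(** The last step of a trajectory to a unit vector shows that the vector lies in the image of [A B],
    so [A B] has rank [n]. Some [n] of its columns have nonzero determinant, and a nonzero term of
    the Leibniz expansion is a matching. *)
Lemma controllable_perfect (SA : 'M[bool]_n) (SB : 'M[bool]_(n, q)) :
  structurally_controllable R SA SB -> perfect (system_links SA SB).
Proof.
move=> [A [B [pA pB ctr]]].
have /choice[y Ey] : forall x, exists y, row_mx A B *m y = unit_col R x.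
  move=> x; have [[|t] [u]] := ctr 0 (unit_col R x).
    by move=> /colP/(_ x)/eqP; rewrite !mxE !eqxx eq_sym oner_eq0.
  move=> /= <-; exists (col_mx (trajectory A B 0 u t) (u t)).
  by rewrite mul_row_col.
pose C := \matrix_(i, j) y j i 0.
have rf : row_full (row_mx A B)^T.
  apply/row_fullP; exists C^T; rewrite -trmx_mul -[RHS]trmx1; congr (_^T).
  apply/matrixP=> i j; have /colP/(_ i) := Ey j; rewrite !mxE eqxx andbT => <-.
  by apply: eq_bigr => k _; rewrite !mxE.
have := fullrowsub_unit rf; set f := fullrankfun rf.
rewrite unitmxE unitfE => det0.
have [s ps] : exists s : 'S_n, forall i, row_mx A B (s i) (f i) != 0.
  apply: contrapT => /forallNP none; case/eqP: det0; rewrite /determinant big1 // => s _.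
  have /existsNP[i /negP] := none s; rewrite negbK => /eqP Ei.
  by rewrite (bigD1 i) //= [rowsub _ _ _ _]mxE [(_^T) _ _]mxE Ei mul0r mulr0.
exists (fun x => split (f ((s^-1)%g x))) => [x z|x].
  by move=> /(can_inj splitK)/fullrankfun_inj/perm_inj.
have := ps ((s^-1)%g x); rewrite permKV mxE.
case: (split _) => j; rewrite ?system_links_inl ?system_links_inr.
  by apply: contraNT => /pA ->.
by apply: contraNT => /pB ->.
Qed.

End Lin.

(** * The approximation guarantee *)

Section Approximation.
Variables (R : realType) (n q : nat).
Variables (canXX : {set 'I_n * 'I_n}) (canUX : {set 'I_q * 'I_n}).
Variable c : link n q -> R.
Let E := link_union canXX canUX.
Implicit Types F T M : {set link n q}.

Lemma link_unionP (v : vertex n q) x :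
  ((v, x) \in E) =
  match v with inl y => (y, x) \in canXX | inr u => (u, x) \in canUX end.
Proof.
rewrite in_setU; case: v => [y|u]; apply/orP/idP.
- by case=> /imsetP[[a b] // ab [-> ->]].
- by move=> yx; left; apply/imsetP; exists (y, x).
- by case=> /imsetP[[a b] // ab [-> ->]].
- by move=> yx; right; apply/imsetP; exists (u, x).
Qed.

Lemma feasible_solutionP (SA : 'M[bool]_n) (SB : 'M[bool]_(n, q)) :
  feasible_solution R canXX canUX SA SB <->
  [/\ system_links SA SB \subset E, reachable (system_links SA SB)
    & perfect (system_links SA SB)].
Proof.
split=> [[sA sB ctr]|[/subsetP sE rF pF]].
  split; [|exact: controllable_reachable ctr|exact: controllable_perfect ctr].
  apply/subsetP=> -[[y|u] x]; rewrite link_unionP ?system_links_inl ?system_links_inr => S.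
    by apply: (subsetP sA); rewrite inE.
  by apply: (subsetP sB); rewrite inE.
split; last exact: reachable_perfect_controllable.
  apply/subsetP=> -[y x]; rewrite inE /= => S.
  by have := sE (inl y, x); rewrite link_unionP system_links_inl; apply.
apply/subsetP=> -[y x]; rewrite inE /= => S.
by have := sE (inr y, x); rewrite link_unionP system_links_inr; apply.
Qed.

Lemma system_of_links F : exists SA SB, system_links SA SB = F.
Proof.
exists (\matrix_(i, j) ((inl j, i) \in F)), (\matrix_(i, j) ((inr j, i) \in F)).
by apply/setP=> -[[y|u] x]; rewrite ?system_links_inl ?system_links_inr mxE.
Qed.

Lemma feasible_candidates :
  feasible R canXX canUX -> reachable E /\ perfect E.
Proof.
move=> [SA [SB /feasible_solutionP[sE rF pF]]].
by split; [apply: reachable_sub rF | apply: perfect_sub pF].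
Qed.

Lemma exists_step1 : reachable E -> exists T, step1 canXX canUX c T.
Proof.
move=> /reachable_forest[F FE sF].
have [|T [[TE sT] minT]] := @exists_arg_min R _
    (fun T => T \subset E /\ spanning_forest T) (total_cost c).
  by exists F.
by exists T; split=> // F' *; apply: minT.
Qed.

Lemma exists_step2 T : perfect E -> exists M, step2 canXX canUX c T M.
Proof.
move=> [pm /matching_of_fun pmI /pmI mE].
have [|M [[mM aM] minM]] := @exists_arg_min R _
    (fun M => maximum_matching E M /\ all_right_matched M) (total_cost (zero_on T c)).
  by eexists; exact: mE.
by exists M; split=> // M' *; apply: minM.
Qed.

Lemma exists_step3 T M : step1 canXX canUX c T -> exists T', step3 c T M T'.
Proof.
move=> [_ sT _].
have [|T' [[TE sT'] minT]] := @exists_arg_min R _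
    (fun F => F \subset T :|: M /\ spanning_forest F) (total_cost (zero_on M c)).
  by exists T; split=> //; apply: subsetUl.
by exists T'; split=> // F' *; apply: minT.
Qed.

Lemma exists_optimal :
  feasible R canXX canUX -> exists opt, optimal_value canXX canUX c opt.
Proof.
move=> [SA [SB fS]].
have [|[SA' SB'] [fS' minS]] := @exists_arg_min R _
    (fun S : 'M[bool]_n * 'M[bool]_(n, q) => feasible_solution R canXX canUX S.1 S.2)
    (fun S => total_cost c (system_links S.1 S.2)).
  by exists (SA, SB).
exists (total_cost c (system_links SA' SB')); split; first by exists SA', SB'.
by move=> dA dB fd; apply: (minS (dA, dB)).
Qed.

(** Zeroing the costs on [M] charges [F] exactly its marginal cost over [M]. This is what the costs
    of steps 2 and 3 measure. *)
Lemma total_costU F M : total_cost c (F :|: M) = total_cost c M + total_cost (zero_on M c) F.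
Proof.
rewrite /total_cost (big_setID M) /= setIUl setIid (setUidPr (subsetIr F M)).
congr (_ + _); rewrite setDUl setDv setU0 [RHS](big_setID M) /=.
rewrite [X in _ = X + _]big1 ?add0r => [|e /setIP[_ eM]]; last by rewrite /zero_on eM.
by apply: eq_bigr => e /setDP[_ eM]; rewrite /zero_on (negbTE eM).
Qed.

Lemma total_cost_sub (d : link n q -> R) F M :
  F \subset M -> (forall e, e \in M -> 0 <= d e) -> total_cost d F <= total_cost d M.
Proof.
move=> /setIidPr FM d0; rewrite /total_cost [leRHS](big_setID F) /= FM lerDl.
by apply: sumr_ge0 => e /setDP[eM _]; apply: d0.
Qed.

Hypothesis c_ge0 : forall e, e \in E -> 0 <= c e.

Lemma algorithm1_approximation opt T M T' SA SB :
  optimal_value canXX canUX c opt ->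
  algorithm1_run canXX canUX c T M T' SA SB ->
  feasible_solution R canXX canUX SA SB /\
  total_cost c (system_links SA SB) <= 2%:R * opt.
Proof.
move=> [[dA [dB [/feasible_solutionP[sE rO pO] <-]]] _].
move=> [[TE sT minT] [[mM _] aM minM] [T'E sT' minT'] S4].
have ME : M \subset E by case: mM.
split.
  apply/feasible_solutionP; rewrite S4; split.
  - rewrite subUset ME andbT; apply: subset_trans T'E _.
    by rewrite subUset TE ME.
  - have /spanning_forestP[rT' _] := sT'.
    by apply: reachable_sub rT'; apply: subsetUl.
  have /matching_perfect : matching M M by case: mM.
  by move/(_ aM); apply: perfect_sub; apply: subsetUr.
rewrite S4 total_costU mulr_natl mulr2n.
have leT : total_cost (zero_on M c) T' <= total_cost (zero_on M c) T.
  by apply: minT' => //; apply: subsetUl.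
(* [T] itself competes in step 3. The cost of the union of [T] and [M] is then split the other way
   round, as the cost of [T] plus what step 2 minimised; each summand is at most the optimum. *)
apply: le_trans (lerD (lexx _) leT) _; rewrite -total_costU setUC total_costU.
apply: lerD.
  have [F FO sF] := reachable_forest rO.
  apply: le_trans (minT F (subset_trans FO sE) sF) _.
  by apply: total_cost_sub FO _ => e eO; apply: c_ge0; apply: (subsetP sE).
have [pm pmI pmO] := pO.
have [mO aO] := matching_of_fun pmI (fun x => subsetP sE _ (pmO x)).
apply: le_trans (minM _ mO aO) _.
set MO := [set (pm x, x) | x in _].
have MOO : MO \subset system_links dA dB.
  by apply/subsetP=> _ /imsetP[x _ ->].
apply: le_trans (total_cost_sub MOO _); last first.
  by move=> e eO; apply: c_ge0; apply: (subsetP sE).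
apply: ler_sum => e /(subsetP MOO)/(subsetP sE)/c_ge0 ce.
by rewrite /zero_on; case: ifP.
Qed.

End Approximation.

(** * Shortest arborescences *)

Section Edmonds.
Variables (R : realDomainType) (n q : nat) (E : {set link n q}).
Variable c : link n q -> R.
Notation V := (vertex n q).
Notation L := (link n q).
Implicit Types (Q : {set V}) (K : nat -> {set V}) (F : {set L}) (ix : L -> nat) (rc : L -> R).

Definition enters (K : {set V}) (e : L) : bool := (e.1 \notin K) && (inl e.2 \in K).

Definition added ix : {set L} := [set e | (0 < ix e)%N].

(** A positive value of [ix] is one more than the step, so the bound [i] selects the links added
    strictly before step [i]. *)
Definition early_arc ix i (K : {set V}) : rel V := fun a b =>
  [&& a \in K, b \in K & if b is inl x then (0 < ix (a, x) <= i)%N else false].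

(* Dual solution of the shortest arborescence problem: the set [K i], chosen in
   step [i], gets the dual value [y i]; [ix e] is [i.+1] if the link [e] was
   added in step [i], and [0] if it was not added. *)
Definition dual_state t ix rc K (y : nat -> R) : Prop :=
  [/\ forall e, (0 < ix e)%N -> [/\ (ix e <= t)%N, e \in E & rc e = 0],
      forall e, e \in E -> 0 <= rc e,
      forall e, rc e = c e - \sum_(i < t | enters (K i) e) y i,
      forall i, (i < t)%N -> 0 <= y i
    & forall i, (i < t)%N ->
      [/\ forall u, inr u \notin K i,
          K i != set0,
          forall e, enters (K i) e -> (0 < ix e)%N -> (i < ix e)%N
        & {in K i &, forall a b, connect (early_arc ix i (K i)) a b}]].

Definition ancestors ix (x : V) : {set V} := [set a | connect (arc (added ix)) a x].

(** The ancestors of such a vertex form a strong component that no added link enters. Its dual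
    variable can be raised without disturbing the tight links. *)
Definition source ix (x : V) : bool :=
  [forall a, connect (arc (added ix)) a x ==> connect (arc (added ix)) x a].

Definition update_ix ix e0 k : L -> nat := fun e => if e == e0 then k else ix e.

Lemma connect_within (T : finType) (r : rel T) (K : {set T}) a b :
  (forall v w, r v w -> w \in K -> v \in K) ->
  connect r a b -> b \in K -> connect (fun v w => [&& v \in K, w \in K & r v w]) a b.
Proof.
move=> clK /connectP[p]; elim: p a => [|w p IH] a /=; first by move=> _ ->.
case/andP=> aw pp Eb bK; have cwb := IH w pp Eb bK.
have wK : w \in K.
  have /connectP : connect r w b by apply/connectP; exists p.
  case=> p' pp' Eb'; elim: p' w {IH pp Eb cwb aw} pp' Eb' => [|z p' IH] w /=.
    by move=> _ <-.
  by case/andP=> wz pz Ez; apply: clK wz (IH _ pz Ez).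
by apply: connect_trans cwb; apply: connect1; rewrite (clK _ _ aw) wK.
Qed.

Lemma ancestors_closed ix x v w :
  arc (added ix) v w -> w \in ancestors ix x -> v \in ancestors ix x.
Proof. by rewrite !inE => vw; apply: connect_trans; apply: connect1. Qed.

Lemma source_ancestors ix x a :
  source ix x -> a \in ancestors ix x -> ancestors ix a = ancestors ix x.
Proof.
move=> /forallP sx; rewrite inE => ax; have /implyP/(_ ax) xa := sx a.
by apply/setP=> b; rewrite !inE; apply/idP/idP=> h; apply: connect_trans h _.
Qed.

Lemma connect_inr ix (a : V) u : connect (arc (added ix)) a (inr u) -> a = inr u.
Proof.
case/connectP=> p; case/lastP: p => [_ -> //|p z].
rewrite rcons_path last_rcons => /andP[_ pz] Ez; rewrite -Ez in pz.
by [].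
Qed.

Lemma source_no_input ix x u : source ix (inl x) -> inr u \notin ancestors ix (inl x).
Proof.
move=> /forallP/(_ (inr u))/implyP sx; apply/negP; rewrite inE => /sx.
by move/connect_inr.
Qed.

(** The new set is the source component, and its dual value is the least reduced cost among the
    links entering it, so [e0] becomes tight and nothing turns negative. Links added before do not
    enter a set closed under predecessors and stay tight. The index [t.+1] of [e0] exceeds every
    earlier step, which preserves the conditions on the earlier sets. *)
Lemma dual_step t ix rc K y x e0 :
  dual_state t ix rc K y -> source ix (inl x) ->
  e0 \in E -> enters (ancestors ix (inl x)) e0 ->
  (forall e, e \in E -> enters (ancestors ix (inl x)) e -> rc e0 <= rc e) ->
  exists K' y', dual_state t.+1 (update_ix ix e0 t.+1)
    (fun e => if enters (ancestors ix (inl x)) e then rc e - rc e0 else rc e) K' y'.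
Proof.
set Kx := ancestors ix (inl x) => -[ix_ok rc_ge0 rcE y_ge0 K_ok] sx e0E ent0 min0.
exists (fun i => if i == t then Kx else K i), (fun i => if i == t then rc e0 else y i).
have it i : (i < t.+1)%N -> i != t -> (i < t)%N.
  by rewrite ltnS leq_eqVlt => /orP[/eqP->|//]; rewrite eqxx.
have ix_t e : (ix e <= t)%N by case: (posnP (ix e)) => [->|/ix_ok[]].
have nent e : (0 < ix e)%N -> ~~ enters Kx e.
  move=> e_gt0; rewrite negb_and negbK orbC -implybE; apply/implyP.
  apply: ancestors_closed; rewrite /= inE -surjective_pairing; exact: e_gt0.
have ix0 : ix e0 = 0%N by apply/eqP; rewrite -leqn0 leqNgt; apply/negP => /nent/negP.
split.
- move=> e; rewrite /update_ix; case: eqVneq => [->|ne] e_gt0.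
    by rewrite ent0 subrr.
  have [le_t eE rc0] := ix_ok e e_gt0.
  by rewrite (negbTE (nent e e_gt0)) leqW.
- move=> e eE; case: ifP => [ent|_]; last exact: rc_ge0.
  by rewrite subr_ge0 min0.
- move=> e; rewrite big_mkcond big_ord_recr /= eqxx -big_mkcondr.
  under eq_bigl => i do rewrite ltn_eqF ?ltn_ord //.
  under eq_bigr => i _ do rewrite ltn_eqF ?ltn_ord //.
  by rewrite rcE; case: ifP => _; rewrite ?addr0 ?opprD ?addrA.
- move=> i ilt; case: eqVneq => [_|/(it _ ilt)]; last exact: y_ge0.
  exact: rc_ge0.
move=> i ilt; case: (eqVneq i t) => [->{i ilt}|/(it _ ilt) {}ilt].
  split=> [u||e ent|a b aK bK].
  - exact: source_no_input.
  - by apply/set0Pn; exists (inl x); rewrite inE connect0.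
  - rewrite /update_ix; case: eqVneq => // _ /nent; by rewrite ent.
  have ab : connect (arc (added ix)) a b.
    have bx : a \in ancestors ix b.
      rewrite (source_ancestors _ bK) //.
    by rewrite inE in bx.
  have := connect_within (@ancestors_closed ix (inl x)) ab bK.
  apply: connect_sub => v [z|u] /and3P[vK zK] //= vz; apply: connect1.
  rewrite /early_arc vK zK /update_ix; rewrite inE in vz.
  case: eqVneq => [E0|_]; last by rewrite vz ix_t.
  by rewrite -E0 ix0 in vz || rewrite E0 ix0 in vz.
have [K1 K2 K3 K4] := K_ok i ilt; split=> // [e ent|a b aK bK].
  rewrite /update_ix; case: eqVneq => [_ _|_]; first by apply: leqW.
  exact: K3.
apply: connect_sub (K4 _ _ aK bK) => v [z|u] /and3P[vK zK] //= vz; apply: connect1.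
rewrite /early_arc vK zK /update_ix; case: eqVneq => // E0.
by rewrite E0 ix0 in vz.
Qed.

Lemma dual_state0 : (forall e, e \in E -> 0 <= c e) ->
  dual_state 0 (fun=> 0%N) c (fun=> set0) (fun=> 0).
Proof. by move=> c_ge0; split=> // e; rewrite big_ord0 subr0. Qed.

Lemma exists_entering (K : {set V}) :
  reachable E -> K != set0 -> (forall u, inr u \notin K) ->
  exists2 e, e \in E & enters K e.
Proof.
move=> rE K0 Ku; have [||v [x [vx vK xK]]] := reachable_crossing rE (Q := ~: K).
- by move=> u; rewrite inE.
- by apply: contraNneq K0 => E0; rewrite -[K]setCK E0 setCT.
move: vK xK; rewrite !inE negbK => vK xK.
by exists (v, x); rewrite // /enters vK xK.
Qed.

(* Two vertices have the same ancestors iff they are strongly connected.  Each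
   step of the dual phase lowers the number of components or that of source
   components and raises neither, so that 2n steps suffice. *)
Definition components ix : {set {set V}} := [set ancestors ix (inl x) | x in 'I_n].

Definition source_components ix : {set {set V}} :=
  [set ancestors ix (inl x) | x in 'I_n & source ix (inl x)].

(** Cutting a walk through the new link at its first and last passage leaves an old walk to [v] and
    an old walk from [x]. The same rule updates the closure table in [close_reach]. *)
Lemma ancestors_update ix v x k z : (0 < k)%N ->
  ancestors (update_ix ix (v, x) k) z =
  if inl x \in ancestors ix z then ancestors ix z :|: ancestors ix v
  else ancestors ix z.
Proof.
move=> k0; have sub : subrel (arc (added ix)) (arc (added (update_ix ix (v, x) k))).
  by move=> a [b|//] /=; rewrite !inE /update_ix; case: ifP.
have csub a b : connect (arc (added ix)) a b ->
    connect (arc (added (update_ix ix (v, x) k))) a b.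
  by apply: connect_sub => {}a {}b /sub/connect1.
have vx : connect (arc (added (update_ix ix (v, x) k))) v (inl x).
  by apply: connect1; rewrite /= inE /update_ix eqxx.
apply/setP=> a; apply/idP/idP; last first.
  case: ifP; rewrite !inE => xz; last exact: csub.
  case/orP=> [/csub//|/csub av].
  by apply: connect_trans av (connect_trans vx (csub _ _ xz)).
rewrite inE => /connectP[p]; elim: p a => [|b p IH] a /=.
  by move=> _ ->; case: ifP => _; rewrite !inE connect0.
case/andP=> ab pp Ez; have := IH _ pp Ez.
case: (boolP (arc (added ix) a b)) => [/connect1 ab' |nab].
  case: ifP => _; rewrite !inE; last exact: connect_trans ab'.
  by case/orP=> /(connect_trans ab') ->; rewrite ?orbT.
case: b ab nab {IH pp Ez} => // b /=; rewrite !inE /update_ix.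
have [[-> ->] _ _|_ -> //] := eqVneq (a, b) (v, x).
case: ifP => // xz; last by rewrite !inE xz.
by rewrite !inE connect0 orbT.
Qed.

(** [g] maps old ancestor sets onto new ones and covers the new source components by old ones, so
    neither count grows. If [x] already reaches [v], then [g] identifies [K] with the distinct set
    of ancestors of [v]. Otherwise [K] gains the ancestor [v], which [x] does not reach, and is no
    longer a source. *)
Lemma components_decrease ix v x k : (0 < k)%N ->
  source ix (inl x) -> v \notin ancestors ix (inl x) ->
  (#|components (update_ix ix (v, x) k)|
     + #|source_components (update_ix ix (v, x) k)| <
   #|components ix| + #|source_components ix|)%N.
Proof.
move=> k0 sx; set K := ancestors ix (inl x) => vK; set ix' := update_ix _ _ _.
pose g (Z : {set V}) := if inl x \in Z then Z :|: ancestors ix v else Z.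
have gE z : ancestors ix' z = g (ancestors ix z) by apply: ancestors_update.
have compE : components ix' = g @: components ix.
  rewrite /components -imset_comp; apply: eq_imset => z; exact: gE.
have xK : inl x \in K by rewrite inE connect0.
have KS : K \in source_components ix by apply/imsetP; exists x; rewrite ?inE.
have selfA j z : z \in ancestors j z by rewrite inE connect0.
have srcE Z : Z \in source_components ix' ->
    exists2 Y, Y \in source_components ix & Z = g Y /\
      (inl x \in Y -> Z = ancestors ix' (inl x) /\ source ix' (inl x)).
  case/imsetP=> z; rewrite inE => /= sz ->.
  case: (boolP (inl x \in ancestors ix (inl z))) => xz.
    exists K => //; have xz' : inl x \in ancestors ix' (inl z).
      by rewrite gE /g xz in_setU xz.
    have EA := source_ancestors sz xz'.
    rewrite -EA gE; split=> // _; split=> //.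
    apply/forallP=> a; apply/implyP=> ax.
    have : inl x \in ancestors ix' a; last by rewrite inE.
    rewrite (source_ancestors sz) // -EA ?selfA //; by rewrite inE.
  have Ez : ancestors ix' (inl z) = ancestors ix (inl z) by rewrite gE /g (negbTE xz).
  exists (ancestors ix (inl z)); last by rewrite gE; split=> // h; rewrite h in xz.
  apply/imsetP; exists z => //; rewrite inE; apply/forallP=> a; apply/implyP=> az.
  have az' : a \in ancestors ix' (inl z) by rewrite Ez inE.
  have Ea := source_ancestors sz az'.
  have : inl z \in ancestors ix a; last by rewrite inE.
  have : inl z \in ancestors ix' a by rewrite Ea selfA.
  rewrite gE /g; case: ifP => // xa _.
  by case/negP: xz; move: xa; rewrite !inE => xa; apply: connect_trans xa az.
have srcsub : source_components ix' \subset g @: source_components ix.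
  by apply/subsetP=> Z /srcE[Y YS [-> _]]; apply: imset_f.
have leS := leq_trans (subset_leq_card srcsub) (leq_imset_card _ _).
have leC : (#|components ix'| <= #|components ix|)%N by rewrite compE leq_imset_card.
case: (boolP (inl x \in ancestors ix v)) => [xv|xv].
  rewrite -addSn; apply: leq_add leS; rewrite compE ltn_neqAle leq_imset_card andbT.
  apply/negP=> /imset_injP injg.
  have [w Ev] : exists w, v = inl w.
    by case: (v) xv => [w|u]; [exists w | rewrite inE => /connect_inr].
  have KA : K \subset ancestors ix v.
    by apply/subsetP=> a; rewrite !inE in xv * => ax; apply: connect_trans ax xv.
  have : K = ancestors ix v.
    apply: injg; [exact: imset_f | by rewrite Ev; apply: imset_f |].
    by rewrite /g xv xK setUid; apply/setUidPr.
  by move=> EK; rewrite EK selfA in vK.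
rewrite -addnS; apply: leq_add leC _.
apply: (@leq_ltn_trans #|g @: (source_components ix :\ K)|).
  apply: subset_leq_card; apply/subsetP=> Z /srcE[Y YS [-> Yx]].
  apply: imset_f; rewrite !inE YS andbT; apply/eqP=> EY; rewrite EY in Yx.
  have [_ /forallP/(_ v)/implyP] := Yx xK.
  have vx : v \in ancestors ix' (inl x) by rewrite gE /g xK inE selfA orbT.
  rewrite inE in vx; move=> /(_ vx) xv'.
  have : inl x \in ancestors ix' v by rewrite inE.
  by rewrite gE /g; case: ifP; rewrite (negbTE xv).
by apply: leq_ltn_trans (leq_imset_card _ _) _; rewrite [X in (_ < X)%N](cardsD1 K) KS.
Qed.

Lemma components_bound ix : (#|components ix| + #|source_components ix| <= n + n)%N.
Proof.
apply: leq_add; first by rewrite -[X in (_ <= X)%N]card_ord; apply: leq_imset_card.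
apply: leq_trans (leq_imset_card _ _) _.
by apply: leq_trans (max_card _) _; rewrite card_ord.
Qed.

(** If no input reaches [x], take among the states leading to [x] one with the fewest ancestors.
    Each of its ancestors has the same ancestor set by minimality, so it would be a source. *)
Lemma no_source_reachable ix :
  (forall x, ~~ source ix (inl x)) -> reachable (added ix).
Proof.
move=> noS x; apply: contrapT => nx.
pose P (z : 'I_n) := connect (arc (added ix)) (inl z) (inl x).
have Px : P x by apply: connect0.
case: (@arg_minnP _ x P (fun z => #|ancestors ix (inl z)|) Px) => z Pz minz.
case/negP: (noS z); apply/forallP=> -[a|u]; apply/implyP=> az; last first.
  by case: nx; exists u; apply: connect_trans az Pz.
have sub : ancestors ix (inl a) \subset ancestors ix (inl z).
  by apply/subsetP=> b; rewrite !inE => ba; apply: connect_trans ba az.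
have Pa : P a by apply: connect_trans az Pz.
have : inl z \in ancestors ix (inl a); last by rewrite inE.
have /eqP <- : ancestors ix (inl z) == ancestors ix (inl a).
  by rewrite eq_sym eqEcard sub minz.
by rewrite inE connect0.
Qed.

(* Prim's algorithm with the step numbers as weights: since [K i] is strongly
   connected by links older than those entering it, it is entered only once. *)
Definition prim_state t ix K Q F : Prop :=
  [/\ grown Q F, F \subset added ix
    & forall i, (i < t)%N ->
      #|[set e in F | enters (K i) e]| = (Q :&: K i != set0)].

Lemma prim_state0 t ix rc K y : dual_state t ix rc K y ->
  prim_state t ix K [set w | if w is inr _ then true else false] set0.
Proof.
move=> [_ _ _ _ K_ok]; split; [exact: grown0|exact: sub0set|move=> i /K_ok[Ku _ _ _]].
rewrite (_ : [set e in set0 | _] = set0) ?cards0; last by apply/setP=> e; rewrite !inE.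
apply/esym/eqP; rewrite eqb0 negbK; apply/eqP/setP=> -[x|u]; rewrite !inE //.
exact: negbTE (Ku u).
Qed.

Lemma prim_step t ix rc K y Q F v x :
  dual_state t ix rc K y -> prim_state t ix K Q F ->
  (0 < ix (v, x))%N -> v \in Q -> inl x \notin Q ->
  (forall v' x', (0 < ix (v', x'))%N -> v' \in Q -> inl x' \notin Q ->
     (ix (v, x) <= ix (v', x'))%N) ->
  prim_state t ix K (inl x |: Q) ((v, x) |: F).
Proof.
move=> [_ _ _ _ K_ok] [gQ FA FK] ix0 vQ xQ minix; split.
- exact: grown_add.
- by rewrite subUset FA andbT sub1set inE.
move=> i it; have [Ku K0 Kix Kconn] := K_ok i it.
have notF : (v, x) \notin F.
  by have [_ _ eF _] := gQ; apply: contraNN xQ => /eF/andP[].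
case: (boolP (enters (K i) (v, x))) => ent; last first.
  rewrite (_ : [set e in _ | _] = [set e in F | enters (K i) e]); last first.
    apply/setP=> e; rewrite !inE andb_orl; case: eqVneq => [->|] //.
    by rewrite (negbTE ent) andbF.
  rewrite FK //; congr nat_of_bool; apply/idP/idP.
    case/set0Pn=> w; rewrite inE => /andP[wQ wK]; apply/set0Pn; exists w.
    by rewrite !inE wQ wK orbT.
  case/set0Pn=> w; rewrite !inE => /andP[/orP[/eqP->|wQ] wK]; apply/set0Pn.
    move: ent; rewrite negb_and negbK wK orbF => vK.
    by exists v; rewrite inE vQ.
  by exists w; rewrite inE wQ.
have xK : inl x \in K i by case/andP: ent.
(* Had the forest met [K i] before, a walk inside [K i] to [x] would leave [Q] along a link of index
   at most [i]. The chosen link is the oldest one leaving [Q], but as it enters [K i] its index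
   exceeds [i]. *)
have QK0 : Q :&: K i = set0.
  apply/eqP; apply: contraT => /set0Pn[a]; rewrite inE => /andP[aQ aK].
  have [v' [w' [/and3P[_ _]]]] := connect_crossing (Kconn _ _ aK xK) aQ xQ.
  case: w' => // x' /andP[i0 ilt] v'Q x'Q.
  have := leq_trans (minix _ _ i0 v'Q x'Q) ilt.
  by rewrite leqNgt Kix.
have F0 : [set e in F | enters (K i) e] = set0.
  by apply/eqP; rewrite -cards_eq0 FK // QK0 eqxx.
rewrite (_ : [set e in _ | _] = [set (v, x)]); last first.
  apply/setP=> e; rewrite !inE andb_orl; case: eqVneq => [->|_] /=; first by rewrite ent.
  by have /setP/(_ e) := F0; rewrite !inE.
rewrite cards1; apply/esym/eqP; rewrite eqb1; apply/set0Pn; exists (inl x).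
by rewrite !inE eqxx xK.
Qed.

(** Weak duality: a forest costs its reduced costs plus each [y i] times the number of its links
    entering [K i]. Every spanning forest enters each [K i] at least once; this one does so exactly
    once and uses tight links only. *)
Lemma prim_optimal t ix rc K y F :
  dual_state t ix rc K y -> prim_state t ix K setT F ->
  minimal_spanning_forest E c F.
Proof.
move=> [ix_ok rc_ge0 rcE y_ge0 K_ok] [gF FA FK].
split; [|exact: grown_spanning|move=> F' F'E sF'].
  by apply/subsetP=> e /(subsetP FA); rewrite inE => /ix_ok[].
have sumE F0 : total_cost c F0 = \sum_(e in F0) rc e
    + \sum_(i < t) y i *+ #|[set e in F0 | enters (K i) e]|.
  rewrite /total_cost.
  under eq_bigr => e _ do rewrite -[c e](subrK (\sum_(i < t | enters (K i) e) y i)) -rcE.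
  rewrite big_split /=; congr (_ + _).
  under eq_bigr => e _ do rewrite big_mkcond.
  rewrite exchange_big /=; apply: eq_bigr => i _.
  rewrite -big_mkcondr -sumr_const; apply: eq_bigl => e.
  by rewrite inE.
rewrite !sumE; apply: lerD.
  rewrite big1; last by move=> e /(subsetP FA); rewrite inE => /ix_ok[].
  by apply: sumr_ge0 => e /(subsetP F'E)/rc_ge0.
apply: ler_sum => i _; rewrite FK // setTI.
have [Ku K0 _ _] := K_ok i (ltn_ord i); rewrite K0.
rewrite ler_wpMn2l ?y_ge0 // card_gt0.
have /spanning_forestP[rF' _] := sF'.
have [||v [x [vx vK xK]]] := reachable_crossing rF' (Q := ~: K i).
- by move=> u; rewrite inE.
- by apply: contraNneq K0 => E0; rewrite -[K i]setCK E0 setCT.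
move: vK xK; rewrite !inE negbK => vK xK.
by apply/set0Pn; exists (v, x); rewrite inE vx /enters vK xK.
Qed.

End Edmonds.

(** * Loop programs *)

(* Loop programs: the counter of a loop is entry (0, 0) of its own array [v],
   and the number of rounds is |U| + |X| ([CFor true]) or |X| ([CFor false]). *)
Inductive cmd : Type :=
| CISet of nat & iexp & iexp & iexp
| CRSet of nat & iexp & iexp & rexp
| CSeq of cmd & cmd
| CIf of bexp & cmd & cmd
| CNop
| CFor of bool & nat & cmd.

Definition reg (a : nat) : iexp := IGet a (IConst 0) (IConst 0).

Definition bound_exp (b : bool) : iexp :=
  if b then IAdd (reg 0) (IGet 0 (IConst 0) (IConst 1)) else reg 0.

Fixpoint compile (p : cmd) : program :=
  match p with
  | CISet a i j e => ISet a i j e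
  | CRSet a i j e => RSet a i j e
  | CSeq p1 p2 => Seq (compile p1) (compile p2)
  | CIf b p1 p2 => If b (compile p1) (compile p2)
  | CNop => Skip
  | CFor b v p1 =>
      Seq (ISet v (IConst 0) (IConst 0) (IConst 0))
        (While (BNot (BILe (bound_exp b) (reg v)))
           (Seq (compile p1)
              (ISet v (IConst 0) (IConst 0) (IAdd (reg v) (IConst 1)))))
  end.

Fixpoint written_ints (p : cmd) : seq nat :=
  match p with
  | CISet a _ _ _ => [:: a]
  | CRSet _ _ _ _ | CNop => [::]
  | CSeq p1 p2 | CIf _ p1 p2 => written_ints p1 ++ written_ints p2
  | CFor _ v p1 => v :: written_ints p1
  end.

Fixpoint written_reals (p : cmd) : seq nat :=
  match p with
  | CRSet a _ _ _ => [:: a]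
  | CISet _ _ _ _ | CNop => [::]
  | CSeq p1 p2 | CIf _ p1 p2 => written_reals p1 ++ written_reals p2
  | CFor _ _ p1 => written_reals p1
  end.

(* Array 0 holds the loop bounds. *)
Fixpoint well_formed (p : cmd) : bool :=
  match p with
  | CISet a _ _ _ => a != 0%N
  | CRSet _ _ _ _ | CNop => true
  | CSeq p1 p2 | CIf _ p1 p2 => well_formed p1 && well_formed p2
  | CFor _ v p1 => [&& v != 0%N, v \notin written_ints p1 & well_formed p1]
  end.

(** A loop pays 4 for resetting its counter and at most 12 + 1 for the failing test, hence 17. Each
    round pays at most 12 + 1 for the test and 8 for the increment, hence 21. Both branches of a
    conditional are charged. *)
Fixpoint cost_bound (p : cmd) (N : nat) : nat :=
  match p with
  | CISet _ i j e => (itime i + itime j + itime e).+1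
  | CRSet _ i j e => (itime i + itime j + rtime e).+1
  | CSeq p1 p2 => cost_bound p1 N + cost_bound p2 N
  | CIf b p1 p2 => (btime b + (cost_bound p1 N + cost_bound p2 N)).+1
  | CNop => 1
  | CFor b v p1 => 17 + N * (cost_bound p1 N + 21)
  end.

Fixpoint depth (p : cmd) : nat :=
  match p with
  | CSeq p1 p2 | CIf _ p1 p2 => maxn (depth p1) (depth p2)
  | CFor _ _ p1 => (depth p1).+1
  | _ => 0
  end.

(** The degree of the time bound is the nesting depth of the loops, so a cubic bound reduces to
    computing that depth. *)
Lemma cost_bound_polynomial p :
  exists K, forall N, (0 < N)%N -> (cost_bound p N <= K * N ^ depth p)%N.
Proof.
elim: p => [a i j e|a i j e|p1 [K1 IH1] p2 [K2 IH2]|b p1 [K1 IH1] p2 [K2 IH2]||b v p [K IH]] /=.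
- by exists (cost_bound (CISet a i j e) 0) => N _; rewrite expn0 muln1.
- by exists (cost_bound (CRSet a i j e) 0) => N _; rewrite expn0 muln1.
- exists (K1 + K2)%N => N N0; rewrite mulnDl leq_add //.
    by apply: leq_trans (IH1 N N0) _; rewrite leq_mul2l leq_pexp2l ?leq_maxl ?orbT.
  by apply: leq_trans (IH2 N N0) _; rewrite leq_mul2l leq_pexp2l ?leq_maxr ?orbT.
- exists ((btime b).+1 + (K1 + K2))%N => N N0; rewrite -addSn !mulnDl !leq_add //.
  + by rewrite leq_pmulr // expn_gt0 N0.
  + by apply: leq_trans (IH1 N N0) _; rewrite leq_mul2l leq_pexp2l ?leq_maxl ?orbT.
  by apply: leq_trans (IH2 N N0) _; rewrite leq_mul2l leq_pexp2l ?leq_maxr ?orbT.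
- by exists 1%N => N _.
exists (38 + K)%N => N N0; rewrite (_ : 38 = 17 + 21)%N // -addnA mulnDl leq_add //.
  by rewrite leq_pmulr // expn_gt0 N0.
rewrite expnS mulnCA leq_mul2l addnC mulnDl leq_add ?orbT ?IH //.
by rewrite leq_pmulr // expn_gt0 N0.
Qed.

(** * Loop programs as total functions, and their running time *)

Section Semantics.
Variable R : realDomainType.
Implicit Types (m : memory R) (p : cmd).

Definition set_int m a i j d : memory R := Memory (update (ints m) a i j d) (reals m).

Fixpoint run p m : memory R :=
  match p with
  | CISet a i j e => set_int m a (ieval m i) (ieval m j) (ieval m e)
  | CRSet a i j e =>
      Memory (ints m) (update (reals m) a (ieval m i) (ieval m j) (reval m e))
  | CSeq p1 p2 => run p2 (run p1 m)
  | CIf b p1 p2 => if beval m b then run p1 m else run p2 m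
  | CNop => m
  | CFor b v p1 =>
      iter (ieval m (bound_exp b))
        (fun m => let m1 := run p1 m in set_int m1 v 0 0 (ints m1 v 0%N 0%N + 1))
        (set_int m v 0 0 0)
  end.

Lemma update_other (D : Type) (f : nat -> nat -> nat -> D) a i j d a' :
  a' != a -> update f a i j d a' = f a'.
Proof. by rewrite /update => /negbTE->. Qed.

Lemma updateE (D : Type) (f : nat -> nat -> nat -> D) a i j d i' j' :
  update f a i j d a i' j' = if (i' == i) && (j' == j) then d else f a i' j'.
Proof. by rewrite /update eqxx. Qed.

Lemma run_ints p m a : a \notin written_ints p -> ints (run p m) a = ints m a.
Proof.
elim: p m => [b i j e|b i j e|p1 IH1 p2 IH2|b p1 IH1 p2 IH2||b v p1 IH1] m //=.
- by rewrite inE; apply: update_other.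
- by rewrite mem_cat negb_or => /andP[a1 a2]; rewrite IH2 ?IH1.
- by rewrite mem_cat negb_or => /andP[a1 a2]; case: ifP; rewrite ?IH2 ?IH1.
rewrite inE negb_or => /andP[av a1].
elim: (ieval _ _) => [|k IH] /=; first by rewrite update_other.
by rewrite update_other // IH1.
Qed.

Lemma run_reals p m a : a \notin written_reals p -> reals (run p m) a = reals m a.
Proof.
elim: p m => [b i j e|b i j e|p1 IH1 p2 IH2|b p1 IH1 p2 IH2||b v p1 IH1] m //=.
- by rewrite inE; apply: update_other.
- by rewrite mem_cat negb_or => /andP[a1 a2]; rewrite IH2 ?IH1.
- by rewrite mem_cat negb_or => /andP[a1 a2]; case: ifP; rewrite ?IH2 ?IH1.
by move=> a1; elim: (ieval _ _) => [|k IH] //=; rewrite IH1.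
Qed.

Lemma well_formed_ints0 p : well_formed p -> 0%N \notin written_ints p.
Proof.
elim: p => [b i j e|b i j e|p1 IH1 p2 IH2|b p1 IH1 p2 IH2||b v p1 IH1] //=.
- by rewrite inE eq_sym.
- by move=> /andP[/IH1 h1 /IH2 h2]; rewrite mem_cat negb_or h1.
- by move=> /andP[/IH1 h1 /IH2 h2]; rewrite mem_cat negb_or h1.
by move=> /and3P[v0 _ /IH1 h]; rewrite inE negb_or eq_sym v0.
Qed.

Definition size_bound m : nat := (ints m 0%N 0%N 0%N + ints m 0%N 0%N 1%N)%N.

Lemma ieval_bound m b :
  ieval m (bound_exp b) = (ints m 0%N 0%N 0%N + (if b then ints m 0%N 0%N 1%N else 0))%N.
Proof. by case: b => //=; rewrite addn0. Qed.

(** [run] fixes the number of rounds on entry, whereas the compiled loop tests its guard each time.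
    They agree because the body writes neither its counter nor array 0. *)
Lemma exec_run p m : well_formed p ->
  exists2 t, exec (compile p) m t (run p m) & (t <= cost_bound p (size_bound m))%N.
Proof.
elim: p m => [a i j e|a i j e|p1 IH1 p2 IH2|b p1 IH1 p2 IH2||b v p IH] m /=.
- by move=> _; eexists; [apply: ExecISet|].
- by move=> _; eexists; [apply: ExecRSet|].
- move=> /andP[wf1 wf2]; have [t1 e1 l1] := IH1 m wf1.
  have [t2 e2 l2] := IH2 (run p1 m) wf2; exists (t1 + t2)%N; first exact: ExecSeq e1 e2.
  by rewrite leq_add //; rewrite /size_bound run_ints ?well_formed_ints0 in l2 *.
- move=> /andP[wf1 wf2]; case: ifP => bm.
    have [t1 e1 l1] := IH1 m wf1; exists (btime b + t1).+1; first exact: ExecIfTrue.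
    by rewrite ltnS leq_add2l (leq_trans l1) ?leq_addr.
  have [t2 e2 l2] := IH2 m wf2; exists (btime b + t2).+1.
    by apply: ExecIfFalse; rewrite ?bm.
  by rewrite ltnS leq_add2l (leq_trans l2) ?leq_addl.
- by move=> _; exists 1%N => //; apply: ExecSkip.
move=> /and3P[v0 vp wf].
set body := fun m : memory R => _; set k0 := ieval m (bound_exp b).
pose mk k := iter k body (set_int m v 0 0 0).
have mk0 k : ints (mk k) 0%N = ints m 0%N.
  elim: k => [|k IHk] /=; first by rewrite update_other // eq_sym.
  by rewrite update_other 1?eq_sym // run_ints ?well_formed_ints0.
have mkv k : ints (mk k) v 0%N 0%N = k.
  elim: k => [|k IHk] /=; first by rewrite updateE.
  by rewrite updateE !eqxx run_ints // IHk addn1.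
have bk k : ieval (mk k) (bound_exp b) = k0 by rewrite /k0 !ieval_bound mk0.
have k0_le : (k0 <= size_bound m)%N.
  by rewrite /k0 ieval_bound leq_add2l; case: (b).
set c := cost_bound p (size_bound m).
(* Induction on the number [j] of rounds still to be run. *)
have loop j : (j <= k0)%N -> exists2 t,
    exec (While (BNot (BILe (bound_exp b) (reg v)))
       (Seq (compile p) (ISet v (IConst 0) (IConst 0) (IAdd (reg v) (IConst 1)))))
      (mk (k0 - j)%N) t (mk k0) & (t <= 13 + j * (c + 21))%N.
  have bt : (btime (BNot (BILe (bound_exp b) (reg v))) <= 12)%N by case: (b).
  elim: j => [|j IHj] jk.
    rewrite subn0; exists (btime (BNot (BILe (bound_exp b) (reg v)))).+1.
      by apply: ExecWhileFalse; rewrite /= bk mkv leqnn.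
    by rewrite mul0n addn0.
  have [t2 e2 l2] := IHj (ltnW jk).
  have [t1 e1 l1] := IH (mk (k0 - j.+1)%N) wf.
  have Emk : mk (k0 - j)%N = body (mk (k0 - j.+1)%N) by rewrite -iterS -subSn.
  eexists.
    apply: (@ExecWhileTrue _ _ _ _ _ _ _ _ _ (ExecSeq e1 (ExecISet _ _ _ _ _))).
      rewrite /= bk mkv -ltnNge ltn_subrL /=; exact: leq_ltn_trans (leq0n _) jk.
    have := e2; rewrite Emk; apply.
  have -> : (itime (IConst 0) + itime (IConst 0) + itime (IAdd (reg v) (IConst 1))).+1 = 8 by [].
  rewrite /size_bound mk0 -/(size_bound m) -/c in l1.
  rewrite mulSn; move: l1 l2 bt; move: (btime _) (j * _)%N => B J l1 l2 bt.
  lia.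
have [t et lt] := loop k0 (leqnn _); rewrite subnn in et.
exists (4 + t)%N.
  apply: ExecSeq et; exact: ExecISet.
rewrite (_ : 17 = 4 + 13)%N // -addnA leq_add2l (leq_trans lt) // leq_add2l.
by rewrite leq_mul2r k0_le orbT.
Qed.

Lemma run_seq p1 p2 m : run (CSeq p1 p2) m = run p2 (run p1 m).
Proof. by []. Qed.

Lemma run_if b p1 p2 m : run (CIf b p1 p2) m = if beval m b then run p1 m else run p2 m.
Proof. by []. Qed.

(** The invariant is indexed by the set of elements already treated rather than by the counter, so
    it can speak of vertices and states instead of their codes. *)
Lemma run_for (n q : nat) (T : finType) (code : T -> nat) (b : bool) v p m
    (I : {set T} -> memory R -> Prop) :
  injective code ->
  (forall k, (k < n + (if b then q else 0))%N <-> exists t, code t = k) ->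
  well_formed (CFor b v p) -> ints m 0%N 0%N 0%N = n -> ints m 0%N 0%N 1%N = q ->
  I set0 (set_int m v 0 0 0) ->
  (forall (D : {set T}) t m', t \notin D -> I D m' ->
     ints m' v 0%N 0%N = code t -> ints m' 0%N = ints m 0%N ->
     I (t |: D) (set_int (run p m') v 0 0 (code t).+1)) ->
  I setT (run (CFor b v p) m).
Proof.
move=> code_inj codeP /and3P[v0 vp wf] mn mq I0 IS /=.
rewrite ieval_bound mn mq; set body := fun m : memory R => _.
set k0 := (n + _)%N in codeP *.
have Dk k : (k <= k0)%N ->
    let m' := iter k body (set_int m v 0 0 0) in
    [/\ ints m' v 0%N 0%N = k, ints m' 0%N = ints m 0%N
      & I [set t | (code t < k)%N] m'].
  elim: k => [|k IH] kk0 m'.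
    split; [by rewrite /= updateE|by rewrite /= update_other // eq_sym|].
    by rewrite (_ : [set t | _] = set0) //; apply/setP=> t; rewrite !inE.
  have [IHv IH0 IHI] := IH (ltnW kk0); rewrite {}/m' /=.
  set m1 := iter k body _ in IHv IH0 IHI *.
  split; first by rewrite updateE !eqxx run_ints // IHv addn1.
    by rewrite update_other 1?eq_sym // run_ints ?well_formed_ints0.
  have [t Et] := (codeP k).1 kk0.
  rewrite (_ : body m1 = set_int (run p m1) v 0 0 (code t).+1); last first.
    by rewrite /body run_ints // IHv addn1 Et.
  rewrite -Et; have -> : [set s | (code s < (code t).+1)%N] = t |: [set s | (code s < code t)%N].
    by apply/setP=> s; rewrite !inE ltnS leq_eqVlt (inj_eq code_inj).
  by apply: IS; rewrite ?inE ?Et ?ltnn // IHv Et.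
have [_ _] := Dk k0 (leqnn _).
rewrite (_ : [set t | _] = setT) //; apply/setP=> t; rewrite !inE.
by apply/codeP; exists t.
Qed.

End Semantics.

Definition set_reg (a : nat) (e : iexp) : cmd := CISet a (IConst 0) (IConst 0) e.
Definition nonzero (e : iexp) : bexp := BNot (BILe e (IConst 0)).
Definition is_zero (e : iexp) : bexp := BILe e (IConst 0).
(** The machine compares only by order; with truncated subtraction this expression is 1 if the
    arguments agree and 0 otherwise. *)
Definition eq_exp (i j : iexp) : iexp := ISub (ISub (IConst 1) (ISub i j)) (ISub j i).

(** * Invariant rules for single and nested loops *)

Section Loops.
Variables (R : realDomainType) (n q : nat).
Implicit Types (m : memory R) (p : cmd).

Definition enumerates (T : finType) (code : T -> nat) (b : bool) : Prop :=
  injective code /\ forall k, (k < n + (if b then q else 0))%N <-> exists t, code t = k.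

Lemma enumerates_vertex : enumerates (@vcode n q) true.
Proof.
split=> [[x|u] [y|v]|k] /=.
- by move/val_inj->.
- by move=> E; have := ltn_ord x; rewrite E ltnNge leq_addr.
- by move=> E; have := ltn_ord y; rewrite -E ltnNge leq_addr.
- by move/addnI/val_inj->.
split=> [kN|[[x|u] <-]] /=; last 2 first.
- by apply: ltn_addr.
- by rewrite ltn_add2l.
case: (ltnP k n) => kn; first by exists (inl (Ordinal kn)).
have kq : (k - n < q)%N by rewrite ltn_subLR.
by exists (inr (Ordinal kq)); rewrite /= subnKC.
Qed.

Lemma enumerates_state : enumerates (@nat_of_ord n) false.
Proof.
split=> [|k]; first exact: val_inj.
rewrite addn0; split=> [kn|[x <-] //]; by exists (Ordinal kn).
Qed.

Definition sized m : Prop := ints m 0%N 0%N 0%N = n /\ ints m 0%N 0%N 1%N = q.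

Lemma sized_run p m : well_formed p -> sized m -> sized (run p m).
Proof. by move=> wf; rewrite /sized run_ints ?well_formed_ints0. Qed.

Lemma run_for1 (T : finType) (code : T -> nat) b v p m (I : {set T} -> memory R -> Prop) :
  enumerates code b -> well_formed (CFor b v p) -> sized m ->
  (forall D m' k, I D m' -> I D (set_int m' v 0 0 k)) ->
  I set0 m ->
  (forall (D : {set T}) t m', t \notin D -> I D m' -> ints m' v 0%N 0%N = code t ->
     sized m' -> I (t |: D) (run p m')) ->
  I setT (run (CFor b v p) m).
Proof.
move=> [ci cP] wf [mn mq] stab I0 IS.
apply: (run_for ci cP wf mn mq) => [|D t m' tD ID Ev E0]; first exact: stab.
by apply: stab; apply: IS => //; rewrite /sized E0.
Qed.

Lemma run_for2 (T1 T2 : finType) (code1 : T1 -> nat) (code2 : T2 -> nat) b1 b2 a b p m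
    (I : {set T1 * T2} -> memory R -> Prop) :
  enumerates code1 b1 -> enumerates code2 b2 ->
  well_formed (CFor b1 a (CFor b2 b p)) -> sized m ->
  (forall D m' k, I D m' -> I D (set_int m' a 0 0 k)) ->
  (forall D m' k, I D m' -> I D (set_int m' b 0 0 k)) ->
  I set0 m ->
  (forall (D : {set T1 * T2}) s t m', (s, t) \notin D -> I D m' ->
     ints m' a 0%N 0%N = code1 s -> ints m' b 0%N 0%N = code2 t ->
     sized m' -> I ((s, t) |: D) (run p m')) ->
  I setT (run (CFor b1 a (CFor b2 b p)) m).
Proof.
move=> en1 en2 wf sz stab1 stab2 I0 IS.
have wf2 : well_formed (CFor b2 b p) by have /and3P[] := wf.
have aw : a \notin written_ints (CFor b2 b p) by have /and3P[] := wf.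
have ab : a != b by move: aw; rewrite inE negb_or => /andP[].
have ap : a \notin written_ints p by move: aw; rewrite inE negb_or => /andP[].
pose I1 (D : {set T1}) m' := I [set e | e.1 \in D] m'.
have := @run_for1 _ code1 b1 a (CFor b2 b p) m I1 en1 wf sz.
have -> : I1 setT = I setT.
  by rewrite /I1; congr I; apply/setP=> e; rewrite !inE.
apply=> [D m' k||D s m' sD ID Es szm']; first exact: stab1.
  by rewrite /I1 (_ : [set e | _] = set0) //; apply/setP=> e; rewrite !inE.
pose I2 (D2 : {set T2}) m'' := ints m'' a 0%N 0%N = code1 s /\
  I ([set e | e.1 \in D] :|: [set e | (e.1 == s) && (e.2 \in D2)]) m''.
have : I2 setT (run (CFor b2 b p) m').
  apply: (run_for1 en2 wf2 szm') => [D2 m'' k [E ID2]||D2 t m'' tD2 [E ID2] Et szm''].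
  - split; last exact: stab2.
    by rewrite /= update_other.
  - split=> //; rewrite (_ : _ :|: _ = [set e | e.1 \in D]) //.
    by apply/setP=> e; rewrite !inE andbF orbF.
  split; first by rewrite run_ints.
  rewrite (_ : _ :|: _ = (s, t) |: ([set e | e.1 \in D]
      :|: [set e | (e.1 == s) && (e.2 \in D2)])).
    by apply: IS => //; rewrite !inE /= (negbTE sD) (negbTE tD2) andbF.
  by apply/setP=> -[x y]; rewrite !inE /= xpair_eqE; case: (x == s); case: (y == t); rewrite ?orbT.
case=> _; rewrite /I1 (_ : _ :|: _ = [set e | e.1 \in s |: D]) //.
by apply/setP=> e; rewrite !inE andbT orbC.
Qed.

(** Meant for tables whose entries are computed from data that the loop leaves alone: the body is
    checked for one entry, in a memory that differs from the initial one only in the arrays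
    written. *)
Lemma run_fill (T1 T2 : finType) (code1 : T1 -> nat) (code2 : T2 -> nat) b1 b2 a b p m
    (z : nat) (f : T1 -> T2 -> nat) :
  enumerates code1 b1 -> enumerates code2 b2 ->
  well_formed (CFor b1 a (CFor b2 b p)) -> sized m -> z != a -> z != b ->
  (forall s t m', ints m' a 0%N 0%N = code1 s -> ints m' b 0%N 0%N = code2 t ->
     (forall z', z' \notin z :: written_ints (CFor b1 a (CFor b2 b p)) ->
        ints m' z' = ints m z') ->
     (forall z', z' \notin written_reals p -> reals m' z' = reals m z') ->
     ints (run p m') z = update (ints m') z (code1 s) (code2 t) (f s t) z) ->
  forall s t, ints (run (CFor b1 a (CFor b2 b p)) m) z (code1 s) (code2 t) = f s t.
Proof.
move=> en1 en2 wf sz za zb body s t.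
pose I (D : {set T1 * T2}) m' :=
  [/\ forall z', z' \notin z :: written_ints (CFor b1 a (CFor b2 b p)) -> ints m' z' = ints m z',
      forall z', z' \notin written_reals p -> reals m' z' = reals m z'
    & forall s t, (s, t) \in D -> ints m' z (code1 s) (code2 t) = f s t].
suff [_ _] : I setT (run (CFor b1 a (CFor b2 b p)) m) by apply; rewrite in_setT.
apply: (run_for2 en1 en2 wf sz) => [D m' k|D m' k||D s' t' m' _ [I1 I2 I3] E1 E2 _].
- move=> [I1 I2 I3]; split=> // [z' z'w|s' t' st]; last by rewrite /= update_other ?I3.
  rewrite /= update_other ?I1 //; apply: contraNneq z'w => ->.
  by rewrite !inE eqxx orbT.
- move=> [I1 I2 I3]; split=> // [z' z'w|s' t' st]; last by rewrite /= update_other ?I3.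
  rewrite /= update_other ?I1 //; apply: contraNneq z'w => ->.
  by rewrite !inE eqxx !orbT.
- by split=> // s' t'; rewrite inE.
split=> [z' z'w|z' z'w|s'' t''].
- by rewrite run_ints ?I1 //; apply: contraNN z'w => h; rewrite !inE h !orbT.
- by rewrite run_reals ?I2.
rewrite (body s' t') // updateE !inE xpair_eqE => st.
have [i1 _] := en1; have [i2 _] := en2.
rewrite (inj_eq i1) (inj_eq i2); case: ifP st => [/andP[/eqP-> /eqP->] //|_] /=.
exact: I3.
Qed.

Lemma run_fill_real (T1 T2 : finType) (code1 : T1 -> nat) (code2 : T2 -> nat) b1 b2 a b p m
    (z : nat) (f : T1 -> T2 -> R) :
  enumerates code1 b1 -> enumerates code2 b2 ->
  well_formed (CFor b1 a (CFor b2 b p)) -> sized m ->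
  (forall s t m', ints m' a 0%N 0%N = code1 s -> ints m' b 0%N 0%N = code2 t ->
     (forall z', z' \notin written_ints (CFor b1 a (CFor b2 b p)) -> ints m' z' = ints m z') ->
     (forall z', z' \notin z :: written_reals p -> reals m' z' = reals m z') ->
     reals (run p m') z = update (reals m') z (code1 s) (code2 t) (f s t) z) ->
  forall s t, reals (run (CFor b1 a (CFor b2 b p)) m) z (code1 s) (code2 t) = f s t.
Proof.
move=> en1 en2 wf sz body s t.
pose I (D : {set T1 * T2}) m' :=
  [/\ forall z', z' \notin written_ints (CFor b1 a (CFor b2 b p)) -> ints m' z' = ints m z',
      forall z', z' \notin z :: written_reals p -> reals m' z' = reals m z'
    & forall s t, (s, t) \in D -> reals m' z (code1 s) (code2 t) = f s t].
suff [_ _] : I setT (run (CFor b1 a (CFor b2 b p)) m) by apply; rewrite in_setT.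
apply: (run_for2 en1 en2 wf sz) => [D m' k|D m' k||D s' t' m' _ [I1 I2 I3] E1 E2 _].
- move=> [I1 I2 I3]; split=> // z' z'w.
  rewrite /= update_other ?I1 //; apply: contraNneq z'w => ->.
  by rewrite !inE eqxx.
- move=> [I1 I2 I3]; split=> // z' z'w.
  rewrite /= update_other ?I1 //; apply: contraNneq z'w => ->.
  by rewrite !inE eqxx !orbT.
- by split=> // s' t'; rewrite inE.
split=> [z' z'w|z' z'w|s'' t''].
- by rewrite run_ints ?I1 //; apply: contraNN z'w => h; rewrite !inE h !orbT.
- by rewrite run_reals ?I2 //; apply: contraNN z'w => h; rewrite inE h orbT.
rewrite (body s' t') // updateE !inE xpair_eqE => st.
have [i1 _] := en1; have [i2 _] := en2.
rewrite (inj_eq i1) (inj_eq i2); case: ifP st => [/andP[/eqP-> /eqP->] //|_] /=.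
exact: I3.
Qed.

End Loops.

(** * The program for spanning forests *)

Section EdmondsProgram.

(* Integer tables: 10 candidate links, 20 reachability, 21 step in which a link
   was added, 23 vertices reached by Prim's algorithm, 24 output forest.
   Real tables: 10 reduced costs.  The other arrays are registers. *)

Definition reach_init : cmd :=
  CFor true 40 (CFor true 41 (CISet 20 (reg 40) (reg 41) (eq_exp (reg 40) (reg 41)))).

Definition step_init : cmd :=
  CFor true 40 (CFor false 41 (CISet 21 (reg 40) (reg 41) (IConst 0))).

(** Registers of this phase: 27 holds a source and 26 whether there is one, 28 the verdict of the
    source test, 25 the number of steps made. Register 30 holds the least reduced cost entering, 31
    and 32 the ends of that link, 29 whether one has been seen. *)
Definition test_source : cmd :=
  CSeq (set_reg 28 (IConst 1))
    (CFor true 43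
      (CIf (BAnd (nonzero (IGet 20 (reg 43) (reg 42))) (is_zero (IGet 20 (reg 42) (reg 43))))
         (set_reg 28 (IConst 0)) CNop)).

Definition find_source : cmd :=
  CSeq (set_reg 26 (IConst 0))
    (CFor false 42
      (CSeq test_source
         (CIf (nonzero (reg 28))
            (CSeq (set_reg 26 (IConst 1)) (set_reg 27 (reg 42))) CNop))).

(** A state and the corresponding vertex have the same code, so the column index 41 may also address
    a row of the closure table. *)
Definition enters_test : bexp :=
  BAnd (is_zero (IGet 20 (reg 40) (reg 27))) (nonzero (IGet 20 (reg 41) (reg 27))).

Definition find_entering : cmd :=
  CSeq (set_reg 29 (IConst 0))
    (CFor true 40 (CFor false 41
      (CIf (BAnd (nonzero (IGet 10 (reg 40) (reg 41)))
             (BAnd enters_test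
                (BNot (BAnd (nonzero (reg 29))
                   (BRLe (RGet 30 (IConst 0) (IConst 0)) (RGet 10 (reg 40) (reg 41)))))))
         (CSeq (set_reg 29 (IConst 1))
            (CSeq (CRSet 30 (IConst 0) (IConst 0) (RGet 10 (reg 40) (reg 41)))
               (CSeq (set_reg 31 (reg 40)) (set_reg 32 (reg 41)))))
         CNop))).

Definition subtract_entering : cmd :=
  CFor true 40 (CFor false 41
    (CIf enters_test
       (CRSet 10 (reg 40) (reg 41)
          (RSub (RGet 10 (reg 40) (reg 41)) (RGet 30 (IConst 0) (IConst 0))))
       CNop)).

Definition close_reach : cmd :=
  CFor true 40 (CFor true 41
    (CIf (BAnd (nonzero (IGet 20 (reg 40) (reg 31))) (nonzero (IGet 20 (reg 32) (reg 41))))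
       (CISet 20 (reg 40) (reg 41) (IConst 1)) CNop)).

Definition dual_step_cmd : cmd :=
  CSeq find_source
    (CIf (nonzero (reg 26))
       (CSeq (set_reg 25 (IAdd (reg 25) (IConst 1)))
       (CSeq find_entering
       (CSeq subtract_entering
       (CSeq (CISet 21 (reg 31) (reg 32) (reg 25)) close_reach))))
       CNop).

(** Up to 2n steps may be required while loops have at most n + q rounds, hence two steps per
    round. *)
Definition dual_cmd : cmd :=
  CSeq reach_init (CSeq step_init (CSeq (set_reg 25 (IConst 0))
    (CFor true 50 (CSeq dual_step_cmd dual_step_cmd)))).

Variables (R : realDomainType) (n q : nat) (E : {set link n q}).
Notation V := (vertex n q).
Implicit Types (m : memory R) (c rc : link n q -> R) (ix : link n q -> nat).

Definition reach_stored m ix : Prop :=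
  forall a b : V, (ints m 20 (vcode a) (vcode b) != 0%N) = connect (arc (added ix)) a b.

Lemma eq_expE m i j : ieval m (eq_exp i j) = (ieval m i == ieval m j).
Proof.
by rewrite /=; case: eqP => [->|ne] /=; lia.
Qed.

Lemma beval_nonzero m e : beval m (nonzero e) = (ieval m e != 0%N).
Proof. by rewrite /= leqn0. Qed.

Lemma beval_is_zero m e : beval m (is_zero e) = (ieval m e == 0%N).
Proof. by rewrite /= leqn0. Qed.

Lemma run_reach_init m : sized n q m ->
  reach_stored (run reach_init m) (fun=> 0%N).
Proof.
move=> sz a b.
have -> : ints (run reach_init m) 20 (vcode a) (vcode b) = (a == b).
  apply: (@run_fill R n q _ _ _ _ _ _ _ _ _ _ 20 (fun a b : V => (a == b) : nat)
    (enumerates_vertex n q) (enumerates_vertex n q)) => // s t m' Es Et _ _.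
  have [vi _] := enumerates_vertex n q.
  rewrite -(inj_eq vi) -Es -Et.
  have -> : (ints m' 40 0 0 == ints m' 41 0 0)%N = ieval m' (eq_exp (reg 40) (reg 41)) :> nat.
    by rewrite eq_expE.
  by [].
rewrite eqb0 negbK; apply/eqP/connectP => [->|[[|w p]]]; first by exists [::].
  by [].
by case: w => //= x; rewrite inE.
Qed.

Lemma run_step_init m : sized n q m ->
  forall v x, ints (run step_init m) 21 (@vcode n q v) (x : 'I_n) = 0%N.
Proof.
move=> sz; apply: (run_fill (f := fun=> fun=> 0%N)
   (enumerates_vertex n q) (enumerates_state n q)) => // s t m' Es Et _ _.
by rewrite /= Es Et.
Qed.

Lemma run_test_source m ix x : sized n q m -> reach_stored m ix ->
  ints m 42 0%N 0%N = nat_of_ord x ->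
  ints (run test_source m) 28 0%N 0%N = source ix (inl x).
Proof.
move=> sz rs Ex.
pose I (D : {set V}) m' := [/\ ints m' 20 = ints m 20, ints m' 42 = ints m 42
  & ints m' 28 0%N 0%N =
    [forall a in D, connect (arc (added ix)) a (inl x) ==> connect (arc (added ix)) (inl x) a]].
have : I setT (run test_source m).
  rewrite /test_source run_seq.
  apply: (run_for1 (enumerates_vertex n q)) => // [|D a m' aD [I1 I2 I3] Ea sz'].
    split=> //; rewrite [LHS]/= (_ : [forall a in set0, _]) //.
    by apply/forallP=> a; rewrite inE.
  have allE : [forall b in a |: D,
        connect (arc (added ix)) b (inl x) ==> connect (arc (added ix)) (inl x) b]
      = (connect (arc (added ix)) a (inl x) ==> connect (arc (added ix)) (inl x) a) &&
        [forall a in D, connect (arc (added ix)) a (inl x) ==> connect (arc (added ix)) (inl x) a].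
    apply/forall_inP/andP=> [h|[ha /forall_inP hD] b].
      split; first by apply: h; rewrite setU11.
      by apply/forall_inP=> b bD; apply: h; rewrite inE bD orbT.
    by rewrite in_setU1 => /orP[/eqP Eb|/hD //]; rewrite Eb.
  have r1 : (ints m 20 (vcode a) x != 0%N) = connect (arc (added ix)) a (inl x).
    exact: rs a (inl x).
  have r2 : (ints m 20 x (vcode a) == 0%N) = ~~ connect (arc (added ix)) (inl x) a.
    by rewrite -(rs (inl x) a) negbK.
  have Eb : beval m' (BAnd (nonzero (IGet 20 (reg 43) (reg 42)))
      (is_zero (IGet 20 (reg 42) (reg 43)))) = ~~ (connect (arc (added ix)) a (inl x) ==>
        connect (arc (added ix)) (inl x) a).
    by rewrite negb_imply -r1 -r2 /= !leqn0 Ea I1 I2 Ex.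
  rewrite run_if Eb; case: ifPn => ax.
    by split=> //; rewrite allE (negbTE ax).
  by split=> //; rewrite allE I3; move: ax; rewrite negbK => ->.
case=> _ _ ->; rewrite /source; congr nat_of_bool; apply/forall_inP/forallP=> h a //.
by apply: h; rewrite inE.
Qed.

Lemma run_find_source m ix : sized n q m -> reach_stored m ix ->
  (ints (run find_source m) 26 0%N 0%N = 0%N /\ forall x, ~~ source ix (inl x)) \/
  (ints (run find_source m) 26 0%N 0%N != 0%N /\ exists2 x : 'I_n,
     ints (run find_source m) 27 0%N 0%N = x & source ix (inl x)).
Proof.
move=> sz rs.
pose I (D : {set 'I_n}) m' := ints m' 20 = ints m 20 /\
  ((ints m' 26 0%N 0%N = 0%N /\ forall x, x \in D -> ~~ source ix (inl x)) \/
   (ints m' 26 0%N 0%N != 0%N /\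
      exists2 x : 'I_n, ints m' 27 0%N 0%N = x & source ix (inl x))).
have : I setT (run find_source m).
  rewrite /find_source run_seq.
  apply: (run_for1 (enumerates_state n q)) => // [|D x m' xD [I1 I2] Ex sz'].
    by split=> //; left; split=> // x; rewrite inE.
  have rs' : reach_stored m' ix by rewrite /reach_stored I1.
  have E28 := run_test_source sz' rs' Ex.
  rewrite run_seq run_if beval_nonzero [ieval _ _]/= E28.
  set m1 := run test_source m' in E28 *.
  have e20 : ints m1 20 = ints m 20 by rewrite run_ints.
  have e26 : ints m1 26 = ints m' 26 by rewrite run_ints.
  have e27 : ints m1 27 = ints m' 27 by rewrite run_ints.
  have e42 : ints m1 42 = ints m' 42 by rewrite run_ints.
  case sx: (source ix (inl x)) => /=.
    split=> //; right; split=> //; exists x => //.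
    by rewrite -Ex -e42.
  split=> //; rewrite e26 e27; case: I2 => [[h1 h2]|h]; [left|by right].
  by split=> // y; rewrite in_setU1 => /predU1P[->|/h2 //]; rewrite sx.
case=> _ [[h1 h2]|]; [left|by right].
by split=> // x; apply: h2; rewrite inE.
Qed.

Definition costs_stored m a c : Prop :=
  forall v x, reals m a (vcode v) (nat_of_ord x) = c (v, x).

Lemma beval_enters m ix v x s : reach_stored m ix ->
  ints m 27 0%N 0%N = nat_of_ord s ->
  ints m 40 0%N 0%N = vcode v -> ints m 41 0%N 0%N = nat_of_ord x ->
  beval m enters_test = enters (ancestors ix (inl s)) (v, x).
Proof.
move=> rs Es Ev Ex; rewrite /enters !inE -(rs v (inl s)) -(rs (inl x) (inl s)).
by rewrite /= !leqn0 Es Ev Ex negbK.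
Qed.

Lemma run_find_entering m ix rc s : sized n q m -> reach_stored m ix ->
  ints m 27 0%N 0%N = nat_of_ord s -> stores_links m 10 E -> costs_stored m 10 rc ->
  (exists2 e, e \in E & enters (ancestors ix (inl s)) e) ->
  exists e0 : link n q, let m' := run find_entering m in
    [/\ ints m' 31 0%N 0%N = vcode e0.1, ints m' 32 0%N 0%N = e0.2,
        reals m' 30 0%N 0%N = rc e0, e0 \in E & enters (ancestors ix (inl s)) e0] /\
    (forall e, e \in E -> enters (ancestors ix (inl s)) e -> rc e0 <= rc e).
Proof.
move=> sz rs Es adj co [e1 e1E ent1].
pose P e := (e \in E) && enters (ancestors ix (inl s)) e.
pose I (D : {set link n q}) m' :=
  [/\ ints m' 10 = ints m 10, ints m' 20 = ints m 20, ints m' 27 = ints m 27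
    & reals m' 10 = reals m 10] /\
  ((ints m' 29 0%N 0%N = 0%N /\ forall e, e \in D -> ~~ P e) \/
   (ints m' 29 0%N 0%N != 0%N /\ exists e0 : link n q,
     [/\ ints m' 31 0%N 0%N = vcode e0.1, ints m' 32 0%N 0%N = e0.2,
        reals m' 30 0%N 0%N = rc e0, P e0
      & forall e, e \in D -> P e -> rc e0 <= rc e])).
have : I setT (run find_entering m).
  rewrite /find_entering run_seq.
  apply: (run_for2 (enumerates_vertex n q) (enumerates_state n q)) => //.
    by split=> //; left; split=> // e; rewrite inE.
  move=> D v x m' _ [[I1 I2 I3 I4] I5] Ev Ex sz'.
  have Eent : beval m' enters_test = enters (ancestors ix (inl s)) (v, x).
    by apply: beval_enters Ev Ex; rewrite /reach_stored ?I2 ?I3.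
  have Eadj : beval m' (nonzero (IGet 10 (reg 40) (reg 41))) = ((v, x) \in E).
    by rewrite beval_nonzero /= I1 Ev Ex.
  have Eco : reals m' 10 (ints m' 40 0 0)%N (ints m' 41 0 0)%N = rc (v, x).
    by rewrite I4 Ev Ex.
  have bAnd b1 b2 : beval m' (BAnd b1 b2) = beval m' b1 && beval m' b2 by [].
  have bNot b1 : beval m' (BNot b1) = ~~ beval m' b1 by [].
  rewrite run_if bAnd Eadj bAnd Eent bNot bAnd beval_nonzero andbA -/(P (v, x)).
  have -> : beval m' (BRLe (RGet 30 (IConst 0) (IConst 0)) (RGet 10 (reg 40) (reg 41)))
      = (reals m' 30 0%N 0%N <= rc (v, x)) by rewrite /= Eco.
  rewrite [ieval _ _]/=.
  case: (boolP (P (v, x))) => Pe; last first.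
    split=> //; case: I5 => [[h1 h2]|[h1 [e0 [h2 h3 h4 h5 h6]]]]; [left|right]; split=> //.
      by move=> e; rewrite in_setU1 => /predU1P[->|/h2].
    exists e0; split=> // e; rewrite in_setU1 => /predU1P[->|/h6 //].
    by rewrite (negbTE Pe).
  rewrite [true && _]/=; case: ifPn => [new|/negPn/andP[h1 h7]].
    split=> //; right; split=> //; exists (v, x); split=> // e.
    rewrite in_setU1 => /predU1P[->//|eD]; case: I5 new => [[h1 h2] _|[h1 [e0 [h2 h3 h4 h5 h6]]]].
      by rewrite (negbTE (h2 e eD)).
    rewrite h1 h4 /= -ltNge => lt1 Pe'; apply: le_trans (ltW lt1) _; exact: h6.
  split=> //; right; case: I5 => [[h8]|[_ [e0 [h2 h3 h4 h5 h6]]]]; first by rewrite h8 in h1.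
  split=> //; exists e0; split=> // e; rewrite in_setU1 => /predU1P[-> _|/h6 //].
  by rewrite -h4.
case=> _ [[_ /(_ e1)]|[_ [e0 [h2 h3 h4 /andP[h5 h6] h7]]]].
  by rewrite inE /P e1E ent1 => /(_ isT).
exists e0; split=> // e eE ent; apply: h7; rewrite ?inE // /P eE; exact: ent.
Qed.

Lemma run_subtract_entering m ix rc s (r : R) : sized n q m -> reach_stored m ix ->
  ints m 27 0%N 0%N = nat_of_ord s -> costs_stored m 10 rc -> reals m 30 0%N 0%N = r ->
  costs_stored (run subtract_entering m) 10
    (fun e => if enters (ancestors ix (inl s)) e then rc e - r else rc e).
Proof.
move=> sz rs Es co Er.
pose I (D : {set link n q}) m' :=
  [/\ ints m' 20 = ints m 20, ints m' 27 = ints m 27, reals m' 30 = reals m 30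
    & costs_stored m' 10 (fun e =>
       if (e \in D) && enters (ancestors ix (inl s)) e then rc e - r else rc e)].
suff [_ _ _ h] : I setT (run subtract_entering m).
  by move=> v x; rewrite h inE.
apply: (run_for2 (enumerates_vertex n q) (enumerates_state n q)) => //.
  by split=> // v x; rewrite inE.
move=> D v x m' vxD [I1 I2 I3 I4] Ev Ex sz'.
have Eent : beval m' enters_test = enters (ancestors ix (inl s)) (v, x).
  by apply: beval_enters Ev Ex; rewrite /reach_stored ?I1 ?I2.
have [vi _] := enumerates_vertex n q.
rewrite run_if Eent; case: ifP => ent; split=> // w y; last first.
  rewrite I4 in_setU1; case: eqVneq => [->|//]; by rewrite ent !andbF.
rewrite /= updateE I3 Er Ev Ex I4 (negbTE vxD) /= (inj_eq vi) (inj_eq val_inj) I4.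
rewrite in_setU1 xpair_eqE; case: eqVneq => [->|] //=; case: eqVneq => [->|] //=.
by rewrite ent.
Qed.

(** The table is overwritten while being read. This is harmless: the entries consulted form the
    column of [e0.1] and the row of [e0.2], and the rule marks such an entry only if it was marked
    already. *)
Lemma run_close_reach m ix (e0 : link n q) k : (0 < k)%N -> sized n q m ->
  reach_stored m ix ->
  ints m 31 0%N 0%N = vcode e0.1 -> ints m 32 0%N 0%N = e0.2 ->
  reach_stored (run close_reach m) (update_ix ix e0 k).
Proof.
move=> k0 sz rs E31 E32; pose cn := connect (arc (added ix)).
pose I (D : {set V * V}) m' :=
  [/\ ints m' 31 = ints m 31, ints m' 32 = ints m 32
    & forall a b : V, (ints m' 20 (vcode a) (vcode b) != 0%N) =
       cn a b || [&& (a, b) \in D, cn a e0.1 & cn (inl e0.2) b]].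
suff [_ _ h] : I setT (run close_reach m).
  move=> a b; rewrite h inE /=; case: e0 {E31 E32 I h} => v x /=.
  have /setP/(_ a) := ancestors_update ix v x b k0; rewrite inE => ->.
  by case: ifP; rewrite !inE /cn => ->; rewrite ?andbT ?andbF ?orbF.
apply: (run_for2 (enumerates_vertex n q) (enumerates_vertex n q)) => //.
  by split=> // a b; rewrite inE /= orbF; apply: rs.
move=> D a b m' _ [I1 I2 I3] Ea Eb sz'.
have Econd : beval m' (BAnd (nonzero (IGet 20 (reg 40) (reg 31)))
    (nonzero (IGet 20 (reg 32) (reg 41)))) = cn a e0.1 && cn (inl e0.2) b.
  have E31' : ints m' 31 0%N 0%N = vcode e0.1 by rewrite I1.
  have E32' : ints m' 32 0%N 0%N = vcode (inl e0.2 : V) by rewrite I2.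
  rewrite [beval _ _]/= !leqn0 Ea Eb E31' E32' !I3.
  congr (_ && _); apply/orP/idP=> [[//|/and3P[]//]|]; by left.
have [vi _] := enumerates_vertex n q.
rewrite run_if Econd; case: ifP => ab; split=> // a' b'; last first.
  by rewrite I3 in_setU1; case: eqVneq => [[-> ->]|//]; rewrite ab !andbF.
rewrite /= updateE Ea Eb !(inj_eq vi) in_setU1 xpair_eqE; case: ifP => [/andP[/eqP-> /eqP->]|_].
  by rewrite ab orbT.
exact: I3.
Qed.

(** After [k] steps either no source is left, and further steps idle, or the potential has dropped
    by at least [k] from its initial bound 2n. *)
Definition dual_memory c k m : Prop :=
  exists t ix rc K y,
    [/\ dual_state E c t ix rc K y, ints m 25 0%N 0%N = t,
        forall v x, ints m 21 (vcode v) (nat_of_ord x) = ix (v, x),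
        costs_stored m 10 rc
      & reach_stored m ix] /\
    ((forall x, ~~ source ix (inl x)) \/
     (#|components ix| + #|source_components ix| + k <= n + n)%N).

Lemma run_dual_step c k m : reachable E -> sized n q m -> stores_links m 10 E ->
  dual_memory c k m -> dual_memory c k.+1 (run dual_step_cmd m).
Proof.
move=> rE sz adj [t [ix [rc [K [y [[ds Et st co rs] pot]]]]]].
rewrite /dual_step_cmd run_seq; set m1 := run find_source m.
have sz1 : sized n q m1 by apply: sized_run.
have rs1 : reach_stored m1 ix by rewrite /reach_stored run_ints.
have st1 v x : ints m1 21 (vcode v) (nat_of_ord x) = ix (v, x) by rewrite run_ints.
have co1 : costs_stored m1 10 rc by rewrite /costs_stored run_reals.
have adj1 : stores_links m1 10 E by rewrite /stores_links run_ints.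
have Et1 : ints m1 25 0%N 0%N = t by rewrite run_ints.
rewrite run_if beval_nonzero; case: (run_find_source sz rs) => -[]; rewrite -/m1 => E26.
  move=> nos; rewrite /= E26 /=.
  by exists t, ix, rc, K, y; split=> //; left.
case=> s E27 ss; rewrite [ieval _ _]/= E26.
rewrite run_seq; set m2 := run _ m1.
have sz2 : sized n q m2 by apply: sized_run.
have Et2 : ints m2 25 0%N 0%N = t.+1 by rewrite /= updateE /= Et1 addn1.
rewrite run_seq; set m3 := run find_entering m2.
have sz3 : sized n q m3 by apply: sized_run.
have exE : exists2 e, e \in E & enters (ancestors ix (inl s)) e.
  apply: exists_entering => //; last by move=> u; apply: source_no_input.
  by apply/set0Pn; exists (inl s); rewrite inE connect0.
have [e0 [[E31 E32 E30 e0E ent0] min0]] := run_find_entering sz2 rs1 E27 adj1 co1 exE.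
rewrite -/m3 in E31 E32 E30.
have rs3 : reach_stored m3 ix by rewrite /reach_stored run_ints.
have E27' : ints m3 27 0%N 0%N = s by rewrite run_ints.
have co3 : costs_stored m3 10 rc by rewrite /costs_stored run_reals.
rewrite run_seq; set m4 := run subtract_entering m3.
have sz4 : sized n q m4 by apply: sized_run.
have co4 : costs_stored m4 10 _ := run_subtract_entering sz3 rs3 E27' co3 E30.
have E25 : ints m4 25 0%N 0%N = t.+1 by rewrite run_ints // run_ints.
have E31' : ints m4 31 0%N 0%N = vcode e0.1 by rewrite run_ints.
have E32' : ints m4 32 0%N 0%N = e0.2 by rewrite run_ints.
rewrite run_seq; set m5 := run _ m4.
have rs5 : reach_stored m5 ix by rewrite /reach_stored run_ints // run_ints.
have sz5 : sized n q m5 by apply: sized_run.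
have rs6 := run_close_reach (ltn0Sn t) sz5 rs5 E31' E32'.
have [K' [y' ds']] := dual_step ds ss e0E ent0 min0.
exists t.+1, (update_ix ix e0 t.+1),
  (fun e => if enters (ancestors ix (inl s)) e then rc e - rc e0 else rc e), K', y'.
split; [split=> //|right].
- by rewrite run_ints.
- move=> v x; rewrite run_ints // /= updateE E31' E32' E25 /update_ix.
  have [vi _] := enumerates_vertex n q.
  rewrite (inj_eq vi) (inj_eq val_inj); case: (e0) => v0 x0 /=; rewrite xpair_eqE.
  case: ifP => // _; by rewrite /m4 !run_ints.
- by rewrite /costs_stored run_reals.
case: pot => [nos|pot]; first by have := nos s; rewrite ss.
case: e0 ent0 {E31 E32 E30 e0E min0 E31' E32' rs6 ds' co4} => v0 x0 /andP[v0K x0K].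
have := components_decrease (k := t.+1) isT (x := x0) (v := v0) (ix := ix).
(* The link [e0] may enter the component at a state [x0] other than [s]. Both have the same
   ancestors, and [x0] is a source as well, so the potential argument applies to [x0]. *)
have EA := source_ancestors ss x0K.
rewrite EA => /(_ _ v0K); have sx0 : source ix (inl x0).
  apply/forallP=> a; apply/implyP=> ax.
  have : inl x0 \in ancestors ix a; last by rewrite inE.
  rewrite (source_ancestors ss) // -?EA inE //.
by move=> /(_ sx0) dec; rewrite addnS; apply: leq_trans pot; rewrite ltn_add2r.
Qed.

Lemma run_dual c m : reachable E -> sized n q m -> stores_links m 10 E ->
  (forall e, e \in E -> 0 <= c e) -> costs_stored m 10 c ->
  exists t ix rc K y,
    [/\ dual_state E c t ix rc K y, reachable (added ix)
      & forall v x, ints (run dual_cmd m) 21 (vcode v) (nat_of_ord x) = ix (v, x)].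
Proof.
move=> rE sz adj c0 co; rewrite /dual_cmd run_seq.
set m1 := run _ m; have sz1 : sized n q m1 by apply: sized_run.
have rs1 : reach_stored m1 (fun=> 0%N) by apply: run_reach_init.
rewrite run_seq; set m2 := run _ m1; have sz2 : sized n q m2 by apply: sized_run.
have ix2 := run_step_init sz1; rewrite -/m2 in ix2.
rewrite run_seq; set m3 := run _ m2; have sz3 : sized n q m3 by apply: sized_run.
pose I (D : {set V}) m' := [/\ stores_links m' 10 E, sized n q m' & dual_memory c (#|D| + #|D|) m'].
suff [_ _ [t [ix [rc [K [y [[ds _ st _ rs] pot]]]]]]] :
    I setT (run (CFor true 50 (CSeq dual_step_cmd dual_step_cmd)) m3).
  exists t, ix, rc, K, y; split=> //; apply: no_source_reachable.
  (* A remaining source makes both counts positive, whereas 2(n + q) steps have used up the whole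
     potential. *)
  case: pot => // pot x; apply/negP=> sx.
  have : (0 < #|source_components ix|)%N.
    rewrite card_gt0; apply/set0Pn; exists (ancestors ix (inl x)).
    by apply/imsetP; exists x; rewrite ?inE.
  have : (0 < #|components ix|)%N.
    rewrite card_gt0; apply/set0Pn; exists (ancestors ix (inl x)).
    by apply/imsetP; exists x; rewrite ?inE.
  move: pot; rewrite cardsT card_sum !card_ord; lia.
apply: (run_for1 (enumerates_vertex n q)) => // [|D v m' vD [adj' sz' dm'] _ _].
  split=> //; first by rewrite /stores_links run_ints // run_ints // run_ints.
  rewrite cards0; exists 0%N, (fun=> 0%N), c, (fun=> set0), (fun=> 0); split.
    split=> //; first exact: dual_state0.
      by rewrite /costs_stored !run_reals.
    by rewrite /reach_stored run_ints // run_ints.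
  by right; rewrite !addn0; apply: components_bound.
have adj'' : stores_links (run dual_step_cmd m') 10 E by rewrite /stores_links run_ints.
split; [by rewrite /stores_links run_ints|by apply: sized_run|].
have -> : (#|v |: D| + #|v |: D| = (#|D| + #|D|).+2)%N by rewrite cardsU1 vD; lia.
rewrite run_seq; apply: run_dual_step => //; first exact: sized_run.
exact: run_dual_step.
Qed.

End EdmondsProgram.

(** * The program growing the forest *)

Section PrimProgram.

Definition prim_init : cmd :=
  CFor true 40 (CFor false 41 (CISet 24 (reg 40) (reg 41) (IConst 0))).

Definition mark_inputs : cmd :=
  CFor true 40
    (CIf (BILe (reg 0) (reg 40)) (CISet 23 (reg 40) (IConst 0) (IConst 1))
       (CISet 23 (reg 40) (IConst 0) (IConst 0))).

Definition find_leaving : cmd :=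
  CSeq (set_reg 29 (IConst 0))
    (CFor true 40 (CFor false 41
      (CIf (BAnd (BAnd (nonzero (IGet 21 (reg 40) (reg 41)))
                   (BAnd (nonzero (IGet 23 (reg 40) (IConst 0)))
                      (is_zero (IGet 23 (reg 41) (IConst 0)))))
             (BNot (BAnd (nonzero (reg 29)) (BILe (reg 33) (IGet 21 (reg 40) (reg 41))))))
         (CSeq (set_reg 29 (IConst 1))
            (CSeq (set_reg 33 (IGet 21 (reg 40) (reg 41)))
               (CSeq (set_reg 31 (reg 40)) (set_reg 32 (reg 41)))))
         CNop))).

Definition prim_step_cmd : cmd :=
  CSeq find_leaving
    (CSeq (CISet 24 (reg 31) (reg 32) (IConst 1))
       (CISet 23 (reg 32) (IConst 0) (IConst 1))).

Definition prim_cmd : cmd :=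
  CSeq prim_init (CSeq mark_inputs (CFor false 50 prim_step_cmd)).

Definition forest_cmd : cmd := CSeq dual_cmd prim_cmd.

Variables (R : realDomainType) (n q : nat) (E : {set link n q}).
Notation V := (vertex n q).
Implicit Types (m : memory R) (c : link n q -> R).

Definition input_set : {set V} := [set w | if w is inr _ then true else false].

Definition set_stored m a (Q : {set V}) : Prop :=
  forall v, (ints m a (vcode v) 0%N != 0%N) = (v \in Q).

Lemma run_prim_init m : sized n q m -> stores_links (run prim_init m) 24 (set0 : {set link n q}).
Proof.
move=> sz v x; rewrite inE; apply/eqP.
apply: (run_fill (f := fun=> fun=> 0%N)
   (enumerates_vertex n q) (enumerates_state n q)) => // s t m' Es Et _ _.
by rewrite /= Es Et.
Qed.

Lemma run_mark_inputs m : sized n q m -> set_stored (run mark_inputs m) 23 input_set.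
Proof.
move=> sz; pose I (D : {set V}) m' := forall v, v \in D ->
  (ints m' 23 (vcode v) 0%N != 0%N) = (v \in input_set).
suff h : I setT (run mark_inputs m) by move=> v; apply: h; rewrite inE.
apply: (run_for1 (enumerates_vertex n q)) => // [v|D v m' vD ID Ev [sn sq] w].
  by rewrite inE.
have [vi _] := enumerates_vertex n q.
have -> : ints (run (CIf (BILe (reg 0) (reg 40)) (CISet 23 (reg 40) (IConst 0) (IConst 1))
       (CISet 23 (reg 40) (IConst 0) (IConst 0))) m') 23 (vcode w) 0%N
   = if w == v then (n <= vcode v)%N : nat else ints m' 23 (vcode w) 0%N.
  rewrite run_if [beval _ _]/= sn Ev.
  by case: leqP => _; rewrite /= updateE Ev (inj_eq vi) andbT.
rewrite in_setU1; case: eqVneq => [->|_ /ID//] _.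
by rewrite inE; case: (v) => x /=; rewrite ?leq_addr // leqNgt ltn_ord.
Qed.

Lemma run_find_leaving m ix (Q : {set V}) : sized n q m ->
  (forall v (x : 'I_n), ints m 21 (vcode v) x = ix (v, x)) -> set_stored m 23 Q ->
  (exists e : link n q, [&& (0 < ix e)%N, e.1 \in Q & inl e.2 \notin Q]) ->
  exists e0 : link n q, let m' := run find_leaving m in
    [/\ ints m' 31 0%N 0%N = vcode e0.1, ints m' 32 0%N 0%N = e0.2,
        [&& (0 < ix e0)%N, e0.1 \in Q & inl e0.2 \notin Q]
      & forall e : link n q, [&& (0 < ix e)%N, e.1 \in Q & inl e.2 \notin Q] -> (ix e0 <= ix e)%N].
Proof.
move=> sz st inQ [e1 Pe1].
pose P (e : link n q) := [&& (0 < ix e)%N, e.1 \in Q & inl e.2 \notin Q].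
pose I (D : {set link n q}) m' :=
  [/\ ints m' 21 = ints m 21 & ints m' 23 = ints m 23] /\
  ((ints m' 29 0%N 0%N = 0%N /\ forall e, e \in D -> ~~ P e) \/
   (ints m' 29 0%N 0%N != 0%N /\ exists e0 : link n q,
     [/\ ints m' 31 0%N 0%N = vcode e0.1, ints m' 32 0%N 0%N = e0.2,
        ints m' 33 0%N 0%N = ix e0, P e0
      & forall e, e \in D -> P e -> (ix e0 <= ix e)%N])).
have : I setT (run find_leaving m).
  rewrite /find_leaving run_seq.
  apply: (run_for2 (enumerates_vertex n q) (enumerates_state n q)) => //.
    by split=> //; left; split=> // e; rewrite inE.
  move=> D v x m' _ [[I1 I2] I5] Ev Ex sz'.
  set test := BAnd (nonzero _) (BAnd _ _).
  have Eix : ints m' 21 (ints m' 40 0 0)%N (ints m' 41 0 0)%N = ix (v, x).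
    by rewrite I1 Ev Ex st.
  have Etest : beval m' test = P (v, x).
    rewrite /P -(inQ v) -(inQ (inl x)) /test [beval _ _]/= !leqn0 Eix I2 Ev Ex.
    by rewrite lt0n negbK.
  have bAnd b1 b2 : beval m' (BAnd b1 b2) = beval m' b1 && beval m' b2 by [].
  have bNot b1 : beval m' (BNot b1) = ~~ beval m' b1 by [].
  rewrite run_if bAnd Etest bNot bAnd beval_nonzero.
  have -> : beval m' (BILe (reg 33) (IGet 21 (reg 40) (reg 41)))
      = (ints m' 33 0%N 0%N <= ix (v, x))%N by rewrite /= Eix.
  rewrite [ieval _ _]/=.
  case: (boolP (P (v, x))) => Pe; last first.
    split=> //; case: I5 => [[h1 h2]|[h1 [e0 [h2 h3 h4 h5 h6]]]]; [left|right]; split=> //.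
      by move=> e; rewrite in_setU1 => /predU1P[->|/h2].
    exists e0; split=> // e; rewrite in_setU1 => /predU1P[->|/h6 //].
    by rewrite (negbTE Pe).
  rewrite [true && _]/=; case: ifPn => [new|/negPn/andP[h1 h7]].
    split=> //; right; split=> //; exists (v, x); split=> // e.
    rewrite in_setU1 => /predU1P[->//|eD]; case: I5 new => [[h1 h2] _|[h1 [e0 [h2 h3 h4 h5 h6]]]].
      by rewrite (negbTE (h2 e eD)).
    rewrite h1 h4 /= -ltnNge => lt1 Pe'; apply: leq_trans (ltnW lt1) _; exact: h6.
  split=> //; right; case: I5 => [[h8]|[_ [e0 [h2 h3 h4 h5 h6]]]]; first by rewrite h8 in h1.
  split=> //; exists e0; split=> // e; rewrite in_setU1 => /predU1P[-> _|/h6 //].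
  by rewrite -h4.
case=> _ [[_ /(_ e1)]|[_ [e0 [h2 h3 h4 h5 h7]]]].
  by rewrite inE /P Pe1 => /(_ isT).
by exists e0; split=> // e Pe; apply: h7; rewrite ?inE.
Qed.

(** The [q] inputs belong to [Q] from the start and each round adds one state, so [n] rounds exhaust
    the vertices. *)
Definition prim_memory t ix K k m : Prop := exists Q F,
  [/\ prim_state t ix K Q F, set_stored m 23 Q, stores_links m 24 F,
      forall v (x : 'I_n), ints m 21 (vcode v) x = ix (v, x) & #|Q| = (q + k)%N].

Lemma run_prim_step c t ix rc K y k m : sized n q m -> reachable (added ix) ->
  dual_state E c t ix rc K y -> (k < n)%N ->
  prim_memory t ix K k m -> prim_memory t ix K k.+1 (run prim_step_cmd m).
Proof.
move=> sz rA ds kn [Q [F [ps inQ outF st cQ]]].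
have exE : exists e : link n q, [&& (0 < ix e)%N, e.1 \in Q & inl e.2 \notin Q].
  have [||v [x [vx vQ xQ]]] := reachable_crossing rA (Q := Q).
  - by case: ps => [[]].
  - apply/eqP=> EQ; move: cQ; rewrite EQ cardsT card_sum !card_ord addnC => /addnI En.
    by rewrite En ltnn in kn.
  by exists (v, x); rewrite inE in vx; rewrite vx vQ.
have [[v x] [E31 E32 /and3P[ix0 vQ xQ] min0]] := run_find_leaving sz st inQ exE.
rewrite [_.1]/= [_.2]/= in vQ xQ E31 E32.
rewrite /prim_step_cmd run_seq; set m1 := run find_leaving m in E31 E32 *.
have i1 a : a \notin written_ints find_leaving -> ints m1 a = ints m a.
  by move=> ?; rewrite run_ints.
exists (inl x |: Q), ((v, x) |: F); split.
- by apply: prim_step ds ps ix0 vQ xQ _ => v' x' *; apply: min0; apply/and3P.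
- have [vi _] := enumerates_vertex n q.
  have E32' : ints m1 32 0%N 0%N = vcode (inl x : V) by [].
  move=> w; rewrite /= updateE !update_other // E32' andbT (inj_eq vi) in_setU1.
  case: (eqVneq w (inl x)) => //= _; rewrite (i1 23%N) //; exact: inQ.
- have [vi _] := enumerates_vertex n q.
  move=> w z; rewrite /= update_other // updateE E31 E32 (inj_eq vi) (inj_eq val_inj).
  rewrite in_setU1 xpair_eqE; case: ifP => //= _; rewrite (i1 24%N) //; exact: outF.
- move=> w z; rewrite /= !update_other // (i1 21%N) //.
by rewrite cardsU1 xQ cQ add1n addnS.
Qed.

Lemma card_input_set : #|input_set| = q.
Proof.
have -> : input_set = [set inr u | u in 'I_q].
  apply/setP=> -[x|u]; rewrite inE; first by apply/esym/imsetP=> -[].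
  by rewrite imset_f.
by rewrite card_imset ?card_ord //; apply: inr_inj.
Qed.

Lemma run_forest c m : reachable E -> sized n q m -> stores_links m 10 E ->
  (forall e, e \in E -> 0 <= c e) -> costs_stored m 10 c ->
  exists2 F, minimal_spanning_forest E c F & stores_links (run forest_cmd m) 24 F.
Proof.
move=> rE sz adj c0 co; have [t [ix [rc [K [y [ds rA st]]]]]] := run_dual rE sz adj c0 co.
rewrite /forest_cmd run_seq; set m1 := run dual_cmd m in st *.
have sz1 : sized n q m1 by apply: sized_run.
rewrite /prim_cmd run_seq; set m2 := run prim_init m1.
have sz2 : sized n q m2 by apply: sized_run.
have out2 := run_prim_init sz1; rewrite -/m2 in out2.
rewrite run_seq; set m3 := run mark_inputs m2.
have sz3 : sized n q m3 by apply: sized_run.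
have in3 := run_mark_inputs sz2; rewrite -/m3 in in3.
pose I (D : {set 'I_n}) m' := prim_memory t ix K #|D| m'.
have [Q [F [ps _ outF _ cQ]]] : I setT (run (CFor false 50 prim_step_cmd) m3).
  apply: (run_for1 (enumerates_state n q)) => // [|D x m' xD ID _ sz'].
    exists input_set, set0; split.
    - exact: prim_state0 ds.
    - exact: in3.
    - by rewrite /stores_links run_ints.
    - by move=> v x; rewrite run_ints // run_ints.
    by rewrite cards0 addn0 card_input_set.
  rewrite /I cardsU1 xD add1n; apply: run_prim_step ds _ ID => //.
  rewrite -[X in (_ < X)%N]card_ord -cardsT; apply: proper_card.
  by apply/properP; split; [apply/subsetP=> z; rewrite !inE | exists x; rewrite ?inE].
have EQ : Q = setT.
  apply/eqP; rewrite eqEcard subsetT /= cardsT card_sum !card_ord cQ cardsT card_ord.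
  by rewrite addnC.
by exists F => //; apply: prim_optimal ds _; rewrite -EQ.
Qed.

End PrimProgram.

(** * Minimum cost matchings *)

Section Hungarian.
Variables (R : realDomainType) (n q : nat) (E : {set link n q}).
Variable c : link n q -> R.
Notation V := (vertex n q).
Implicit Types (mt : 'I_n -> option V) (u : 'I_n -> R) (v minv : V -> R).
Implicit Types (used : V -> nat) (way : V -> option 'I_n) (P inR : {set 'I_n}).

Definition reduced u v (e : link n q) : R := c e - u e.2 - v e.1.

(* Optimality conditions for the matching [mt] of the states of [P].  While an
   augmenting path is being flipped, the vertex [free] is exempted from
   complementary slackness. *)
Definition tight_matching P mt u v (free : option V) : Prop :=
  [/\ forall e, e \in E -> 0 <= reduced u v e,
      forall x, (mt x != None) = (x \in P),
      forall x y w, mt x = Some w -> mt y = Some w -> x = y,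
      forall x w, mt x = Some w -> ((w, x) \in E) /\ reduced u v (w, x) = 0
    & forall w, v w <= 0 /\ [\/ v w = 0, exists x, mt x = Some w | free = Some w]].

(** [way w] is the tree state through which [w] was entered. It is the root, or it is matched to a
    vertex entered strictly earlier, so tracing back terminates. The cutoff [t] restricts the claim
    to the part of the tree that an ongoing augmentation still uses. *)
Definition way_ok mt u v used way i (t : nat) : Prop := forall w,
  (0 < used w <= t)%N -> exists x,
    [/\ way w = Some x, (w, x) \in E, reduced u v (w, x) = 0
      & x = i \/ exists2 w', mt x = Some w' & (0 < used w' < used w)%N].

(* [used w] is the time at which [w] entered the alternating tree rooted at the
   unmatched state [i], and [0] if it did not. *)
Definition alternating_tree mt used inR r i t : Prop :=
  [/\ [/\ mt i = None, i \in r |: inR, r \notin inR & #|inR| = t],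
      forall w, (used w <= t)%N,
      forall w, (0 < used w)%N -> exists2 x, mt x = Some w & x \in r |: inR
    & forall x, x \in r |: inR -> x = i \/ exists2 w, mt x = Some w & (0 < used w)%N].

(** An absent [way w] stands for an infinite slack; the stored number [minv w] is then
    meaningless. *)
Definition slack_ok u v used way minv inR : Prop := forall w, used w = 0%N ->
  if way w is Some x then
    [/\ x \in inR, (w, x) \in E, minv w = reduced u v (w, x)
      & forall y, y \in inR -> (w, y) \in E -> minv w <= reduced u v (w, y)]
  else forall x, x \in inR -> (w, x) \notin E.

Definition improves u v used way minv r w : bool :=
  [&& used w == 0%N, (w, r) \in E
    & ~~ ((way w != None) && (minv w <= reduced u v (w, r)))].

Lemma slack_scan u v used way minv inR r :
  slack_ok u v used way minv inR ->
  slack_ok u v used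
    (fun w => if improves u v used way minv r w then Some r else way w)
    (fun w => if improves u v used way minv r w then reduced u v (w, r) else minv w)
    (r |: inR).
Proof.
move=> sl w uw; have := sl w uw; rewrite /improves uw eqxx /=.
case Ew: ((w, r) \in E) => /=; case: (way w) => [x|] /=.
- move=> [xR xE mE mmin]; case: ifPn => [|/negPn le].
    rewrite -ltNge => lt; split=> //; first exact: setU11.
    move=> y; rewrite in_setU1 => /predU1P[->//|yR yE].
    exact: le_trans (ltW lt) (mmin y yR yE).
  split=> //; first by rewrite in_setU1 xR orbT.
  by move=> y; rewrite in_setU1 => /predU1P[->//|]; apply: mmin.
- move=> nE; split=> //; first exact: setU11.
  by move=> y; rewrite in_setU1 => /predU1P[->//|/nE/negbTE->].
- move=> [xR xE mE mmin]; split=> //; first by rewrite in_setU1 xR orbT.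
  by move=> y; rewrite in_setU1 => /predU1P[->|]; [rewrite Ew | apply: mmin].
by move=> nE x; rewrite in_setU1 => /predU1P[->|/nE //]; rewrite Ew.
Qed.

(* Hall's argument: the states of the tree outnumber its used vertices. *)
Lemma exists_slack mt u v used way minv inR r i t :
  perfect E -> alternating_tree mt used inR r i t ->
  slack_ok u v used way minv (r |: inR) ->
  exists2 w, used w = 0%N & way w != None.
Proof.
move=> [pm pmI pmE] [[mti iR rR cR] _ tree2 _] sl; apply: contrapT => none.
have sub : pm @: (r |: inR) \subset [set w | (0 < used w)%N].
  apply/subsetP=> _ /imsetP[x xR ->]; rewrite inE lt0n; apply/negP=> /eqP ux.
  have := sl _ ux; case Ew: (way (pm x)) => [y|]; last by move=> /(_ x xR); rewrite pmE.
  by move=> _; case: none; exists (pm x); rewrite ?Ew.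
have sub2 : [set Some w | w in [set w | (0 < used w)%N]] \subset mt @: ((r |: inR) :\ i).
  apply/subsetP=> _ /imsetP[w + ->]; rewrite inE => /tree2[x mx xR].
  rewrite -mx; apply: imset_f; rewrite !inE -in_setU1 xR andbT.
  by apply/eqP=> Ex; rewrite Ex mti in mx.
have := subset_leq_card sub; rewrite card_imset // => le1.
have := subset_leq_card sub2; rewrite card_imset => [le2|]; last by move=> ? ? [].
have := leq_trans le1 (leq_trans le2 (leq_imset_card _ _)).
by rewrite [X in (X <= _)%N](cardsD1 i) iR ltnn.
Qed.

(** * The dual update of the Hungarian algorithm *)

Section DualUpdate.
Variables (P : {set 'I_n}) (mt : 'I_n -> option V) (u : 'I_n -> R) (v : V -> R).
Variables (used : V -> nat) (way : V -> option 'I_n) (minv : V -> R).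
Variables (inR : {set 'I_n}) (r i : 'I_n) (t : nat) (j : V).
Hypotheses (tm : tight_matching P mt u v None) (wo : way_ok mt u v used way i t).
Hypothesis (tree : alternating_tree mt used inR r i t).
Hypothesis (wR : forall w, (0 < used w)%N -> exists2 x, way w = Some x & x \in inR).
Hypothesis (sl : slack_ok u v used way minv (r |: inR)).
Hypotheses (uj : used j = 0%N) (wj : way j != None).
Hypothesis (minj : forall w, used w = 0%N -> way w != None -> minv j <= minv w).

Let d := minv j.
Let u' x := if x \in r |: inR then u x + d else u x.
Let v' w := if (0 < used w)%N then v w - d else v w.
Let used' w := if w == j then t.+1 else used w.

Lemma delta_ge0 : 0 <= d.
Proof.
have := sl uj; rewrite /d; case: (way j) wj => [x|] // _ [_ xE -> _].
by have [feas _ _ _ _] := tm; apply: feas.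
Qed.

Lemma reduced_update w x : reduced u' v' (w, x) =
  reduced u v (w, x) + (if (0 < used w)%N then d else 0) - (if x \in r |: inR then d else 0).
Proof.
by rewrite /reduced /u' /v' /=; case: ifP => _; case: ifP => _; ring.
Qed.

(** A reduced cost changes only if exactly one end of the link is in the tree. It decreases when
    that end is the state, and then [d] is at most the slack. Matched pairs have both ends in the
    tree or neither. Lowering [v] is allowed on used vertices since they are matched. *)
Lemma tight_update : tight_matching P mt u' v' None.
Proof.
have d0 := delta_ge0; have [feas dom inj tight vneg] := tm.
have [_ _ tree2 tree3] := tree.
split=> // [[w x] wxE|x w mx|w].
- rewrite reduced_update; case: (posnP (used w)) => uw; case: ifP => xR.
  + rewrite addr0 subr_ge0; have := sl uw; case Ew: (way w) => [y|].
      by move=> [_ _ _ /(_ x xR wxE)]; apply: le_trans; apply: minj; rewrite ?Ew.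
    by move=> /(_ x xR); rewrite wxE.
  + by rewrite addr0 subr0 feas.
  + by rewrite addrK feas.
  by rewrite subr0 addr_ge0 ?feas.
- have [wxE rc0] := tight _ _ mx; split=> //; rewrite reduced_update rc0.
  case: (boolP (x \in _)) => xR.
    have [Ei|[w' mx' uw']] := tree3 x xR.
      by move: mx; rewrite Ei; case: tree => -[-> _ _ _].
    by move: mx uw'; rewrite mx' => -[->] ->; rewrite addrK.
  case: (posnP (used w)) => uw; first by rewrite !addr0 subr0.
  have [y my yR] := tree2 w uw.
  by rewrite (inj _ _ _ mx my) yR in xR.
have [vw hw] := vneg w; rewrite /v'; case: ifP => uw //; split.
  by rewrite subr_le0 (le_trans vw).
by have [y my _] := tree2 w uw; constructor 2; exists y.
Qed.

Lemma slack_update :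
  slack_ok u' v' used' way (fun w => minv w - (if (0 < used w)%N then 0 else d)) (r |: inR).
Proof.
move=> w; rewrite /used'; case: eqVneq => // _ uw; rewrite uw /=.
have := sl uw; case: (way w) => [x|//] [xR xE mE mmin]; split=> // [|y yR yE].
  by rewrite reduced_update uw xR addr0 mE.
by rewrite reduced_update uw yR addr0 lerD2r mmin.
Qed.

Lemma way_update : way_ok mt u' v' used' way i t.+1.
Proof.
have [[mti _ _ _] tree1 tree2 tree3] := tree.
move=> w; rewrite /used'; case: eqVneq => [-> _|wnj /andP[uw _]].
  have := sl uj; case Ew: (way j) wj => [x|] // _ [xR xE mE _].
  exists x; split=> //; first by rewrite reduced_update uj xR addr0 -mE subrr.
  have [Ei|[w' mx uw']] := tree3 x xR; [by left|right; exists w' => //].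
  rewrite ?eqxx; case: (eqVneq w' j) => [Ew'|_]; first by rewrite Ew' uj in uw'.
  by rewrite uw' ltnS tree1.
have [|x [wx xE rc0 hx]] := wo (w := w); first by rewrite uw tree1.
have [x' wx'] := wR uw; rewrite wx in wx'; case: wx' => <- xR.
exists x; split=> //; first by rewrite reduced_update uw in_setU1 xR orbT addrK.
case: hx => [|[w' mx /andP[uw' lt]]]; [by left|right; exists w' => //].
by case: eqVneq uw' => [->|_ ->]; rewrite ?uj.
Qed.

Lemma way_tree_update w : (0 < used' w)%N ->
  exists2 x, way w = Some x & x \in r |: inR.
Proof.
rewrite /used'; case: eqVneq => [-> _|_ /wR[x wx xR]]; last first.
  by exists x; rewrite // in_setU1 xR orbT.
by have := sl uj; case: (way j) wj => [x|] // _ [xR _ _ _]; exists x.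
Qed.

Lemma tree_update x : mt x = Some j ->
  alternating_tree mt used' (r |: inR) x i t.+1.
Proof.
have [[mti iR rR cR] tree1 tree2 tree3] := tree; move=> mx.
have [_ _ inj _ _] := tm.
have xR : x \notin r |: inR.
  apply/negP=> /tree3[Ei|[w mw uw]]; first by rewrite Ei mti in mx.
  by move: mw; rewrite mx => -[Ew]; rewrite -Ew uj in uw.
split.
- by split=> //; [rewrite in_setU1 iR orbT | rewrite cardsU1 rR cR].
- by move=> w; rewrite /used'; case: eqVneq => // _; apply: leqW.
- move=> w; rewrite /used'; case: eqVneq => [-> _|_ /tree2[y my yR]].
    by exists x; rewrite // setU11.
  by exists y; rewrite // in_setU1 yR orbT.
move=> y; rewrite in_setU1 => /predU1P[->|/tree3[->|[w mw uw]]].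
- by right; exists j; rewrite // /used' eqxx.
- by left.
by right; exists w; rewrite // /used'; case: eqVneq => // _.
Qed.

End DualUpdate.

(** The vertex [j] is the current end of the path: it has just lost its partner, or never had one,
    and is about to be matched to [way j]. *)
Definition augmenting P mt u v used way i j : Prop :=
  [/\ tight_matching P mt u v (Some j), i \notin P, forall x, mt x <> Some j,
      (0 < used j)%N & way_ok mt u v used way i (used j)].

Definition rematch mt x j : 'I_n -> option V := fun y => if y == x then Some j else mt y.

(** Matching [way j] to [j] releases the former partner [w] of that state, which was entered earlier
    and takes over the role of [j]. If there was no partner, the state is the root [i] and the path
    is complete. *)
Lemma augment_step P mt u v used way i j :
  augmenting P mt u v used way i j ->
  exists x, [/\ way j = Some x,
    mt x = None -> tight_matching (i |: P) (rematch mt x j) u v None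
    & forall w, mt x = Some w -> (used w < used j)%N /\
        augmenting P (rematch mt x j) u v used way i w].
Proof.
move=> [tm iP mj uj wo]; have [feas dom inj tight vneg] := tm.
have [|x [wx xE rc0 hx]] := wo j; first by rewrite uj leqnn.
have inj' y z w : rematch mt x j y = Some w -> rematch mt x j z = Some w -> y = z.
  rewrite /rematch; case: eqVneq => [->|_]; case: eqVneq => [->|_] //.
  - by move=> [<-] mz; case: (mj z).
  - by move=> my [Ew]; case: (mj y); rewrite Ew.
  exact: inj.
have tight' y w : rematch mt x j y = Some w -> (w, y) \in E /\ reduced u v (w, y) = 0.
  by rewrite /rematch; case: eqVneq => [-> [<-]|_]; [|apply: tight].
exists x; split=> // [mx|w mx].
  have Ei : x = i by case: hx => // -[w]; rewrite mx.
  split=> //.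
    by move=> y; rewrite /rematch in_setU1 -Ei -dom; case: (eqVneq y x).
  move=> w; have [v0 hw] := vneg w; split=> //.
  case: hw => [->|[y my]|[<-]]; [by constructor 1|constructor 2|constructor 2].
    by exists y; rewrite /rematch; case: eqVneq => // Ey; rewrite Ey mx in my.
  by exists x; rewrite /rematch eqxx.
have xP : x \in P by rewrite -dom mx.
have [w' mx' /andP[uw' lt]] : exists2 w', mt x = Some w' & (0 < used w' < used j)%N.
  by case: hx => // Ei; rewrite -Ei xP in iP.
move: mx'; rewrite mx => -[Ew]; rewrite -{w'}Ew in uw' lt.
split=> //; split=> //.
- split=> //.
    by move=> y; rewrite /rematch -dom; case: (eqVneq y x) => // ->; rewrite mx.
  move=> w1; have [v0 hw] := vneg w1; split=> //.
  case: hw => [->|[y my]|[<-]].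
  + by constructor 1.
  + case: (eqVneq y x) => [Ey|yx]; first by constructor 3; rewrite -mx -Ey.
    by constructor 2; exists y; rewrite /rematch (negbTE yx).
  by constructor 2; exists x; rewrite /rematch eqxx.
- move=> y; rewrite /rematch; case: eqVneq => [_ [Ej]|yx my].
    by case: (mj x); rewrite Ej.
  by case/eqP: yx; apply: inj my mx.
(* Rematching [x] does not affect vertices entered no later than [w]: if [x] were the tree state of
   such a [w1], its partner [w] would have been entered strictly before [w1]. *)
move=> w1 /andP[uw1 le1]; have [|y [wy yE rcy hy]] := wo w1.
  by rewrite uw1 (leq_trans le1 (ltnW lt)).
exists y; split=> //; case: hy => [|[w2 my lt2]]; [by left|right; exists w2 => //].
rewrite /rematch; case: eqVneq => // Ey; move: my; rewrite Ey mx => -[Ew2].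
by move: lt2; rewrite -Ew2 => /andP[_ /leq_trans/(_ le1)]; rewrite ltnn.
Qed.

Lemma total_cost_fun (pm : 'I_n -> V) (d : link n q -> R) :
  total_cost d [set (pm x, x) | x in 'I_n] = \sum_x d (pm x, x).
Proof. by rewrite /total_cost big_imset //= => x y _ _ []. Qed.

(** Weak duality: a matching covering all states costs at least the sum of [u] plus the sum of [v]
    over the left vertices it uses, hence at least the sum of all [u] and [v] because [v] is
    nonpositive. The tight matching attains this, as [v] vanishes on the vertices it misses. *)
Lemma tight_optimal mt u v : tight_matching setT mt u v None ->
  min_cost_maximum_matching E c [set e | mt e.2 == Some e.1].
Proof.
move=> [feas dom inj tight vneg].
have /choice[pm mtE] : forall x, exists w, mt x = Some w.
  by move=> x; have := dom x; rewrite inE; case: (mt x) => [w|//]; exists w.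
have pmI : injective pm by move=> x y Exy; apply: inj (mtE x) _; rewrite Exy mtE.
have pmE x : (pm x, x) \in E by have [] := tight x (pm x) (mtE x).
have EM : [set e : link n q | mt e.2 == Some e.1] = [set (pm x, x) | x in 'I_n].
  apply/setP=> -[w x]; rewrite inE mtE /=; apply/eqP/imsetP=> [[<-]|[y _ [-> ->]] //].
  by exists x.
have [mM aM] := matching_of_fun pmI pmE.
rewrite EM; split=> // M' [[M'E inj1 inj2] _] aM'.
have /choice[pm' pmM'] : forall x, exists w, (w, x) \in M'.
  by move=> x; have [[w y] wM /= <-] := aM' x; exists w.
have EM' : M' = [set (pm' x, x) | x in 'I_n].
  apply/setP=> -[w x]; apply/idP/imsetP=> [wM|[y _ [-> ->]] //].
  by exists x => //; apply: inj2.
have pmI' : injective pm'.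
  by move=> x y Exy; have [] := inj1 _ _ (pmM' x) (pmM' y) Exy.
rewrite EM' !total_cost_fun.
have cE e : c e = reduced u v e + u e.2 + v e.1 by rewrite /reduced addrAC !subrK.
rewrite (eq_bigr (fun x => u x + v (pm x))); last first.
  by move=> x _; rewrite cE; have [_ ->] := tight _ _ (mtE x); rewrite add0r.
apply: (@le_trans _ _ (\sum_x (u x + v (pm' x)))).
  rewrite !big_split /= lerD2l.
  have sumV f : injective f -> \sum_x v (f x) = \sum_(w in [set f x | x in 'I_n]) v w.
    by move=> fI; rewrite big_imset //= => x y _ _; apply: fI.
  rewrite !sumV //; apply: (@le_trans _ _ (\sum_w v w)).
    rewrite [leRHS](bigID (mem [set pm x | x in 'I_n])) /=.
    rewrite [X in _ <= _ + X]big1 ?addr0 // => w wpm.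
    have [_ [//|[x mx]|//]] := vneg w; case/negP: wpm; apply/imsetP; exists x => //.
    by move: mx; rewrite mtE => -[].
  rewrite [leLHS](bigID (mem [set pm' x | x in 'I_n])) /=.
  by rewrite gerDl; apply: sumr_le0 => w _; have [] := vneg w.
apply: ler_sum => x _; rewrite cE -addrA lerDr; apply: feas.
exact: subsetP M'E _ (pmM' x).
Qed.

Lemma tight_empty : (forall e, e \in E -> 0 <= c e) ->
  tight_matching set0 (fun=> None) (fun=> 0) (fun=> 0) None.
Proof.
move=> c0; split=> // [e eE|x|w]; first by rewrite /reduced !subr0 c0.
  by rewrite inE.
by split=> //; constructor 1.
Qed.

Lemma tree_empty mt i : mt i = None ->
  alternating_tree mt (fun=> 0%N) set0 i i 0.
Proof.
move=> mi; split=> // [|x]; first by split; rewrite ?setU11 ?inE ?cards0.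
by rewrite !inE orbF => /eqP; left.
Qed.

End Hungarian.

(** * The program for matchings *)

Section HungarianProgram.

(* Integer tables: 10 candidate links, 11 and 12 the matching as seen from the
   left and from the right, 13 entrance times, 15 best states of the tree,
   16 scanned states.  Real tables: 10 costs, 11 and 12 dual variables of the
   right and of the left vertices, 13 slacks.  A vertex or state is stored with
   its code increased by one, so that 0 means that there is none. *)

Definition at1 (a : nat) (i : iexp) : iexp := IGet a i (IConst 0).
Definition rat1 (a : nat) (i : iexp) : rexp := RGet a i (IConst 0).
Definition rreg (a : nat) : rexp := RGet a (IConst 0) (IConst 0).
Definition incr (e : iexp) : iexp := IAdd e (IConst 1).
Definition decr (e : iexp) : iexp := ISub e (IConst 1).

Definition clear_left : cmd :=
  CFor true 40 (CSeq (CISet 13 (reg 40) (IConst 0) (IConst 0))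
                  (CISet 15 (reg 40) (IConst 0) (IConst 0))).

Definition clear_right : cmd :=
  CFor false 41 (CISet 16 (reg 41) (IConst 0) (IConst 0)).

(** Registers of the search: 60 is the state to be matched, 61 the state to be scanned, 62 the flag
    for a path found, 63 the time, 64 the selected vertex, 65 whether a candidate has been seen.
    Real register 14 holds the least slack. *)
Definition clear_search : cmd :=
  CSeq clear_left
    (CSeq clear_right
       (CSeq (set_reg 61 (reg 60)) (CSeq (set_reg 62 (IConst 0)) (set_reg 63 (IConst 0))))).

Definition reduced_exp : rexp :=
  RSub (RSub (RGet 10 (reg 40) (reg 61)) (rat1 11 (reg 61))) (rat1 12 (reg 40)).

Definition scan_test : bexp :=
  BAnd (is_zero (at1 13 (reg 40)))
    (BAnd (nonzero (IGet 10 (reg 40) (reg 61)))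
       (BNot (BAnd (nonzero (at1 15 (reg 40))) (BRLe (rat1 13 (reg 40)) reduced_exp)))).

Definition scan_loop : cmd :=
  CFor true 40
    (CIf scan_test
       (CSeq (CRSet 13 (reg 40) (IConst 0) reduced_exp)
             (CISet 15 (reg 40) (IConst 0) (incr (reg 61))))
       CNop).

Definition select_loop : cmd :=
  CSeq (set_reg 65 (IConst 0))
    (CFor true 40
      (CIf (BAnd (BAnd (is_zero (at1 13 (reg 40))) (nonzero (at1 15 (reg 40))))
             (BNot (BAnd (nonzero (reg 65)) (BRLe (rreg 14) (rat1 13 (reg 40))))))
         (CSeq (set_reg 65 (IConst 1))
            (CSeq (CRSet 14 (IConst 0) (IConst 0) (rat1 13 (reg 40)))
               (set_reg 64 (reg 40))))
         CNop)).

Definition update_left : cmd :=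
  CFor true 40
    (CIf (nonzero (at1 13 (reg 40)))
       (CRSet 12 (reg 40) (IConst 0) (RSub (rat1 12 (reg 40)) (rreg 14)))
       (CRSet 13 (reg 40) (IConst 0) (RSub (rat1 13 (reg 40)) (rreg 14)))).

Definition update_right : cmd :=
  CFor false 41
    (CIf (nonzero (at1 16 (reg 41)))
       (CRSet 11 (reg 41) (IConst 0) (RAdd (rat1 11 (reg 41)) (rreg 14))) CNop).

Definition extend_tree : cmd :=
  CSeq (set_reg 63 (incr (reg 63)))
    (CSeq (CISet 13 (reg 64) (IConst 0) (reg 63))
       (CIf (is_zero (at1 11 (reg 64))) (set_reg 62 (IConst 1))
          (set_reg 61 (decr (at1 11 (reg 64)))))).

(** The loop around it has a fixed length; flag 62 turns the rounds after the discovery of a path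
    into idle ones. *)
Definition search_step : cmd :=
  CIf (is_zero (reg 62))
    (CSeq (CISet 16 (reg 61) (IConst 0) (IConst 1))
    (CSeq scan_loop (CSeq select_loop (CSeq update_left (CSeq update_right extend_tree)))))
    CNop.

(** Here flag 62 means that a path is still to be flipped; it is cleared at the root, after which
    the rounds idle. *)
Definition augment_cmd : cmd :=
  CIf (is_zero (reg 62)) CNop
    (CSeq (set_reg 66 (decr (at1 15 (reg 64))))
    (CSeq (set_reg 67 (at1 12 (reg 66)))
    (CSeq (CISet 11 (reg 64) (IConst 0) (incr (reg 66)))
    (CSeq (CISet 12 (reg 66) (IConst 0) (incr (reg 64)))
       (CIf (is_zero (reg 67)) (set_reg 62 (IConst 0)) (set_reg 64 (decr (reg 67)))))))).

Definition match_row : cmd :=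
  CSeq clear_search (CSeq (CFor true 51 search_step) (CFor true 52 augment_cmd)).

Definition clear_matching : cmd :=
  CSeq (CFor true 40 (CSeq (CISet 11 (reg 40) (IConst 0) (IConst 0))
                        (CRSet 12 (reg 40) (IConst 0) RZero)))
    (CFor false 41 (CSeq (CISet 12 (reg 41) (IConst 0) (IConst 0))
                        (CRSet 11 (reg 41) (IConst 0) RZero))).

Definition write_matching : cmd :=
  CFor true 40 (CFor false 41
    (CISet 3 (reg 40) (reg 41) (eq_exp (at1 12 (reg 41)) (incr (reg 40))))).

Definition matching_cmd : cmd :=
  CSeq clear_matching (CSeq (CFor false 60 match_row) write_matching).

Variables (R : realDomainType) (n q : nat) (E : {set link n q}).
Variable c : link n q -> R.
Notation V := (vertex n q).
Implicit Types (m : memory R).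
Implicit Types (mt : 'I_n -> option V) (u : 'I_n -> R) (v minv : V -> R).
Implicit Types (used : V -> nat) (way : V -> option 'I_n) (P inR : {set 'I_n}).

Definition option_code (T : Type) (code : T -> nat) (o : option T) : nat :=
  if o is Some t then (code t).+1 else 0.

Definition instance_stored m : Prop :=
  [/\ sized n q m, stores_links m 10 E & costs_stored m 10 c].

(** During the flipping of a path, the left table may still hold an outdated partner for the vertex
    [free], which is therefore exempted. *)
Definition matching_stored m mt u v (free : option V) : Prop :=
  [/\ forall x : 'I_n, ints m 12 x 0%N = option_code (@vcode n q) (mt x),
      forall w, free <> Some w ->
        (exists2 x : 'I_n, mt x = Some w & ints m 11 (vcode w) 0%N = x.+1) \/
        ((forall x, mt x <> Some w) /\ ints m 11 (vcode w) 0%N = 0%N),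
      forall x : 'I_n, reals m 11 x 0%N = u x
    & forall w, reals m 12 (vcode w) 0%N = v w].

Definition search_stored m used way minv : Prop :=
  [/\ forall w, ints m 13 (vcode w) 0%N = used w,
      forall w, ints m 15 (vcode w) 0%N = option_code (@nat_of_ord n) (way w)
    & forall w, reals m 13 (vcode w) 0%N = minv w].

Definition scanned_stored m inR : Prop :=
  forall x : 'I_n, (ints m 16 x 0%N != 0%N) = (x \in inR).

Lemma instance_stored_run p m : well_formed p -> 10%N \notin written_ints p ->
  10%N \notin written_reals p -> instance_stored m -> instance_stored (run p m).
Proof.
move=> wf i10 r10 [sz ad co]; split; first exact: sized_run.
  by rewrite /stores_links run_ints.
by rewrite /costs_stored run_reals.
Qed.

Lemma matching_stored_run p m mt u v free :
  ~~ has (mem (written_ints p)) [:: 11; 12]%N ->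
  ~~ has (mem (written_reals p)) [:: 11; 12]%N ->
  matching_stored m mt u v free -> matching_stored (run p m) mt u v free.
Proof.
rewrite /= !negb_or => /and3P[i11 i12 _] /and3P[r11 r12 _].
by rewrite /matching_stored !run_ints // !run_reals.
Qed.

Lemma search_stored_run p m used way minv :
  ~~ has (mem (written_ints p)) [:: 13; 15]%N -> 13%N \notin written_reals p ->
  search_stored m used way minv -> search_stored (run p m) used way minv.
Proof.
rewrite /= !negb_or => /and3P[i13 i15 _] r13.
by rewrite /search_stored !run_ints // !run_reals.
Qed.

Lemma run_set_reg a e m : ints (run (set_reg a e) m) a 0%N 0%N = ieval m e.
Proof. exact: updateE. Qed.

Lemma run_if_true b p1 p2 m : beval m b -> run (CIf b p1 p2) m = run p1 m.
Proof. by rewrite run_if => ->. Qed.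

Lemma run_if_false b p1 p2 m : beval m b = false -> run (CIf b p1 p2) m = run p2 m.
Proof. by rewrite run_if => ->. Qed.

Let vi : injective (@vcode n q).
Proof. by have [] := enumerates_vertex n q. Qed.

Lemma option_code_eq0 (T : Type) (code : T -> nat) (o : option T) :
  (option_code code o == 0%N) = ~~ isSome o.
Proof. by case: o. Qed.

Lemma run_scan_loop m mt u v used way minv r : instance_stored m ->
  matching_stored m mt u v None -> search_stored m used way minv ->
  ints m 61 0%N 0%N = nat_of_ord r ->
  search_stored (run scan_loop m) used
    (fun w => if improves E c u v used way minv r w then Some r else way w)
    (fun w => if improves E c u v used way minv r w then reduced c u v (w, r) else minv w).
Proof.
move=> [sz ad co] [_ _ stu stv] [su sw sm] Er.
pose imp w := improves E c u v used way minv r w.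
pose I (D : {set V}) m' :=
  [/\ [/\ ints m' 10 = ints m 10, ints m' 13 = ints m 13 & ints m' 61 = ints m 61],
      [/\ reals m' 10 = reals m 10, reals m' 11 = reals m 11 & reals m' 12 = reals m 12],
      forall w, ints m' 15 (vcode w) 0%N =
        option_code (@nat_of_ord n) (if (w \in D) && imp w then Some r else way w)
    & forall w, reals m' 13 (vcode w) 0%N =
        if (w \in D) && imp w then reduced c u v (w, r) else minv w].
suff [[_ h13 _] _ h15 h13r] : I setT (run scan_loop m).
  split=> w; first by rewrite h13.
    by rewrite h15 inE.
  by rewrite h13r inE.
apply: (run_for1 (enumerates_vertex n q)) => // [|D w m' wD ID Ew sz'].
  by split=> // w; rewrite inE.
have [[i10 i13 i61] [r10 r11 r12] I15 I13] := ID.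
have Ered : reval m' reduced_exp = reduced c u v (w, r).
  by rewrite /= i61 r10 r11 r12 Ew Er co stu stv.
have Etest : beval m' scan_test = imp w.
  have bAnd b1 b2 : beval m' (BAnd b1 b2) = beval m' b1 && beval m' b2 by [].
  have bNot b1 : beval m' (BNot b1) = ~~ beval m' b1 by [].
  rewrite /scan_test !bAnd bNot bAnd !beval_nonzero beval_is_zero.
  rewrite -[beval m' (BRLe _ _)]/(reval m' (rat1 13 (reg 40)) <= reval m' reduced_exp) Ered.
  rewrite [reval _ _]/= ![ieval _ _]/= Ew I13 I15 i13 i10 i61 Er su ad (negbTE wD) /=.
  by rewrite /imp /improves; case: (way w).
rewrite run_if Etest; case: ifPn => iw; last first.
  split=> // w'; rewrite ?I15 ?I13 in_setU1; case: (eqVneq w' w) => //= ->.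
    by rewrite (negbTE iw) andbF.
  by rewrite (negbTE iw) andbF.
rewrite run_seq; set m1 := run _ m'.
split=> // w'.
  rewrite /= updateE -[ints m1]/(ints m') Ew (inj_eq vi) in_setU1 andbT.
  case: (eqVneq w' w) => [->|_] /=; last exact: I15.
  by rewrite -[ints m1]/(ints m') iw /= i61 Er addn1.
rewrite /= /m1 /= updateE Ew (inj_eq vi) in_setU1 andbT.
case: (eqVneq w' w) => [->|_]; first by rewrite iw -Ered /= Ew.
exact: I13.
Qed.

Lemma run_select_loop m used way minv : sized n q m -> search_stored m used way minv ->
  (exists2 w, used w = 0%N & way w != None) ->
  exists j, let m' := run select_loop m in
    [/\ ints m' 64 0%N 0%N = vcode j, reals m' 14 0%N 0%N = minv j,
        used j = 0%N, way j != None
      & forall w, used w = 0%N -> way w != None -> minv j <= minv w].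
Proof.
move=> sz [su sw sm] [w1 uw1 ww1].
pose cand w := (used w == 0%N) && (way w != None).
pose I (D : {set V}) m' :=
  [/\ ints m' 13 = ints m 13, ints m' 15 = ints m 15 & reals m' 13 = reals m 13] /\
  ((ints m' 65 0%N 0%N = 0%N /\ forall w, w \in D -> ~~ cand w) \/
   (ints m' 65 0%N 0%N != 0%N /\ exists j,
     [/\ ints m' 64 0%N 0%N = vcode j, reals m' 14 0%N 0%N = minv j, cand j
       & forall w, w \in D -> cand w -> minv j <= minv w])).
have : I setT (run select_loop m).
  rewrite /select_loop run_seq.
  apply: (run_for1 (enumerates_vertex n q)) => // [|D w m' _ [[i13 i15 r13] I5] Ew sz'].
    by split=> //; left; split=> // w; rewrite inE.
  have bAnd b1 b2 : beval m' (BAnd b1 b2) = beval m' b1 && beval m' b2 by [].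
  have bNot b1 : beval m' (BNot b1) = ~~ beval m' b1 by [].
  have Em : reval m' (rat1 13 (reg 40)) = minv w by rewrite /= r13 Ew sm.
  rewrite run_if !bAnd bNot bAnd !beval_nonzero beval_is_zero.
  rewrite -[beval m' (BRLe _ _)]/(reval m' (rreg 14) <= reval m' (rat1 13 (reg 40))) Em.
  rewrite ![ieval _ _]/= [reval _ _]/= i13 i15 Ew su sw.
  have -> : (used w == 0%N) && (option_code (nat_of_ord (n:=n)) (way w) != 0%N) = cand w.
    by rewrite /cand; case: (way w).
  case: (boolP (cand w)) => Pe; last first.
    split=> //; case: I5 => [[h1 h2]|[h1 [e0 [h2 h3 h5 h6]]]]; [left|right]; split=> //.
      by move=> e; rewrite in_setU1 => /predU1P[->|/h2].
    exists e0; split=> // e; rewrite in_setU1 => /predU1P[->|/h6 //].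
    by rewrite (negbTE Pe).
  rewrite [true && _]/=; case: ifPn => [new|/negPn/andP[h1 h7]].
    split=> //; right; split=> //; exists w; split=> // e.
    rewrite in_setU1 => /predU1P[->//|eD]; case: I5 new => [[h1 h2] _|[h1 [e0 [h2 h3 h5 h6]]]].
      by rewrite (negbTE (h2 e eD)).
    rewrite h1 h3 /= -ltNge => lt1 Pe'; apply: le_trans (ltW lt1) _; exact: h6.
  split=> //; right; case: I5 => [[h8]|[_ [e0 [h2 h3 h5 h6]]]]; first by rewrite h8 in h1.
  split=> //; exists e0; split=> // e; rewrite in_setU1 => /predU1P[-> _|/h6 //].
  by rewrite -h3.
case=> _ [[_ /(_ w1)]|[_ [j [h2 h3 /andP[/eqP h4 h5] h6]]]].
  by rewrite inE /cand uw1 ww1 => /(_ isT).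
by exists j; split=> // w uw ww; apply: h6; rewrite ?inE // /cand uw.
Qed.

Lemma run_update_left m used d v minv : sized n q m ->
  (forall w, ints m 13 (vcode w) 0%N = used w) -> reals m 14 0%N 0%N = d ->
  (forall w, reals m 12 (vcode w) 0%N = v w) ->
  (forall w, reals m 13 (vcode w) 0%N = minv w) ->
  (forall w, reals (run update_left m) 12 (vcode w) 0%N =
     if (0 < used w)%N then v w - d else v w) /\
  (forall w, reals (run update_left m) 13 (vcode w) 0%N =
     minv w - (if (0 < used w)%N then 0 else d)).
Proof.
move=> sz su Ed sv sm.
pose I (D : {set V}) m' :=
  [/\ ints m' 13 = ints m 13, reals m' 14 = reals m 14,
      forall w, reals m' 12 (vcode w) 0%N =
        if (w \in D) && (0 < used w)%N then v w - d else v w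
    & forall w, reals m' 13 (vcode w) 0%N =
        minv w - (if (w \in D) && (used w == 0)%N then d else 0)].
suff [_ _ h1 h2] : I setT (run update_left m).
  split=> w; first by rewrite h1 inE.
  by rewrite h2 inE; case: (used w).
apply: (run_for1 (enumerates_vertex n q)) => // [|D w m' wD [i13 r14 I12 I13] Ew sz'].
  by split=> // w; rewrite inE // subr0.
have E12 w' : (w' == w) = false -> (w' \in w |: D) = (w' \in D).
  by move=> ne; rewrite in_setU1 ne.
rewrite run_if beval_nonzero [ieval _ _]/= i13 Ew su -lt0n.
case: ifPn => uw; split=> // w'.
- rewrite /= updateE Ew r14 Ed (inj_eq vi) andbT.
  case: eqVneq => [->|/negbTE/E12->]; last exact: I12.
  by rewrite setU11 uw I12 (negbTE wD).
- rewrite /= update_other // I13; case: (eqVneq w' w) => [->|/negbTE/E12->] //.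
  by rewrite (gtn_eqF uw) !andbF.
- rewrite /= update_other // I12; case: (eqVneq w' w) => [->|/negbTE/E12->] //.
  by rewrite (negbTE uw) !andbF.
rewrite /= updateE Ew r14 Ed (inj_eq vi) andbT.
case: eqVneq => [->|/negbTE/E12->]; last exact: I13.
by rewrite setU11 -leqn0 leqNgt uw I13 (negbTE wD) subr0.
Qed.

Lemma run_update_right m inR d u : sized n q m -> scanned_stored m inR ->
  reals m 14 0%N 0%N = d -> (forall x : 'I_n, reals m 11 x 0%N = u x) ->
  forall x : 'I_n, reals (run update_right m) 11 x 0%N = if x \in inR then u x + d else u x.
Proof.
move=> sz sR Ed su.
pose I (D : {set 'I_n}) m' :=
  [/\ ints m' 16 = ints m 16, reals m' 14 = reals m 14
    & forall x : 'I_n, reals m' 11 x 0%N = if (x \in D) && (x \in inR) then u x + d else u x].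
suff [_ _ h] : I setT (run update_right m) by move=> x; rewrite h inE.
apply: (run_for1 (enumerates_state n q)) => // [|D y m' yD [i16 r14 I11] Ey sz'].
  by split=> // x; rewrite inE.
have E12 z : (z == y) = false -> (z \in y |: D) = (z \in D).
  by move=> ne; rewrite in_setU1 ne.
rewrite run_if beval_nonzero [ieval _ _]/= i16 Ey sR.
case: ifPn => yR; split=> // z.
  rewrite /= updateE Ey r14 Ed (inj_eq val_inj) andbT.
  case: eqVneq => [->|/negbTE/E12->]; last exact: I11.
  by rewrite setU11 yR I11 (negbTE yD).
rewrite I11; case: (eqVneq z y) => [->|/negbTE/E12->] //.
by rewrite (negbTE yR) !andbF.
Qed.

Lemma run_clear_search m (x : 'I_n) : sized n q m -> ints m 60 0%N 0%N = x ->
  let m' := run clear_search m in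
  [/\ forall w, ints m' 13 (@vcode n q w) 0%N = 0%N,
      forall w, ints m' 15 (@vcode n q w) 0%N = 0%N,
      scanned_stored m' set0,
      ints m' 61 0%N 0%N = x
    & ints m' 62 0%N 0%N = 0%N /\ ints m' 63 0%N 0%N = 0%N].
Proof.
move=> sz Ex; rewrite /clear_search run_seq.
pose I1 (D : {set V}) m' := forall w, w \in D ->
  ints m' 13 (vcode w) 0%N = 0%N /\ ints m' 15 (vcode w) 0%N = 0%N.
have h1 : I1 setT (run clear_left m).
  apply: (run_for1 (enumerates_vertex n q)) => // [w|D w m' _ ID Ew _ w'].
    by rewrite inE.
  rewrite /= update_other // !updateE !update_other // Ew (inj_eq vi) andbT in_setU1.
  by case: (eqVneq w' w) => [//|_] /= /ID.
set m1 := run clear_left m in h1 *.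
have sz1 : sized n q m1 by apply: sized_run.
rewrite run_seq.
pose I2 (D : {set 'I_n}) m' := forall y : 'I_n, y \in D -> ints m' 16 y 0%N = 0%N.
have h2 : I2 setT (run clear_right m1).
  apply: (run_for1 (enumerates_state n q)) => // [w|D y m' _ ID Ey _ z].
    by rewrite inE.
  rewrite /= !updateE Ey (inj_eq val_inj) andbT in_setU1.
  by case: (eqVneq z y) => [//|_] /= /ID.
set m2 := run clear_right m1 in h2 *.
have e1 a : a \notin written_ints clear_right -> ints m2 a = ints m1 a.
  by move=> ?; rewrite run_ints.
have e60 : ints m2 60 0%N 0%N = x by rewrite run_ints // run_ints.
split=> [w|w|z||] //.
- by rewrite run_ints // (e1 13%N) //; have [->] := h1 w (in_setT _).
- by rewrite run_ints // (e1 15%N) //; have [_ ->] := h1 w (in_setT _).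
by rewrite run_ints // h2 ?in_setT // inE.
Qed.

Definition search_memory P i k m : Prop :=
  exists mt u v used way minv,
  [/\ matching_stored m mt u v None, search_stored m used way minv
    & (ints m 62 0%N 0%N = 0%N /\ exists inR r,
       [/\ [/\ scanned_stored m inR, ints m 61 0%N 0%N = nat_of_ord r
            & ints m 63 0%N 0%N = k],
           i \notin P, tight_matching E c P mt u v None,
           way_ok E c mt u v used way i k /\ alternating_tree mt used inR r i k
         & (forall w, (0 < used w)%N -> exists2 x, way w = Some x & x \in inR)
           /\ slack_ok E c u v used way minv inR]) \/
      (ints m 62 0%N 0%N != 0%N /\ exists j,
       [/\ ints m 64 0%N 0%N = vcode j, augmenting E c P mt u v used way i j
         & (used j <= n + q)%N])].

Lemma run_search_step P i k m : perfect E -> instance_stored m -> (k < n + q)%N ->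
  search_memory P i k m -> search_memory P i k.+1 (run search_step m).
Proof.
move=> pE inst kN [mt [u [v [used [way [minv [ms ss search]]]]]]].
have [sz ad co] := inst.
rewrite /search_step run_if beval_is_zero [ieval _ _]/=.
case: search => [[E62]|[E62 fin]]; last first.
  by rewrite (negbTE E62); exists mt, u, v, used, way, minv; split=> //; right.
case=> inR [r [[sR Er Et] iP tm [wo tree] [wR sl]]]; rewrite E62 eqxx.
rewrite run_seq; set m1 := run _ m.
have inst1 : instance_stored m1 by apply: instance_stored_run.
have ms1 : matching_stored m1 mt u v None by apply: matching_stored_run.
have ss1 : search_stored m1 used way minv by apply: search_stored_run.
have Er1 : ints m1 61 0%N 0%N = r by rewrite run_ints.
have sR1 : scanned_stored m1 (r |: inR).
  move=> x; rewrite /m1 /= updateE Er (inj_eq val_inj) andbT in_setU1.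
  by case: (eqVneq x r) => //= _; apply: sR.
rewrite run_seq; set m2 := run scan_loop m1.
have inst2 : instance_stored m2 by apply: instance_stored_run.
have ss2 := run_scan_loop inst1 ms1 ss1 Er1; rewrite -/m2 in ss2.
have sl2 := slack_scan r sl.
set way2 := fun w => if _ then Some r else way w in ss2 sl2.
set minv2 := fun w => if _ then _ else minv w in ss2 sl2.
have wE w : (0 < used w)%N -> way2 w = way w.
  by rewrite /way2 /improves; case: (used w).
have wo2 : way_ok E c mt u v used way2 i k.
  move=> w uw; have [x [wx xE rc0 hx]] := wo w uw; exists x; split=> //.
  by rewrite wE //; case/andP: uw.
have wR2 w : (0 < used w)%N -> exists2 x, way2 w = Some x & x \in inR.
  by move=> uw; rewrite wE //; apply: wR.
rewrite run_seq; set m3 := run select_loop m2.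
have sz2 : sized n q m2 by case: inst2.
have [j [E64 E14 uj wj minj]] := run_select_loop sz2 ss2 (exists_slack pE tree sl2).
rewrite -/m3 in E64 E14.
have sz3 : sized n q m3 by apply: sized_run.
rewrite run_seq; set m4 := run update_left m3.
have sz4 : sized n q m4 by apply: sized_run.
have [su sw sm] := ss2; have [s12 s11 sr11 sr12] := ms1.
have [|||v4 minv4] := @run_update_left m3 used (minv2 j) v minv2 sz3 _ E14.
- by move=> w; rewrite run_ints.
- by move=> w; rewrite run_reals // run_reals.
- by move=> w; rewrite run_reals.
rewrite -/m4 in v4 minv4.
rewrite run_seq; set m5 := run update_right m4.
have sz5 : sized n q m5 by apply: sized_run.
have u5 (x : 'I_n) : reals m5 11 x 0%N = if x \in r |: inR then u x + minv2 j else u x.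
  apply: (run_update_right sz4) => [y||y].
  - by rewrite run_ints // run_ints // run_ints.
  - by rewrite run_reals.
  by rewrite run_reals // run_reals // run_reals.
have i5 a : a \notin written_ints
      (CSeq scan_loop (CSeq select_loop (CSeq update_left update_right))) ->
    ints m5 a = ints m1 a by move=> h; rewrite -(run_ints m1 h).
pose used' w := if w == j then k.+1 else used w.
pose u' x := if x \in r |: inR then u x + minv2 j else u x.
pose v' w := if (0 < used w)%N then v w - minv2 j else v w.
pose minv' w := minv2 w - (if (0 < used w)%N then 0 else minv2 j).
have E64' : ints m5 64 0%N 0%N = vcode j by rewrite run_ints // run_ints.
have E63' : ints m5 63 0%N 0%N = k by rewrite (i5 63%N) // run_ints.
rewrite /extend_tree run_seq; set m6 := run _ m5.
have E63m6 : ints m6 63 0%N 0%N = k.+1 by rewrite /= updateE /= E63' addn1.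
have E64m6 : ints m6 64 0%N 0%N = vcode j by rewrite run_ints.
rewrite run_seq; set m7 := run _ m6.
have E63 : ints m7 63 0%N 0%N = k.+1 by rewrite run_ints.
have tm' := tight_update tm tree sl2 uj wj minj.
have wo' := way_update wo2 tree wR2 sl2 uj wj.
have sl' := slack_update sl2.
have wR' := way_tree_update wR2 sl2 uj wj.
have ss7 : search_stored m7 used' way2 minv'.
  split=> w.
  - rewrite (_ : ints m7 13 = update (ints m6) 13 (ints m6 64 0 0)%N 0 (ints m6 63 0 0)%N 13) //.
    rewrite updateE E64m6 E63m6 (inj_eq vi) andbT /used'.
    by case: eqVneq => // _; rewrite run_ints // run_ints // run_ints // run_ints.
  - by rewrite run_ints // run_ints // run_ints // run_ints // run_ints.
  by rewrite run_reals // run_reals // run_reals.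
have E11 : ints m7 11 = ints m 11.
  by rewrite run_ints // run_ints // i5 // run_ints.
have ms7 : matching_stored m7 mt u' v' None.
  split=> [x|w fw|x|w].
  - by rewrite run_ints // run_ints // (i5 12%N).
  - by rewrite E11; case: ms => _ h _ _; apply: h.
  - by rewrite run_reals // run_reals // u5.
  by rewrite run_reals // run_reals // run_reals.
have E64'' : ints m7 64 0%N 0%N = vcode j by rewrite run_ints // run_ints.
have E11j : ieval m7 (at1 11 (reg 64)) = ints m 11 (vcode j) 0%N by rewrite -E11 -E64''.
rewrite run_if beval_is_zero E11j.
have [_ pmP _ _] := ms; have Nj : (None : option V) <> Some j by [].
have [[x mx Epm]|[nj Epm]] := pmP j Nj.
- rewrite Epm [_ == _]/=; set m8 := run _ m7.
  exists mt, u', v', used', way2, minv'.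
  split; [exact: matching_stored_run|exact: search_stored_run|left].
  split; first by rewrite run_ints // run_ints // run_ints // (i5 62%N) // run_ints.
  exists (r |: inR), x; split=> //.
  + split.
    * move=> y; rewrite run_ints // run_ints // run_ints // (i5 16%N) //; exact: sR1.
    * rewrite run_set_reg (_ : ieval m7 _ = ieval m7 (at1 11 (reg 64)) - 1)%N //.
      by rewrite E11j Epm subn1.
    by rewrite run_ints.
  + by split=> //; exact: (tree_update tm tree uj mx).
  by split; [exact: wR' | exact: sl'].
rewrite Epm [_ == _]/=; set m8 := run _ m7.
exists mt, u', v', used', way2, minv'.
split; [exact: matching_stored_run|exact: search_stored_run|right].
split; first by rewrite run_set_reg.
exists j; split.
- by rewrite run_ints.
- split=> //; rewrite /used' ?eqxx //.
  case: tm' => h1 h2 h3 h4 h5; split=> // w; have [h6 h7] := h5 w; split=> //.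
  by case: h7 => [?|?|//]; [constructor 1|constructor 2].
by rewrite /used' eqxx.
Qed.

Lemma run_search_loop P i m : perfect E -> instance_stored m ->
  search_memory P i 0 m ->
  exists mt u v used way minv,
  [/\ matching_stored (run (CFor true 51 search_step) m) mt u v None,
      search_stored (run (CFor true 51 search_step) m) used way minv,
      ints (run (CFor true 51 search_step) m) 62 0%N 0%N != 0%N
    & exists j, [/\ ints (run (CFor true 51 search_step) m) 64 0%N 0%N = vcode j,
        augmenting E c P mt u v used way i j & (used j <= n + q)%N]].
Proof.
move=> pE inst s0; have [sz _ _] := inst.
pose I (D : {set V}) m' := instance_stored m' /\ search_memory P i #|D| m'.
have [_ s1] : I setT (run (CFor true 51 search_step) m).
  apply: (run_for1 (enumerates_vertex n q)) => // [|D w m' wD [inst' s'] _ _].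
    by split=> //; rewrite cards0.
  split; first exact: instance_stored_run.
  rewrite cardsU1 wD add1n; apply: run_search_step => //.
  rewrite (_ : n + q = #|[set: V]|)%N; last by rewrite cardsT card_sum !card_ord.
  by apply: proper_card; apply/properP; split; [apply: subsetT|exists w; rewrite ?inE].
move: s1; set m1 := run _ m => -[mt [u [v [used [way [minv [ms ss search]]]]]]].
exists mt, u, v, used, way, minv; case: search => [[_]|[E62 fin]]; last by split.
(* A search still running after n + q rounds would have scanned more states than exist. *)
case=> inR [r [_ _ _ [_ [[_ _ rR cR] _ _ _]] _]].
have := subset_leq_card (subsetT (r |: inR)).
by rewrite cardsU1 rR cR !cardsT card_sum !card_ord; lia.
Qed.

Definition augment_memory P i k m : Prop :=
  exists mt u v,
    (ints m 62 0%N 0%N = 0%N /\ matching_stored m mt u v None /\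
       tight_matching E c (i |: P) mt u v None) \/
    (ints m 62 0%N 0%N != 0%N /\ exists used way j,
      [/\ matching_stored m mt u v (Some j),
          forall w, ints m 15 (vcode w) 0%N = option_code (@nat_of_ord n) (way w),
          ints m 64 0%N 0%N = vcode j, augmenting E c P mt u v used way i j
        & (used j + k <= n + q)%N]).

(* The times of entrance strictly decrease along the augmenting path, hence
   |U| + |X| rounds flip all of it. *)
Lemma run_augment P i k m :
  augment_memory P i k m -> augment_memory P i k.+1 (run augment_cmd m).
Proof.
case=> mt [u [v aug]]; rewrite /augment_cmd run_if beval_is_zero [ieval _ _]/=.
case: aug => [[E62 done]|[E62 [used [way [j [ms sw E64 aug le]]]]]].
  by rewrite E62; exists mt, u, v; left.
rewrite (negbTE E62); have [x [wx last more]] := augment_step aug.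
have [mj inj] : (forall y, mt y <> Some j) /\
    (forall y z w, mt y = Some w -> mt z = Some w -> y = z).
  by case: aug => -[_ _ ? _ _] _ ? _ _.
have [sm sp su sv] := ms.
rewrite run_seq; set m1 := run _ m.
have E66 : ints m1 66 0%N 0%N = x.
  rewrite run_set_reg (_ : ieval m _ = ints m 15 (ints m 64 0 0) 0 - 1)%N //.
  by rewrite E64 sw wx subn1.
rewrite run_seq; set m2 := run _ m1.
have E67 : ints m2 67 0%N 0%N = option_code (@vcode n q) (mt x).
  rewrite run_set_reg (_ : ieval m1 _ = ints m1 12 (ints m1 66 0 0) 0)%N //.
  by rewrite E66 run_ints.
rewrite run_seq; set m3 := run _ m2.
have E66' : ints m2 66 0%N 0%N = x by rewrite run_ints.
have E64' : ints m2 64 0%N 0%N = vcode j by rewrite run_ints // run_ints.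
have i3 : ints m3 11 = update (ints m2) 11 (vcode j) 0 x.+1 11.
  rewrite (_ : ints m3 11 = update (ints m2) 11 (ints m2 64 0 0)%N 0
     (ints m2 66 0 0 + 1)%N 11) //.
  by rewrite E66' E64' addn1.
rewrite run_seq; set m4 := run _ m3.
have E66'' : ints m3 66 0%N 0%N = x by rewrite run_ints.
have E64'' : ints m3 64 0%N 0%N = vcode j by rewrite run_ints.
have i4 : ints m4 12 = update (ints m3) 12 x 0 (vcode j).+1 12.
  rewrite (_ : ints m4 12 = update (ints m3) 12 (ints m3 66 0 0)%N 0
     (ints m3 64 0 0 + 1)%N 12) //.
  by rewrite E66'' E64'' addn1.
have E67' : ints m4 67 0%N 0%N = option_code (@vcode n q) (mt x) by rewrite run_ints // run_ints.
have ms4 : matching_stored m4 (rematch mt x j) u v (mt x).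
  split=> [y|w fw|y|w].
  - rewrite i4 updateE (inj_eq val_inj) andbT /rematch; case: eqVneq => // _.
    by rewrite run_ints // run_ints // run_ints.
  - rewrite run_ints // i3 updateE (inj_eq vi) andbT; case: (eqVneq w j) => [->|wj].
      by left; exists x; rewrite // /rematch eqxx.
    have fj : Some j <> Some w by move=> [Ew]; rewrite Ew eqxx in wj.
    rewrite run_ints // run_ints //; case: (sp w fj) => [[y my Ey]|[ny Ey]].
      left; exists y => //; rewrite /rematch; case: eqVneq => // Exy.
      by case: fw; rewrite -Exy.
    right; split=> // y; rewrite /rematch; case: eqVneq => _; last exact: ny.
    exact: fj.
  - by rewrite run_reals // run_reals // run_reals // run_reals.
  by rewrite run_reals // run_reals // run_reals // run_reals.
have b4 : beval m4 (is_zero (reg 67)) = ~~ isSome (mt x).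
  by rewrite beval_is_zero (_ : ieval m4 (reg 67) = ints m4 67 0 0)%N // E67' option_code_eq0.
case Emx: (mt x) ms4 E67' b4 => [w|] ms4 E67' b4.
  rewrite (run_if_false _ _ b4).
  have [lt aug'] := more w Emx.
  exists (rematch mt x j), u, v; right; split.
    by rewrite run_ints // run_ints // run_ints // run_ints // run_ints.
  exists used, way, w; split; [| | |exact: aug'|].
  - exact: matching_stored_run.
  - by move=> w'; rewrite run_ints // run_ints // run_ints // run_ints // run_ints.
  - rewrite run_set_reg (_ : ieval m4 _ = ints m4 67 0 0 - 1)%N //.
    by rewrite E67' subn1.
  by rewrite addnS; apply: leq_trans le; rewrite ltn_add2r.
rewrite (run_if_true _ _ b4).
exists (rematch mt x j), u, v; left; split; first by rewrite run_set_reg.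
by split; [exact: matching_stored_run | exact: last].
Qed.

Definition row_memory P m : Prop := instance_stored m /\ exists mt u v,
  matching_stored m mt u v None /\ tight_matching E c P mt u v None.

Lemma run_match_row P i m : perfect E -> i \notin P -> ints m 60 0%N 0%N = nat_of_ord i ->
  row_memory P m -> row_memory (i |: P) (run match_row m).
Proof.
move=> pE iP E60 [inst [mt [u [v [ms tm]]]]]; split; first exact: instance_stored_run.
have [sz _ _] := inst.
rewrite /match_row run_seq; set m1 := run clear_search m.
have inst1 : instance_stored m1 by apply: instance_stored_run.
have [c13 c15 c16 c61 [c62 c63]] := run_clear_search sz E60.
have mi : mt i = None.
  by have [_ dom _ _ _] := tm; have := dom i; rewrite (negbTE iP) => /negbFE/eqP.
have s1 : search_memory P i 0 m1.
  (* With every [way] absent the slacks carry no meaning, so whatever the memory holds serves as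
     [minv]. *)
  exists mt, u, v, (fun=> 0%N), (fun=> None), (fun w => reals m1 13 (vcode w) 0%N).
  split; [exact: matching_stored_run|by []|left].
  split=> //; exists set0, i; split=> //.
  - by split; [move=> w; rewrite ltnn | exact: (tree_empty mi)].
  by split=> // w _ x; rewrite inE.
rewrite run_seq; set m2 := run _ m1.
have inst2 : instance_stored m2 by apply: instance_stored_run.
have [mt2 [u2 [v2 [used [way [minv [ms2 [_ sw _] E62 [j [E64 aug lej]]]]]]]]] :=
  run_search_loop pE inst1 s1.
rewrite -/m2 in ms2 sw E62 E64.
pose I (D : {set V}) m' := augment_memory P i #|D| m'.
have [mt3 [u3 [v3 aug3]]] : I setT (run (CFor true 52 augment_cmd) m2).
  apply: (run_for1 (enumerates_vertex n q)) => // [||D w m' wD s' _ _].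
  - by case: inst2.
  - exists mt2, u2, v2; right; split=> //; exists used, way, j; split=> //.
      by case: ms2 => h1 h2 h3 h4; split=> // w _; apply: h2.
    by rewrite cards0 addn0.
  by rewrite /I cardsU1 wD add1n; apply: run_augment.
exists mt3, u3, v3; case: aug3 => [[_ []] //|[_ [used3 [_ [j3 [_ _ _ [_ _ _ uj _]]]]]]].
by rewrite cardsT card_sum !card_ord; move: uj; lia.
Qed.

Lemma run_clear_matching m : sized n q m ->
  matching_stored (run clear_matching m) (fun=> None) (fun=> 0) (fun=> 0) None.
Proof.
move=> sz; rewrite /clear_matching run_seq; set m1 := run _ m.
pose I1 (D : {set V}) m' := forall w, w \in D ->
  ints m' 11 (vcode w) 0%N = 0%N /\ reals m' 12 (vcode w) 0%N = 0.
have h1 : I1 setT m1.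
  apply: (run_for1 (enumerates_vertex n q)) => // [w|D w m' _ ID Ew _ w'].
    by rewrite inE.
  rewrite /= !updateE !update_other // Ew (inj_eq vi) andbT in_setU1.
  by case: (eqVneq w' w) => [//|_] /= /ID.
have sz1 : sized n q m1 by apply: sized_run.
set m2 := run _ m1.
pose I2 (D : {set 'I_n}) m' := forall y : 'I_n, y \in D ->
  ints m' 12 y 0%N = 0%N /\ reals m' 11 y 0%N = 0.
have h2 : I2 setT m2.
  apply: (run_for1 (enumerates_state n q)) => // [w|D y m' _ ID Ey _ z].
    by rewrite inE.
  rewrite /= !updateE !update_other // Ey (inj_eq val_inj) andbT in_setU1.
  by case: (eqVneq z y) => [//|_] /= /ID.
split=> [x|w _|x|w].
- by have [] := h2 x (in_setT _).
- by right; split=> //; rewrite run_ints //; have [] := h1 w (in_setT _).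
- by have [] := h2 x (in_setT _).
by rewrite run_reals //; have [] := h1 w (in_setT _).
Qed.

Lemma run_matching m : perfect E -> instance_stored m ->
  (forall e, e \in E -> 0 <= c e) ->
  exists2 M, min_cost_maximum_matching E c M & stores_links (run matching_cmd m) 3 M.
Proof.
move=> pE inst c0; rewrite /matching_cmd run_seq; set m1 := run clear_matching m.
have inst1 : instance_stored m1 by apply: instance_stored_run.
have [sz _ _] := inst; have ms1 := run_clear_matching sz; rewrite -/m1 in ms1.
rewrite run_seq; set m2 := run _ m1.
have [inst2 [mt [u [v [ms tm]]]]] : row_memory setT m2.
  apply: (run_for1 (enumerates_state n q)) => // [||D x m' xD s' Ex _].
  - by case: inst1.
  - split=> //; exists (fun=> None), (fun=> 0), (fun=> 0); split=> //.
    exact: tight_empty.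
  exact: run_match_row.
exists [set e | mt e.2 == Some e.1]; first exact: tight_optimal tm.
have [sz2 _ _] := inst2; have [sm _ _ _] := ms.
move=> w x; rewrite inE /=.
have -> : ints (run write_matching m2) 3 (vcode w) x = (mt x == Some w).
  apply: (run_fill (f := fun (w : V) (x : 'I_n) => (mt x == Some w) : nat)
    (enumerates_vertex n q) (enumerates_state n q)) => // s t m' Es Et fr _.
  have -> : (mt t == Some s) = ieval m' (eq_exp (at1 12 (reg 41)) (incr (reg 40))) :> nat.
    rewrite eq_expE (_ : ieval m' (at1 12 (reg 41)) = ints m' 12 (ints m' 41 0 0) 0)%N //.
    rewrite (_ : ieval m' (incr (reg 40)) = ints m' 40 0 0 + 1)%N // Es Et fr // sm addn1.
    by case: (mt t) => [w'|] //=; rewrite eqSS (inj_eq vi).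
  by rewrite -Es -Et.
by case: (mt x == Some w).
Qed.

End HungarianProgram.

(** * Algorithm 1 *)

(** The input memory shows cost 0 for non-candidates. The programs therefore optimise a cost that
    agrees with the given one on candidates only, and optimality has to be transferred. *)
Lemma minimal_spanning_forest_eq (R : realDomainType) (n q : nat) (E F : {set link n q})
    (c d : link n q -> R) :
  {in E, c =1 d} -> minimal_spanning_forest E c F -> minimal_spanning_forest E d F.
Proof.
move=> cd; have costE (F' : {set link n q}) : F' \subset E -> total_cost d F' = total_cost c F'.
  by move=> /subsetP F'E; apply: eq_bigr => e /F'E/cd.
by move=> [FE sF minF]; split=> // F' F'E sF'; rewrite !costE ?minF.
Qed.

Lemma min_cost_maximum_matching_eq (R : realDomainType) (n q : nat) (E M : {set link n q})
    (c d : link n q -> R) :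
  {in E, c =1 d} -> min_cost_maximum_matching E c M -> min_cost_maximum_matching E d M.
Proof.
move=> cd; have costE (F' : {set link n q}) : F' \subset E -> total_cost d F' = total_cost c F'.
  by move=> /subsetP F'E; apply: eq_bigr => e /F'E/cd.
move=> [mM aM minM]; split=> // M' mM' aM'.
by rewrite !costE ?minM //; [case: mM' => -[] | case: mM => -[]].
Qed.

Section Algorithm1.

(* Table 10 is the instance that [forest_cmd] and [matching_cmd] work on; the
   original instance stays in integer table 1 and real table 0. *)
Definition load (adj : iexp) (zero : bexp) : cmd :=
  CFor true 40 (CFor false 41
    (CSeq (CISet 10 (reg 40) (reg 41) adj)
       (CIf zero (CRSet 10 (reg 40) (reg 41) RZero)
          (CRSet 10 (reg 40) (reg 41) (RGet 0 (reg 40) (reg 41)))))).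

Definition entry (a : nat) : iexp := IGet a (reg 40) (reg 41).

Definition copy_forest (a : nat) : cmd :=
  CFor true 40 (CFor false 41 (CISet a (reg 40) (reg 41) (entry 24))).

(** Link tables are indexed by tail and head, matrices by head and tail, hence the exchanged
    indices. Adding two entries forms the union, and subtracting [n] from a code recovers the number
    of an input. *)
Definition write_system : cmd :=
  CFor true 40 (CFor false 41
    (CIf (BILe (reg 0) (reg 40))
       (CISet 6 (reg 41) (ISub (reg 40) (reg 0)) (IAdd (entry 4) (entry 3)))
       (CISet 5 (reg 41) (reg 40) (IAdd (entry 4) (entry 3))))).

(** The test is constantly false: step 1 works with the original costs. *)
Definition step1_cmd : cmd :=
  CSeq (load (entry 1) (BNot (BILe (IConst 0) (IConst 0)))) (CSeq forest_cmd (copy_forest 2)).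

Definition step2_cmd : cmd :=
  CSeq (load (entry 1) (nonzero (entry 2))) matching_cmd.

Definition step3_cmd : cmd :=
  CSeq (load (IAdd (entry 2) (entry 3)) (nonzero (entry 3)))
    (CSeq forest_cmd (copy_forest 4)).

Variables (R : realType) (n q : nat).
Implicit Types (m : memory R) (E F T M : {set link n q}) (c : link n q -> R).

Lemma run_load m adj zero E F c : sized n q m ->
  (forall m' v x, ints m' 40 0%N 0%N = vcode v -> ints m' 41 0%N 0%N = nat_of_ord x ->
     (forall z, z \notin [:: 10; 40; 41]%N -> ints m' z = ints m z) ->
     (ieval m' adj != 0%N) = ((v, x) \in E) /\ beval m' zero = ((v, x) \in F)) ->
  costs_stored m 0 c ->
  stores_links (run (load adj zero) m) 10 E /\
  costs_stored (run (load adj zero) m) 10 (zero_on F c).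
Proof.
move=> sz ev co; split=> v x; last first.
  apply: (run_fill_real (f := fun v x => zero_on F c (v, x))
    (enumerates_vertex n q) (enumerates_state n q)) => // s t m' Es Et fi fr.
  rewrite run_seq; set m1 := run _ m'.
  have E40 : ints m1 40 0%N 0%N = vcode s by rewrite run_ints.
  have E41 : ints m1 41 0%N 0%N = t by rewrite run_ints.
  have f1 z : z \notin [:: 10; 40; 41]%N -> ints m1 z = ints m z.
    rewrite !inE !negb_or => /and3P[z10 z40 z41]; rewrite run_ints ?inE //.
    by apply: fi; rewrite /= !inE !negb_or z10 z40 z41; case: (zero).
  have [_ Ez] := ev m1 s t E40 E41 f1; rewrite run_if Ez /zero_on.
  case: ifP => _.
    rewrite (_ : reals (run _ m1) 10 = update (reals m1) 10
      (ints m1 40 0 0)%N (ints m1 41 0 0)%N 0 10) //.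
    by rewrite E40 E41.
  rewrite (_ : reals (run _ m1) 10 = update (reals m1) 10 (ints m1 40 0 0)%N
    (ints m1 41 0 0)%N (reals m1 0 (ints m1 40 0 0)%N (ints m1 41 0 0)%N) 10) //.
  rewrite E40 E41 (_ : reals m1 = reals m') // fr //.
  by rewrite co.
pose I (D : {set link n q}) m' :=
  (forall z, z \notin [:: 10; 40; 41]%N -> ints m' z = ints m z) /\
  forall v (x : 'I_n), (v, x) \in D -> (ints m' 10 (vcode v) x != 0%N) = ((v, x) \in E).
suff [_ h] : I setT (run (load adj zero) m) by rewrite h ?inE.
apply: (run_for2 (enumerates_vertex n q) (enumerates_state n q)) => //.
- move=> D m' k [h1 h2]; split=> // z z'w; rewrite [ints _ _]/= update_other ?h1 //.
  by apply: contraNneq z'w => ->.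
- move=> D m' k [h1 h2]; split=> // z z'w; rewrite [ints _ _]/= update_other ?h1 //.
  by apply: contraNneq z'w => ->.
- by split=> // w y; rewrite inE.
move=> D w y m' _ [h1 h2] Ew Ey _.
have [Ea _] := ev m' w y Ew Ey h1.
rewrite run_seq.
have fi a : ints (run (CIf zero (CRSet 10 (reg 40) (reg 41) RZero)
        (CRSet 10 (reg 40) (reg 41) (RGet 0 (reg 40) (reg 41))))
      (run (CISet 10 (reg 40) (reg 41) adj) m')) a
   = ints (run (CISet 10 (reg 40) (reg 41) adj) m') a by rewrite run_ints.
split=> [z z'w|w' y']; rewrite fi.
  by rewrite run_ints ?h1 // inE; move: z'w; rewrite !inE !negb_or => /andP[].
have [vi _] := enumerates_vertex n q.
rewrite (_ : ints (run (CISet _ _ _ _) m') 10 = update (ints m') 10 (ints m' 40 0 0)%N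
   (ints m' 41 0 0)%N (ieval m' adj) 10) // updateE Ew Ey (inj_eq vi) (inj_eq val_inj).
rewrite in_setU1 xpair_eqE; case: ifP => [/andP[/eqP-> /eqP->] //|_] /=.
exact: h2.
Qed.

Lemma run_copy_forest m a F : sized n q m -> a \notin [:: 0; 24; 40; 41]%N ->
  stores_links m 24 F -> stores_links (run (copy_forest a) m) a F.
Proof.
move=> sz a_ok sF; move: a_ok; rewrite !inE !negb_or => /and4P[a0 a24 a40 a41] v x.
rewrite -sF; congr (_ != _).
apply: (run_fill (f := fun v (x : 'I_n) => ints m 24 (vcode v) x)
  (enumerates_vertex n q) (enumerates_state n q)) => // [|s t m' Es Et fi _].
  by rewrite /= !inE !negb_or a0 (eq_sym 40%N a) (eq_sym 41%N a) a40 a41.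
rewrite (_ : ints (run _ m') a = update (ints m') a (ints m' 40 0 0)%N (ints m' 41 0 0)%N
   (ints m' 24 (ints m' 40 0 0)%N (ints m' 41 0 0)%N) a) // Es Et fi //.
by rewrite !inE !negb_or (eq_sym 24%N a) a24.
Qed.

Lemma run_write_system m F M (SA : 'M[bool]_n) (SB : 'M[bool]_(n, q)) : sized n q m ->
  stores_links m 4 F -> stores_links m 3 M -> system_links SA SB = F :|: M ->
  stores_matrix (run write_system m) 5 SA /\ stores_matrix (run write_system m) 6 SB.
Proof.
move=> sz sF sM sys.
pose I (D : {set link n q}) m' :=
  [/\ ints m' 3 = ints m 3, ints m' 4 = ints m 4,
      forall y x : 'I_n, (inl y, x) \in D -> (ints m' 5 x y != 0%N) = ((inl y, x) \in F :|: M)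
    & forall (u : 'I_q) (x : 'I_n), (inr u, x) \in D ->
        (ints m' 6 x u != 0%N) = ((inr u, x) \in F :|: M)].
suff [_ _ h1 h2] : I setT (run write_system m).
  split=> i j; first by rewrite h1 ?in_setT // -sys system_links_inl.
  by rewrite h2 ?in_setT // -sys system_links_inr.
apply: (run_for2 (enumerates_vertex n q) (enumerates_state n q)) => //.
  by split=> // a b; rewrite inE.
move=> D w z m' _ [i3 i4 h1 h2] Ew Ez [sn _].
have Ee : (ieval m' (IAdd (entry 4) (entry 3)) != 0%N) = ((w, z) \in F :|: M).
  rewrite (_ : ieval m' _ = ints m' 4 (ints m' 40 0 0) (ints m' 41 0 0) +
    ints m' 3 (ints m' 40 0 0) (ints m' 41 0 0))%N //.
  by rewrite Ew Ez i3 i4 addn_eq0 negb_and sF sM in_setU.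
rewrite run_if (_ : beval m' _ = (ints m' 0 0 0 <= ints m' 40 0 0))%N // sn Ew.
case: w Ew Ee => [y|u] Ew Ee; last first.
  rewrite [vcode _]/= leq_addr; split=> // [a b|u' b].
    by rewrite run_ints // in_setU1 => /predU1P[//|]; apply: h1.
  rewrite (_ : ints (run _ m') 6 = update (ints m') 6 (ints m' 41 0 0)%N
    (ints m' 40 0 0 - ints m' 0 0 0)%N (ieval m' (IAdd (entry 4) (entry 3))) 6) //.
  rewrite updateE Ez Ew sn [vcode _]/= addKn !(inj_eq val_inj) in_setU1 xpair_eqE.
  case: ifP => [/andP[/eqP-> /eqP->] //|ne].
  case: (eqVneq b z) ne => [->|_] /=; rewrite ?andbT ?andbF => ne; last exact: h2.
  by rewrite (_ : (inr u' == inr u :> vertex n q) = (u' == u)) // ne; apply: h2.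
rewrite [vcode _]/= leqNgt ltn_ord; split=> // [a b|u' b]; last first.
  by rewrite run_ints // in_setU1 => /predU1P[//|]; apply: h2.
rewrite (_ : ints (run _ m') 5 = update (ints m') 5 (ints m' 41 0 0)%N
  (ints m' 40 0 0)%N (ieval m' (IAdd (entry 4) (entry 3))) 5) //.
rewrite updateE Ez Ew [vcode _]/= !(inj_eq val_inj) in_setU1 xpair_eqE.
case: ifP => [/andP[/eqP-> /eqP->] //|ne].
case: (eqVneq b z) ne => [->|_] /=; rewrite ?andbT ?andbF => ne; last exact: h1.
by rewrite (_ : (inl a == inl y :> vertex n q) = (a == y)) // ne; apply: h1.
Qed.

Variables (canXX : {set 'I_n * 'I_n}) (canUX : {set 'I_q * 'I_n}).
Variable c : link n q -> R.
Let E := link_union canXX canUX.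
Let c0 : link n q -> R := fun e => if e \in E then c e else 0.
Let m0 := input_memory canXX canUX c.

Lemma input_stored : [/\ sized n q m0, stores_links m0 1 E & costs_stored m0 0 c0].
Proof.
have [vi _] := enumerates_vertex n q.
split=> // v x.
  rewrite /= eqb0 negbK; apply/existsP/idP=> [[[w y] /and3P[wE /eqP/vi Ew /eqP/val_inj Ey]]|vxE].
    by rewrite -Ew -Ey.
  by exists (v, x); rewrite vxE !eqxx.
rewrite /= /c0; case: ifP => vxE.
  rewrite (big_pred1 (v, x)) // => -[w y]; rewrite /= (inj_eq vi) (inj_eq val_inj) xpair_eqE.
  by case: eqVneq => [->|]; case: eqVneq => [->|]; rewrite ?andbF ?andbT.
rewrite big1 // => -[w y] /= /and3P[wE /eqP/vi Ew /eqP/val_inj Ey].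
by move: wE; rewrite -/E Ew Ey vxE.
Qed.

Hypothesis c_ge0 : forall e, e \in E -> 0 <= c e.
Hypothesis feas : feasible R canXX canUX.

Lemma run_algorithm1 :
  let m1 := run step1_cmd m0 in let m2 := run step2_cmd m1 in
  let m3 := run step3_cmd m2 in let m4 := run write_system m3 in
  [/\ sized n q m0, sized n q m1, sized n q m2 & sized n q m3] /\
  exists T M T' SA SB,
    [/\ stores_links m1 2 T, stores_links m2 3 M, stores_links m3 4 T',
        stores_matrix m4 5 SA & stores_matrix m4 6 SB] /\
    algorithm1_run canXX canUX c T M T' SA SB.
Proof.
move=> m1 m2 m3 m4; have [sz0 adj0 co0] := input_stored.
have sz1 : sized n q m1 by apply: sized_run.
have sz2 : sized n q m2 by apply: sized_run.
have sz3 : sized n q m3 by apply: sized_run.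
split=> //; have [rE pE] := feasible_candidates feas.
have c0_ge0 e : 0 <= c0 e by rewrite /c0; case: ifP => // /c_ge0.
have z0_ge0 F e : 0 <= zero_on F c0 e by rewrite /zero_on; case: ifP.
have zc F : {in E, zero_on F c0 =1 zero_on F c}.
  by move=> e eE; rewrite /zero_on /c0 eE.
have [T mT sT] : exists2 T, step1 canXX canUX c T & stores_links m1 2 T.
  rewrite /m1 /step1_cmd run_seq; set ma := run (load _ _) m0.
  have [adja coa] : stores_links ma 10 E /\ costs_stored ma 10 (zero_on set0 c0).
    apply: run_load => // m' v x Ev Ex fi; split; last by rewrite inE.
    by rewrite (_ : ieval m' _ = ints m' 1 (ints m' 40 0 0) (ints m' 41 0 0))%N // Ev Ex fi.
  have sza : sized n q ma by apply: sized_run.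
  have [T mT sT] := run_forest rE sza adja (fun e _ => z0_ge0 _ e) coa.
  exists T; last by rewrite run_seq; apply: run_copy_forest => //; apply: sized_run.
  by apply: minimal_spanning_forest_eq mT => e eE; rewrite zc // /zero_on inE.
have adj1 : stores_links m1 1 E by rewrite /stores_links run_ints.
have co1 : costs_stored m1 0 c0 by rewrite /costs_stored run_reals.
have [M mM sM] : exists2 M, step2 canXX canUX c T M & stores_links m2 3 M.
  rewrite /m2 /step2_cmd run_seq; set ma := run (load _ _) m1.
  have [adja coa] : stores_links ma 10 E /\ costs_stored ma 10 (zero_on T c0).
    apply: run_load => // m' v x Ev Ex fi; split.
      by rewrite (_ : ieval m' _ = ints m' 1 (ints m' 40 0 0) (ints m' 41 0 0))%N // Ev Ex fi.
    rewrite beval_nonzero.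
    by rewrite (_ : ieval m' _ = ints m' 2 (ints m' 40 0 0) (ints m' 41 0 0))%N // Ev Ex fi.
  have sza : sized n q ma by apply: sized_run.
  have inst : instance_stored E (zero_on T c0) ma by split.
  have [M mM sM] := run_matching pE inst (fun e _ => z0_ge0 _ e).
  by exists M => //; apply: min_cost_maximum_matching_eq mM => e eE; rewrite zc.
have sT2 : stores_links m2 2 T by rewrite /stores_links run_ints.
have co2 : costs_stored m2 0 c0 by rewrite /costs_stored run_reals.
have TME : T :|: M \subset E.
  by rewrite subUset; case: mT => -> _ _; case: mM => -[[-> _ _] _] _ _.
have [T' mT' sT'] : exists2 T', step3 c T M T' & stores_links m3 4 T'.
  rewrite /m3 /step3_cmd run_seq; set ma := run (load _ _) m2.
  have [adja coa] : stores_links ma 10 (T :|: M) /\ costs_stored ma 10 (zero_on M c0).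
    apply: run_load => // m' v x Ev Ex fi; split.
      rewrite (_ : ieval m' _ = ints m' 2 (ints m' 40 0 0) (ints m' 41 0 0) +
        ints m' 3 (ints m' 40 0 0) (ints m' 41 0 0))%N //.
      by rewrite Ev Ex !fi // addn_eq0 negb_and sT2 sM in_setU.
    rewrite beval_nonzero.
    by rewrite (_ : ieval m' _ = ints m' 3 (ints m' 40 0 0) (ints m' 41 0 0))%N // Ev Ex fi.
  have sza : sized n q ma by apply: sized_run.
  have rTM : reachable (T :|: M).
    by case: mT => _ /spanning_forestP[rT _] _; apply: reachable_sub rT; apply: subsetUl.
  have [T' mT' sT'] := run_forest rTM sza adja (fun e _ => z0_ge0 _ e) coa.
  exists T'; last by rewrite run_seq; apply: run_copy_forest => //; apply: sized_run.
  by apply: minimal_spanning_forest_eq mT' => e /(subsetP TME) eE; rewrite zc.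
have sM3 : stores_links m3 3 M by rewrite /stores_links run_ints.
have [SA [SB sys]] := system_of_links (T' :|: M).
have [sA sB] := run_write_system sz3 sT' sM3 sys.
by exists T, M, T', SA, SB.
Qed.

End Algorithm1.

Theorem theorem2 (R : realType) :
  (* Algorithm 1 never gets stuck and is a 2-approximation algorithm *)
  (forall (n q : nat) (canXX : {set 'I_n * 'I_n}) (canUX : {set 'I_q * 'I_n})
          (c : link n q -> R),
     (forall e, e \in link_union canXX canUX -> 0 <= c e) ->
     feasible R canXX canUX ->
     [/\ exists T, step1 canXX canUX c T,
         forall T, step1 canXX canUX c T -> exists M, step2 canXX canUX c T M,
         forall T M, step1 canXX canUX c T -> step2 canXX canUX c T M ->
           exists T', step3 c T M T'
       & exists2 opt, optimal_value canXX canUX c opt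
           & forall T M T' SA SB, algorithm1_run canXX canUX c T M T' SA SB ->
               feasible_solution R canXX canUX SA SB /\
               total_cost c (system_links SA SB) <= 2%:R * opt]) /\
  (* Algorithm 1 runs in time O((|U| + |X|)^3): p1, ..., p4 carry out its steps *)
  (exists (p1 p2 p3 p4 : program) (K : nat),
     forall (n q : nat) (canXX : {set 'I_n * 'I_n}) (canUX : {set 'I_q * 'I_n})
            (c : link n q -> R),
       (0 < q + n)%N ->
       (forall e, e \in link_union canXX canUX -> 0 <= c e) ->
       feasible R canXX canUX ->
       exists (t1 t2 t3 t4 : nat) (m1 m2 m3 m4 : memory R)
              (T M T' : {set link n q}) (SA : 'M[bool]_n) (SB : 'M[bool]_(n, q)),
         [/\ [/\ exec p1 (input_memory canXX canUX c) t1 m1, exec p2 m1 t2 m2,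
                 exec p3 m2 t3 m3 & exec p4 m3 t4 m4],
             [/\ stores_links m1 2 T, stores_links m2 3 M, stores_links m3 4 T',
                 stores_matrix m4 5 SA & stores_matrix m4 6 SB],
             algorithm1_run canXX canUX c T M T' SA SB
           & (t1 + t2 + t3 + t4 <= K * (q + n) ^ 3)%N]).
Proof.
split=> [n q canXX canUX c c_ge0 feas|].
  have [rE pE] := feasible_candidates feas.
  split; [exact: exists_step1|by move=> T _; exact: (exists_step2 c T pE)
         |by move=> T M sT _; apply: exists_step3 sT|].
  have [opt optP] := exists_optimal c feas; exists opt => // T M T' SA SB.
  exact: algorithm1_approximation.
have cubic p : (depth p <= 3)%N ->
    exists K, forall N, (0 < N)%N -> (cost_bound p N <= K * N ^ 3)%N.
  move=> dp; have [K boundK] := cost_bound_polynomial p; exists K => N N0.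
  by apply: leq_trans (boundK N N0) _; rewrite leq_mul2l leq_pexp2l ?orbT.
(* The nesting depth of each step is computed to be at most 3. *)
have [K1 b1] := cubic step1_cmd isT; have [K2 b2] := cubic step2_cmd isT.
have [K3 b3] := cubic step3_cmd isT; have [K4 b4] := cubic write_system isT.
exists (compile step1_cmd), (compile step2_cmd), (compile step3_cmd), (compile write_system).
exists (K1 + K2 + K3 + K4)%N => n q canXX canUX c N0 c_ge0 feas.
have [[sz0 sz1 sz2 sz3] [T [M [T' [SA [SB [stored alg]]]]]]] := run_algorithm1 c_ge0 feas.
have step_exec p K (m : memory R) : well_formed p -> sized n q m ->
    (forall N, (0 < N)%N -> (cost_bound p N <= K * N ^ 3)%N) ->
    exists2 t, exec (compile p) m t (run p m) & (t <= K * (q + n) ^ 3)%N.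
  move=> wf [mn mq] bp; have [t et le] := exec_run m wf; exists t => //.
  by apply: leq_trans le _; rewrite /size_bound mn mq addnC bp.
have [t1 e1 l1] := step_exec _ K1 _ (isT : well_formed step1_cmd) sz0 b1.
have [t2 e2 l2] := step_exec _ K2 _ (isT : well_formed step2_cmd) sz1 b2.
have [t3 e3 l3] := step_exec _ K3 _ (isT : well_formed step3_cmd) sz2 b3.
have [t4 e4 l4] := step_exec _ K4 _ (isT : well_formed write_system) sz3 b4.
do 4 eexists; do 4 eexists; exists T, M, T', SA, SB; split.
- by split; [exact: e1|exact: e2|exact: e3|exact: e4].
- exact: stored.
- exact: alg.
by rewrite !mulnDl !leq_add.
Qed.
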